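(* Let $\mu\in(0,1)$, $\nu\in[0,1]$, $\omega,\lambda\in\mathbb{C}$, $\rho>0$, $K,\gamma,\delta\ge 0$, and let $f\in L^1[0,\infty)$. The solution of the Cauchy problem $$\mathbf{D}_{\rho,\omega,0^+}^{\gamma,\mu,\nu}y(x)=\lambda\,\mathbf{E}_{\rho,\mu,\omega,0^+}^{\delta}y(x)+f(x),\qquad x>0,$$ $$\Big[\mathbf{E}_{\rho,(1-\nu)(1-\mu),\omega,0^+}^{-\gamma(1-\nu)}y(x)\Big]_{x=0^+}=K,$$ is $$y(x)=K\sum_{n=0}^{\infty}\lambda^{n}x^{\nu(1-\mu)+\mu(2n+1)-1}E_{\rho,\nu(1-\mu)+\mu(2n+1)}^{\gamma-\gamma\nu+n(\delta+\gamma)}(\omega x^{\rho})+\sum_{n=0}^{\infty}\lambda^{n}\,\mathbf{E}_{\rho,(2n+1)\mu,\omega,0^+}^{\gamma+n(\delta+\gamma)}f(x).$$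
   Context: Three-parameter Mittag-Leffler (Prabhakar) function: $E_{\alpha,\beta}^{\gamma}(z)=\sum_{k=0}^\infty \frac{(\gamma)_k}{\Gamma(\alpha k+\beta)}\frac{z^k}{k!}$, where $(\gamma)_k=\Gamma(\gamma+k)/\Gamma(\gamma)=\gamma(\gamma+1)\cdots(\gamma+k-1)$, $\mathrm{Re}(\alpha)>0$. Prabhakar integral: for $\mathrm{Re}(\rho),\mathrm{Re}(\mu)>0$, $\mathbf{E}_{\rho,\mu,\omega,0^+}^{\gamma}g(x)=\int_0^x (x-s)^{\mu-1}E_{\rho,\mu}^{\gamma}[\omega(x-s)^\rho]g(s)\,ds$, with the convention $\mathbf{E}_{\rho,0,\omega,0^+}^{0}g=g$. Hilfer-Prabhakar fractional derivative of order $\mu$, for locally integrable $y$ on $[0,\infty)$ such that $\mathbf{E}_{\rho,(1-\nu)(1-\mu),\omega,0^+}^{-\gamma(1-\nu)}y$ is absolutely continuous on bounded intervals: $$\mathbf{D}_{\rho,\omega,0^+}^{\gamma,\mu,\nu}y(x)=\Big(\mathbf{E}_{\rho,\nu(1-\mu),\omega,0^+}^{-\gamma\nu}\frac{d}{dx}\big(\mathbf{E}_{\rho,(1-\nu)(1-\mu),\omega,0^+}^{-\gamma(1-\nu)}y\big)\Big)(x).$$ The same formulas are used for complex $\omega$ and complex-valued functions.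
   Formalization: For some f in L^1 no solution exists (ν=1, γ=λ=0, f singular at 0), so: any solution equals the formula a.e.; the formula solves it (a.e.) if it lies in the operator's domain with initial value K, e.g. if E^{γν}_{ρ,1-ν(1-μ),ω}f is AC on bounded intervals with limit 0 at 0+. *)

(* Defs.v *)
From HB Require Import structures.
From mathcomp Require Import all_boot all_order all_algebra.
From mathcomp Require Import complex.
From mathcomp Require Import all_classical all_reals all_analysis.

Set Implicit Arguments.
Unset Strict Implicit.
Unset Printing Implicit Defensive.

Import Order.TTheory GRing.Theory Num.Theory.
Import numFieldNormedType.Exports.

Local Open Scope classical_set_scope.
Local Open Scope complex_scope.
Local Open Scope ring_scope.

Section ComplexValued.
Context {R : realType}.
Implicit Types (D : set R) (g : R -> R[i]) (u : nat -> R[i]).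

Definition cintegrable D g : Prop :=
  (@lebesgue_measure R).-integrable D (fun x => (complex.Re (g x))%:E) /\
  (@lebesgue_measure R).-integrable D (fun x => (complex.Im (g x))%:E).

Definition cintegral D g : R[i] :=
  (\int[@lebesgue_measure R]_(x in D) complex.Re (g x)) +i*
  (\int[@lebesgue_measure R]_(x in D) complex.Im (g x)).

Definition cderive g (x : R) : R[i] :=
  derive1 (fun t => complex.Re (g t)) x +i* derive1 (fun t => complex.Im (g t)) x.

(* R[i] carries its topology through the alias R[i]^o. *)
Definition cseries u : nat -> R[i]^o := series (u : nat -> R[i]^o).

Definition csum u : R[i] := limn (cseries u).

Definition loc_integrable g : Prop := forall b : R, cintegrable `[0, b] g.

(* D is meant to be an interval; the sum is a real element of R[i]. *)
Definition abs_continuous D g : Prop :=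
  forall e : R, 0 < e -> exists2 d : R, 0 < d &
  forall (n : nat) (a b : 'I_n -> R),
    (forall i, [/\ D (a i), D (b i) & a i < b i]) ->
    (forall i j, i != j -> b i <= a j \/ b j <= a i) ->
    \sum_(i < n) (b i - a i) < d ->
    \sum_(i < n) `|g (b i) - g (a i)| < e%:C.

(* Absolute continuity on bounded intervals, up to the boundary point 0 but
   regardless of the value at 0: a fractional integral is 0 there (empty
   integration range), whereas its limit at 0+ need not be. *)
Definition loc_abs_continuous g : Prop :=
  forall b : R, 0 < b -> abs_continuous `]0, b] g.

End ComplexValued.

Section Prabhakar.
Context {R : realType}.
Implicit Types (alpha beta gamma delta rho mu nu t x : R).
Implicit Types (omega lambda z : R[i]) (g f y : R -> R[i]).

(* Euler's integral; only used for t > 0. *)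
Definition Gamma t : R :=
  \int[@lebesgue_measure R]_(s in `]0, +oo[) (s `^ (t - 1) * expR (- s)).

Definition pochhammer gamma (k : nat) : R := \prod_(i < k) (gamma + i%:R).

(* E_{alpha,beta}^gamma (z), for alpha, beta > 0. *)
Definition mittag_leffler alpha beta gamma z : R[i] :=
  csum (fun k =>
    (pochhammer gamma k / Gamma (alpha * k%:R + beta))%:C * (z ^+ k / k`!%:R)).

(* The operator of superscript gamma and subscripts rho, mu, omega, 0+. *)
Definition prabhakar gamma rho mu omega g x : R[i] :=
  if (mu == 0) && (gamma == 0) then g x
  else cintegral `[0, x] (fun s =>
    ((x - s) `^ (mu - 1))%:C
    * mittag_leffler rho mu gamma (omega * ((x - s) `^ rho)%:C) * g s).

Definition hp_inner gamma mu nu rho omega y : R -> R[i] :=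
  prabhakar (- gamma * (1 - nu)) rho ((1 - nu) * (1 - mu)) omega y.

Definition hp_domain gamma mu nu rho omega y : Prop :=
  loc_integrable y /\ loc_abs_continuous (hp_inner gamma mu nu rho omega y).

Definition hp_derivative gamma mu nu rho omega y : R -> R[i] :=
  prabhakar (- gamma * nu) rho (nu * (1 - mu)) omega
    (cderive (hp_inner gamma mu nu rho omega y)).

Definition hp_initial gamma mu nu rho omega (K : R) y : Prop :=
  (hp_inner gamma mu nu rho omega y x : R[i]^o) @[x --> 0^'+]
    --> (K%:C : R[i]^o).

Definition hp_equation gamma delta mu nu rho omega lambda f y : Prop :=
  {ae @lebesgue_measure R, forall x, 0 < x ->
    hp_derivative gamma mu nu rho omega y x =
    lambda * prabhakar delta rho mu omega y x + f x}.

Definition hp_solution gamma delta mu nu rho omega lambda (K : R) f y : Prop :=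
  [/\ hp_domain gamma mu nu rho omega y,
      hp_equation gamma delta mu nu rho omega lambda f y &
      hp_initial gamma mu nu rho omega K y].

End Prabhakar.

(* Main.v *)
(* A Hilfer-Prabhakar problem is a linear Volterra equation in disguise. Write
   k(m,g)(t) = t^(m-1) E_{rho,m}^g(omega t^rho). The Vandermonde identity for
   Pochhammer symbols and the Beta integral give the semigroup law
   k(m,g) * k(m',g') = k(m+m',g+g'), with k(1,0) = 1. Convolving the equation
   with the kernels complementary to the two Prabhakar integrals of the
   derivative turns it, after removing a common factor 1 * _ (an injective
   operation), into
     y = K k(beta,g) + k(mu,gamma) * f + lambda k(2mu,delta+gamma) * y,
   and every step can be reversed. Since Gamma grows faster than any geometric
   sequence, the Neumann series of this equation converges; its terms are
   those of the announced solution. Two analytic points remain: an absolutely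
   continuous function is the integral of its derivative (its variation is the
   distribution function of a measure dominated by the Lebesgue measure, to
   which Radon-Nikodym and Lebesgue differentiation apply), and all the identities
   between convolutions are almost everywhere identities, which hold at every
   point where the convolution of |f| with the weakest kernel is finite. *)

Require Import Defs.
From HB Require Import structures.
From mathcomp Require Import all_boot all_order all_algebra.
From mathcomp Require Import complex.
From mathcomp Require Import all_classical all_reals all_analysis.
From mathcomp Require Import measurable_realfun real_interval interval_inference.
From mathcomp Require Import ring lra.

Import Order.TTheory GRing.Theory Num.Theory.
Import numFieldNormedType.Exports.

Local Open Scope classical_set_scope.
Local Open Scope complex_scope.
Local Open Scope ring_scope.

Set Implicit Arguments.
Unset Strict Implicit.
Unset Printing Implicit Defensive.

(** The source [f] is only integrable, and this splits the statement. For a function already in the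
    domain, the equation is integrated and compared with the Volterra equation, all of it up to null
    sets. Membership of the announced function in the domain is another matter: its inner Prabhakar
    integral must be absolutely continuous with a limit at 0, hence be known at every point. The
    source term of index 0 contributes [F] to it, of order [1 - nu (1 - mu)], possibly less than 1,
    which integrability of [f] does not make regular; this is the origin of the conditions on [F] in
    the third conclusion. They give a [w] with [F = 1 * w], so that [f] is almost everywhere the
    outer Prabhakar integral of [w]; rewriting the solution with [w] raises the orders of all
    kernels that appear in its inner integral to at least 1. At such orders convolutions with
    locally integrable functions are finite at every [x > 0], and the identities become pointwise.
    Since the kernels are unbounded at 0, all estimates are by a constant times one
    Riemann-Liouville kernel rather than by a supremum. *)

Section AffineSubstitution.
Local Open Scope ereal_scope.
Context {R : realType}.
Local Notation mu := (@lebesgue_measure R).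

(** The pushforward of the Lebesgue measure under the affine map, scaled by [a], gives every
    half-open interval its length, so it is the Lebesgue measure. *)
Lemma ge0_integral_affine (a b : R) (f : R -> \bar R) :
  (0 < a)%R -> measurable_fun [set: R] f -> (forall x, 0 <= f x) ->
  \int[mu]_x f (a * x + b)%R = a^-1%:E * \int[mu]_x f x.
Proof.
move=> a0 mf f0.
have mphi : measurable_fun (setT : set (measurableTypeR R))
    ((fun x => a * x + b)%R : _ -> measurableTypeR R).
  by apply: measurable_funD => //; exact: mulrl_measurable.
have ai : (0 <= a)%R by exact: ltW.
pose nu0 := [the measure _ _ of
  pushforward mu ((fun x => a * x + b)%R : _ -> measurableTypeR R)].
pose nu1 : {measure set (measurableTypeR R) -> \bar R} := nu0 mphi.
pose nu := mscale (NngNum ai) nu1.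
have nuE : forall A, measurable A -> mu A = nu A.
  apply: lebesgue_measure_unique => _ [[l r]] _ <-.
  change (mu `]l, r] = a%:E * mu ((fun x : R => a * x + b)%R @^-1` `]l, r])).
  rewrite (_ : _ @^-1` _ = `](l - b) / a, (r - b) / a]%classic)%R; last first.
    apply/seteqP; split => x /=; rewrite !in_itv/= ltr_pdivrMr// ler_pdivlMr//
      ltrBlDr lerBrDr [(x * a)%R]mulrC//.
  rewrite !lebesgue_measure_itv/= !lte_fin ltr_pM2r ?invr_gt0// ltrD2r.
  by case: ifPn => _; rewrite ?mule0// -!EFinB -EFinM; congr EFin; field; rewrite gt_eqF.
have -> : \int[mu]_x f x = \int[nu]_x f x.
  by apply: eq_measure_integral => A mA _; exact: nuE.
rewrite ge0_integral_mscale// ge0_integral_pushforward//.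
by rewrite muleA -EFinM mulVf ?gt_eqF// mul1e.
Qed.
End AffineSubstitution.

(** * Convolution of nonnegative functions on the line *)

Section NonnegConvolution.
Local Open Scope ereal_scope.
Context {R : realType}.
Local Notation mu := (@lebesgue_measure R).
Implicit Types (f g h : R -> \bar R).

Lemma ge0_integral_shift (b : R) f : measurable_fun [set: R] f ->
  (forall x, 0 <= f x) -> \int[mu]_x f (x - b)%R = \int[mu]_x f x.
Proof.
move=> mf f0; have := ge0_integral_affine (- b) (@ltr01 R) mf f0.
rewrite invr1 mul1e => <-.
by apply: eq_integral => x _; rewrite mul1r.
Qed.

Lemma lebesgue_tonelli (F : R -> R -> \bar R) :
  measurable_fun [set: R * R] (fun z => F z.1 z.2) ->
  (forall x y, 0 <= F x y) ->
  \int[mu]_x \int[mu]_y F x y = \int[mu]_y \int[mu]_x F x y.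
Proof.
move=> mF F0.
exact: (@fubini_tonelli _ _ (measurableTypeR R) (measurableTypeR R) R mu mu
  (fun z => F z.1 z.2)).
Qed.

Lemma measurable_lebesgue_section (F : R -> R -> \bar R) :
  measurable_fun [set: R * R] (fun z => F z.1 z.2) ->
  (forall x y, 0 <= F x y) ->
  measurable_fun [set: R] (fun x => \int[mu]_y F x y).
Proof.
move=> mF F0.
exact: (@measurable_fun_fubini_tonelli_F _ _ (measurableTypeR R)
  (measurableTypeR R) R mu (fun z => F z.1 z.2)).
Qed.

(** With extended nonnegative values, Tonelli makes associativity unconditional. Applied to moduli,
    finiteness of such a convolution at a point is the condition under which complex convolutions
    are handled there. *)
Definition nconv f g (x : R) : \bar R := \int[mu]_s (f (x - s)%R * g s).

Lemma nconv_ge0 f g x : (forall t, 0 <= f t) -> (forall t, 0 <= g t) ->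
  0 <= nconv f g x.
Proof. by move=> f0 g0; apply: integral_ge0 => s _; exact: mule_ge0. Qed.

Lemma measurable_nconv_kernel f g : measurable_fun [set: R] f ->
  measurable_fun [set: R] g ->
  measurable_fun [set: R * R] (fun z : R * R => f (z.1 - z.2)%R * g z.2).
Proof.
move=> mf mg; apply: emeasurable_funM.
  by apply: (measurableT_comp mf); exact: measurable_funB.
exact: (measurableT_comp mg).
Qed.

Lemma measurable_sub_cst (x : R) : measurable_fun [set: R] (fun s : R => (x - s)%R).
Proof. exact: measurable_funB. Qed.

Lemma measurable_nconv_section f g x : measurable_fun [set: R] f ->
  measurable_fun [set: R] g ->
  measurable_fun [set: R] (fun s : R => f (x - s)%R * g s).
Proof.
move=> mf mg; apply: emeasurable_funM => //.
by apply: (measurableT_comp mf); exact: measurable_sub_cst.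
Qed.

Lemma measurable_nconv f g : measurable_fun [set: R] f ->
  measurable_fun [set: R] g -> (forall t, 0 <= f t) -> (forall t, 0 <= g t) ->
  measurable_fun [set: R] (nconv f g).
Proof.
move=> mf mg f0 g0.
apply: measurable_lebesgue_section; first exact: measurable_nconv_kernel.
by move=> x y; exact: mule_ge0.
Qed.

Lemma integral_nconv f g : measurable_fun [set: R] f ->
  measurable_fun [set: R] g -> (forall t, 0 <= f t) -> (forall t, 0 <= g t) ->
  \int[mu]_x nconv f g x = \int[mu]_x f x * \int[mu]_x g x.
Proof.
move=> mf mg f0 g0.
rewrite lebesgue_tonelli; last 2 first.
- exact: measurable_nconv_kernel.
- by move=> x y; exact: mule_ge0.
rewrite -ge0_integralZl//; last by apply: integral_ge0.
apply: eq_integral => s _; rewrite muleC -(ge0_integral_shift s mf)//.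
rewrite -ge0_integralZl//; first by apply: eq_integral => x _; rewrite muleC.
by apply: (measurableT_comp mf); exact: measurable_funB.
Qed.

Lemma nconvA f g h x : measurable_fun [set: R] f -> measurable_fun [set: R] g ->
  measurable_fun [set: R] h ->
  (forall t, 0 <= f t) -> (forall t, 0 <= g t) -> (forall t, 0 <= h t) ->
  nconv f (nconv g h) x = nconv (nconv f g) h x.
Proof.
move=> mf mg mh f0 g0 h0.
transitivity (\int[mu]_s \int[mu]_t (f (x - s)%R * (g (s - t)%R * h t))).
  apply: eq_integral => s _; rewrite ge0_integralZl//.
  - exact: measurable_nconv_section.
  - by move=> t _; exact: mule_ge0.
rewrite lebesgue_tonelli; last 2 first.
- apply: emeasurable_funM; last exact: measurable_nconv_kernel.
  by apply: (measurableT_comp mf); exact: measurable_funB.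
- by move=> s t; rewrite !mule_ge0.
apply: eq_integral => t _.
rewrite /nconv muleC -ge0_integralZl//; last 2 first.
- exact: measurable_nconv_section.
- by move=> s _; rewrite mule_ge0.
rewrite -[RHS](ge0_integral_shift t).
- apply: eq_integral => s _; rewrite muleA muleC.
  by rewrite (_ : x - t - (s - t) = x - s)%R//; ring.
- by apply: emeasurable_funM => //; exact: measurable_nconv_section.
- by move=> s; rewrite !mule_ge0.
Qed.

Lemma nconvZ (a b : R) f g x : (0 <= a)%R -> (0 <= b)%R ->
  measurable_fun [set: R] f ->
  measurable_fun [set: R] g -> (forall t, 0 <= f t) -> (forall t, 0 <= g t) ->
  nconv (fun t => a%:E * f t) (fun t => b%:E * g t) x = (a * b)%:E * nconv f g x.
Proof.
move=> a0 b0 mf mg f0 g0; rewrite -ge0_integralZl//.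
- by apply: eq_integral => s _; rewrite EFinM muleACA.
- exact: measurable_nconv_section.
- by move=> s _; rewrite mule_ge0.
- by rewrite lee_fin mulr_ge0.
Qed.

(* For functions supported in [0, +oo[, the values of [nconv f g] on [0, b]
   only involve f and g on [0, b]. *)
Lemma integral_nconv_itv f g (b : R) : measurable_fun [set: R] f ->
  measurable_fun [set: R] g -> (forall t, 0 <= f t) -> (forall t, 0 <= g t) ->
  (forall t, (t < 0)%R -> f t = 0) -> (forall t, (t < 0)%R -> g t = 0) ->
  \int[mu]_(x in `[0%R, b]) nconv f g x <=
  \int[mu]_(x in `[0%R, b]) f x * \int[mu]_(x in `[0%R, b]) g x.
Proof.
move=> mf mg f0 g0 fN gN.
have mr (h : R -> \bar R) : measurable_fun [set: R] h -> measurable_fun [set: R] (h \_ `[0%R, b]).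
  by move=> mh; apply/(measurable_restrictT _ _).1 => //; exact: measurable_funTS.
have r0 (h : R -> \bar R) : (forall t, 0 <= h t) -> forall t, 0 <= (h \_ `[0%R, b]) t.
  by move=> h0 t; rewrite patchE; case: ifP.
rewrite [X in _ <= X * _]integral_mkcond [X in _ <= _ * X]integral_mkcond.
rewrite -integral_nconv; [|exact: mr|exact: mr|exact: r0|exact: r0].
rewrite integral_mkcond; apply: ge0_le_integral => //.
- by move=> x _; apply: r0 => t; exact: nconv_ge0.
- by apply: mr; exact: measurable_nconv.
- by apply: measurable_nconv; [exact: mr|exact: mr|exact: r0|exact: r0].
move=> x _; rewrite patchE; case: ifPn => [|_]; last first.
  by apply: nconv_ge0; exact: r0.
rewrite inE/= in_itv/= => /andP[x0 xb].
rewrite le_eqVlt; apply/orP; left; apply/eqP; apply: eq_integral => s _.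
have [s0|s0] := ltP s 0%R.
  by rewrite gN// mule0 [X in _ * X]patchE ifF ?mule0//; apply/negbTE/negP;
    rewrite inE/= in_itv/= leNgt s0.
have [xs|xs] := ltP x s.
  by rewrite fN ?mul0e ?subr_lt0// [X in X * _]patchE ifF ?mul0e//; apply/negbTE/negP;
    rewrite inE/= in_itv/= subr_ge0 leNgt xs.
rewrite !patchE !ifT//; rewrite inE/= in_itv/= ?subr_ge0 ?xs ?s0/=.
  by rewrite (le_trans xs).
by rewrite (le_trans _ xb)// gerBl.
Qed.

End NonnegConvolution.

(** * Riemann-Liouville kernels and the Gamma function *)

Section PowerKernel.
Context {R : realType}.
Local Notation mu := (@lebesgue_measure R).
Implicit Types (a b c t x : R).

(** Vanishing for [t <= 0] turns convolutions over the line into integrals over [[0, x]]. *)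
Definition pw a t : R := if 0 < t then t `^ (a - 1) else 0.

Lemma pw_ge0 a t : 0 <= pw a t.
Proof. by rewrite /pw; case: ifP => // _; exact: powR_ge0. Qed.

Lemma measurable_pw a : measurable_fun [set: R] (pw a).
Proof.
apply: measurable_fun_ifT; [exact: measurable_fun_ltr|exact: measurable_powR|].
exact: measurable_cst.
Qed.

Lemma measurable_EFin_pw a : measurable_fun [set: R] (EFin \o pw a).
Proof. by apply/measurable_EFinP; exact: measurable_pw. Qed.

Lemma powRD_gt0 x a b : 0 < x -> x `^ (a + b) = x `^ a * x `^ b.
Proof. by move=> x0; rewrite powRD// (gt_eqF x0) implybT. Qed.

Lemma powRB1_gt0 x a : 0 < x -> x `^ (a - 1) = x `^ a / x.
Proof.
by move=> x0; rewrite powRB ?(gt_eqF x0) ?implybT// powRr1//; exact: ltW.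
Qed.

Lemma integral_powR_lt a e c : 0 < a -> 0 < e -> e < c ->
  (\int[mu]_(t in `[e, c]) (t `^ (a - 1))%:E = (c `^ a / a - e `^ a / a)%:E)%E.
Proof.
move=> a0 e0 ec.
have d t (t0 : 0 < t) : is_derive t 1 (fun t => t `^ a / a) (t `^ (a - 1)).
  have := is_derive1_powR a t0.
  move=> /(@is_deriveM _ _ _ _ _ _ _ _)/(_ (is_derive_cst a^-1 t 1)) h.
  apply: (is_derive_eq h).
  by rewrite scaler0 add0r/= /GRing.scale/= mulrA mulVf ?mul1r// gt_eqF.
apply: (@continuous_FTC2 R (fun t => t `^ (a - 1)) (fun t => t `^ a / a) e c ec).
- apply: derivable_within_continuous => t; rewrite in_itv/= => /andP[et _].
  by apply: derivable_powR; rewrite in_itv/= (lt_le_trans e0 et).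
- split.
  + move=> t; rewrite in_itv/= => /andP[et _].
    by have [] := d t (lt_trans e0 et).
  + have [/derivable1_diffP/differentiable_continuous h _] := d _ e0.
    exact: cvg_at_right_filter h.
  + have [/derivable1_diffP/differentiable_continuous h _] := d _ (lt_trans e0 ec).
    exact: cvg_at_left_filter h.
- move=> t; rewrite in_itv/= => /andP[et _].
  by rewrite derive1E; have [_] := d t (lt_trans e0 et).
Qed.

(** For [a < 1] the integrand is unbounded at 0, so the primitive is used on [[c / i.+1, c]] and
    monotone convergence passes to the limit; the boundary term dropped is nonnegative. *)
Lemma integral_pw_le a c : 0 < a -> 0 < c ->
  (\int[mu]_(t in `]0%R, c]) (pw a t)%:E <= (c `^ a / a)%:E)%E.
Proof.
move=> a0 c0.
pose F (i : nat) : set R := [set` `[c / i.+1%:R, c]].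
have FE : \bigcup_i F i = [set` `]0, c]].
  apply/seteqP; split => t /=; rewrite in_itv/=.
    move=> [i _]; rewrite /F/= in_itv/= => /andP[it ->]; rewrite andbT.
    by apply: lt_le_trans it; rewrite divr_gt0.
  move=> /andP[t0 tc]; exists (Num.truncn (c / t)) => //.
  rewrite /F/= in_itv/= tc andbT ler_pdivrMr// mulrC -ler_pdivrMr//.
  by apply: ltW; exact: truncnS_gt.
have ndF : {homo F : m n / (m <= n)%N >-> (m <= n)%O}.
  move=> m n mn; rewrite subsetEset => x; rewrite /F/= !in_itv/= => /andP[mx ->].
  by rewrite andbT; apply: le_trans mx; rewrite ler_pM2l// lef_pV2 ?posrE// ler_nat ltnS.
have cv : (\int[mu]_(t in F i) (EFin \o pw a) t @[i --> \oo] -->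
    \int[mu]_(t in \bigcup_i F i) (EFin \o pw a) t)%E.
  apply: ge0_nondecreasing_set_cvg_integral => //.
  - by move=> i; exact: measurable_itv.
  - by move=> i; apply: measurable_funTS; exact: measurable_EFin_pw.
  - by move=> i x _; rewrite lee_fin pw_ge0.
rewrite -FE -(cvg_lim _ cv)//; apply: lime_le; first by apply/cvg_ex; eexists; exact: cv.
near=> i.
have i0 : (0 < i)%N by near: i; exact: nbhs_infty_gt.
have e0 : 0 < c / i.+1%:R by rewrite divr_gt0.
have ec : c / i.+1%:R < c by rewrite ltr_pdivrMr// ltr_pMr// ltr1n.
have -> : (\int[mu]_(t in F i) (EFin \o pw a) t)%E =
    (c `^ a / a - (c / i.+1%:R) `^ a / a)%:E.
  rewrite -integral_powR_lt//; apply: eq_integral => t.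
  rewrite inE /F/= in_itv/= => /andP[it _]; rewrite /pw ifT//.
  exact: lt_le_trans it.
by rewrite lee_fin gerBl divr_ge0 ?powR_ge0// ltW.
Unshelve. all: by end_near. Qed.

(** For [s = t / (2 * a)] this is [ln s <= s], multiplied by [a] and exponentiated. Only half of the
    exponent is spent, so the Gamma integrand keeps an exponential tail. *)
Lemma powR_le_exp a t : 0 < a -> 0 < t -> t `^ a <= (2 * a) `^ a * expR (t / 2).
Proof.
move=> a0 t0.
have a20 : 0 < 2 * a by rewrite mulr_gt0.
have tE : t = 2 * a * (t / (2 * a)) by field; rewrite gt_eqF.
set s := t / (2 * a) in tE; have s0 : 0 < s by rewrite divr_gt0.
rewrite {1}tE powRM; [|exact: ltW|exact: ltW].
rewrite ler_wpM2l ?powR_ge0//.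
rewrite /powR gt_eqF// ler_expR (_ : t / 2 = a * s); last first.
  by rewrite /s; field; rewrite gt_eqF.
rewrite ler_pM2l//.
have : -1 < s - 1 by rewrite ltrBrDr addNr.
by move=> /le_ln1Dx; rewrite addrC subrK => /le_trans; apply; rewrite gerBl.
Qed.

(** Euler's integral before [fine]: in the extended reals a product of two such integrals is the
    integral of a convolution, before any finiteness is known. *)
Definition egamma a : \bar R := (\int[mu]_t (pw a t * expR (- t))%:E)%E.

Lemma measurable_egamma a : measurable_fun [set: R] (fun t => (pw a t * expR (- t))%:E).
Proof.
apply/measurable_EFinP; apply: measurable_funM; first exact: measurable_pw.
by apply: measurableT_comp => //; exact: measurable_oppr.
Qed.

Lemma GammaE a : Gamma a = fine (egamma a).
Proof.
rewrite /Gamma /Rintegral; congr fine; rewrite integral_mkcond; apply: eq_integral => t _.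
rewrite patchE /pw; have [t0|t0] := ltP 0 t.
  by rewrite mem_set//= in_itv/= t0.
by rewrite mul0r ifF//; apply/negbTE/negP; rewrite inE/= in_itv/= andbT ltNge t0.
Qed.

Lemma egamma_fin_num a : 0 < a -> egamma a \is a fin_num.
Proof.
move=> a0; rewrite ge0_fin_numE; last first.
  by apply: integral_ge0 => t _; rewrite lee_fin mulr_ge0 ?pw_ge0 ?expR_ge0.
(* The constant of [powR_le_exp], times 2 to cancel the rate 1/2 that normalises the exponential
   density majorising the tail beyond 1. *)
pose C : R := (2 * a) `^ a * 2.
have C0 : 0 <= C by rewrite mulr_ge0 ?powR_ge0.
apply: (@le_lt_trans _ _ (\int[mu]_t (((EFin \o pw a) \_ `]0%R, 1%R]) t +
    C%:E * (exponential_pdf (2^-1) t)%:E))%E).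
  have me : measurable_fun [set: R] (fun t => C%:E * (exponential_pdf (2^-1 : R) t)%:E)%E.
    apply: measurable_funeM; apply/measurable_EFinP; exact: measurable_exponential_pdf.
  have mp : measurable_fun [set: R] ((EFin \o pw a) \_ `]0%R, 1%R]).
    apply/(measurable_restrictT _ _).1 => //; apply: measurable_funTS.
    exact: measurable_EFin_pw.
  have p0 t : (0 <= ((EFin \o pw a) \_ `]0%R, 1%R]) t)%E.
    by rewrite patchE; case: ifP => //= _; rewrite lee_fin pw_ge0.
  have e0 t : (0 <= C%:E * (exponential_pdf (2^-1 : R) t)%:E)%E.
    by rewrite mule_ge0// lee_fin// exponential_pdf_ge0// invr_ge0.
  apply: ge0_le_integral => //.
  - by move=> t _; rewrite lee_fin mulr_ge0 ?pw_ge0 ?expR_ge0.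
  - exact: measurable_egamma.
  - exact: emeasurable_funD.
  move=> t _; have [t0|t0] := leP t 0.
    by rewrite /pw ltNge t0 mul0r adde_ge0.
  have [t1|t1] := leP t 1.
    rewrite patchE mem_set/= ?in_itv/= ?t0 ?t1// -[leLHS]adde0 leeD//.
    by rewrite lee_fin ler_piMr ?pw_ge0// -expR0 ler_expR oppr_le0 ltW.
  rewrite -[leLHS]add0e leeD// -EFinM lee_fin /exponential_pdf patchE.
  rewrite mem_set/=; last by rewrite in_itv/= andbT ltW.
  rewrite (_ : C * _ = (2 * a) `^ a * expR (- 2^-1 * t)); last by rewrite /C; field.
  rewrite /pw t0.
  apply: (@le_trans _ _ (t `^ a * expR (- t))).
    by rewrite ler_wpM2r ?expR_ge0//; apply: ler_powR; [exact: ltW|rewrite gerBl].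
  apply: le_trans (ler_wpM2r (expR_ge0 _) (powR_le_exp a0 t0)) _.
  rewrite -mulrA -expRD ler_wpM2l ?powR_ge0// ler_expR.
  by rewrite le_eqVlt; apply/orP; left; apply/eqP; field.
rewrite ge0_integralD//=.
- rewrite -integral_mkcond ge0_integralZl//=.
  + rewrite integral_exponential_pdf ?invr_gt0// mule1 lte_add_pinfty ?ltry//.
    exact: le_lt_trans (integral_pw_le a0 (@ltr01 R)) (ltry _).
  + by apply/measurable_EFinP; exact: measurable_exponential_pdf.
  + by move=> t _; rewrite lee_fin exponential_pdf_ge0// invr_ge0.
- by move=> t _; rewrite patchE; case: ifP => //= _; rewrite lee_fin pw_ge0.
- by apply/(measurable_restrictT _ _).1 => //; apply: measurable_funTS;
    exact: measurable_EFin_pw.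
- by move=> t _; rewrite mule_ge0// lee_fin// exponential_pdf_ge0// invr_ge0.
- by apply: measurable_funeM; apply/measurable_EFinP; exact: measurable_exponential_pdf.
Qed.

Lemma egammaE a : 0 < a -> egamma a = (Gamma a)%:E.
Proof. by move=> a0; rewrite GammaE fineK ?egamma_fin_num. Qed.

(* The mass of [B, B + 1] alone already makes Gamma grow faster than any
   geometric sequence. *)
Lemma Gamma_ge B : 0 < B -> exists2 c, 0 < c & forall a, 0 < a -> c * B `^ a <= Gamma a.
Proof.
move=> B0; have B10 : 0 < B + 1 by rewrite addr_gt0.
exists (expR (- (B + 1)) / (B + 1)); first by rewrite divr_gt0 ?expR_gt0.
move=> a a0; rewrite -lee_fin -egammaE//.
set k := expR _ / _ * _.
have k0 : 0 <= k by rewrite !mulr_ge0 ?expR_ge0 ?invr_ge0 ?powR_ge0// ltW.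
have -> : k%:E = (\int[mu]_(t in `[B, (B + 1)%R]) (cst k%:E) t)%E.
  rewrite integral_cst//= lebesgue_measure_itv/= lte_fin ltrDl ltr01 -EFinB.
  by rewrite addrAC subrr add0r mule1.
have mI : measurable (`[B, (B + 1)%R]%classic : set R) by exact: measurable_itv.
apply: le_trans (ge0_subset_integral mu mI measurableT
  (@measurable_egamma a) _ _) => //; last first.
  by move=> t _; rewrite lee_fin mulr_ge0 ?pw_ge0 ?expR_ge0.
apply: ge0_le_integral => //.
- by apply: measurable_funTS; exact: measurable_egamma.
move=> t /=; rewrite in_itv/= => /andP[Bt tB]; rewrite lee_fin.
have t0 : 0 < t by exact: lt_le_trans Bt.
rewrite /k -mulrA mulrC; apply: ler_pM.
- by rewrite mulr_ge0 ?powR_ge0 ?invr_ge0// ltW.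
- exact: expR_ge0.
- rewrite /pw t0 powRB1_gt0// mulrC; apply: ler_pM.
  + exact: powR_ge0.
  + by rewrite invr_ge0 ltW.
  + by apply: ge0_ler_powR => //; rewrite ?nnegrE ltW.
  + by rewrite lef_pV2 ?posrE.
- by rewrite ler_expR lerN2.
Qed.

Lemma Gamma_gt0 a : 0 < a -> 0 < Gamma a.
Proof.
move=> a0; have [c c0 /(_ a a0)] := Gamma_ge (@ltr01 R).
by apply: lt_le_trans; rewrite powR1 mulr1.
Qed.

Definition ebeta a b : \bar R := nconv (EFin \o pw a) (EFin \o pw b) 1.

(** Homogeneity: replacing the variable by [x * s] extracts the power of [x] and leaves the Beta
    integral, the value at 1. *)
Lemma nconv_pw a b x :
  nconv (EFin \o pw a) (EFin \o pw b) x = ((pw (a + b) x)%:E * ebeta a b)%E.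
Proof.
have p0 c t : (0 <= (EFin \o pw c) t)%E by rewrite lee_fin pw_ge0.
have [x0|x0] := leP x 0.
  rewrite /pw ltNge x0 mul0e /nconv integral0_eq// => s _ /=; rewrite subr_gt0.
  case: ltP => [sx|_]; last by rewrite mul0e.
  by rewrite [X in (_ * X%:E)%E]ifF ?mule0//; apply/negbTE; rewrite -leNgt (le_trans (ltW sx)).
pose phi s := ((EFin \o pw a) (x - s)%R * (EFin \o pw b) s)%E.
have mphi : measurable_fun [set: R] phi.
  exact: (measurable_nconv_section x (@measurable_EFin_pw a) (@measurable_EFin_pw b)).
have phi0 s : (0 <= phi s)%E by apply: mule_ge0; exact: p0.
have x0' : (0 <= x%:E)%E by rewrite lee_fin ltW.
have -> : nconv (EFin \o pw a) (EFin \o pw b) x = (x%:E * \int[mu]_s phi (x * s + 0)%R)%E.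
  rewrite (ge0_integral_affine 0 x0 mphi phi0) muleA -EFinM mulfV ?mul1e//.
  by rewrite gt_eqF.
have mphi' : measurable_fun [set: R] (fun s => phi (x * s + 0)).
  by apply: (measurableT_comp mphi); apply: measurable_funD => //; exact: mulrl_measurable.
rewrite -(@ge0_integralZl _ _ _ mu _ measurableT _ mphi' _ (fun s _ => phi0 _) x0').
have mphi1 : measurable_fun [set: R] (fun s => (EFin \o pw a) (1 - s)%R * (EFin \o pw b) s)%E.
  exact: (measurable_nconv_section 1 (@measurable_EFin_pw a) (@measurable_EFin_pw b)).
rewrite /ebeta /nconv -(@ge0_integralZl _ _ _ mu _ measurableT _ mphi1 _
  (fun s _ => mule_ge0 (p0 a _) (p0 b _)) (p0 (a + b) x)).
apply: eq_integral => s _; rewrite /phi addr0 /= -!EFinM; congr EFin.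
rewrite /pw x0 (_ : x - x * s = x * (1 - s)); last by ring.
rewrite !pmulr_rgt0//; case: (ltP 0 (1 - s)) => s1; last by rewrite !(mul0r, mulr0).
case: ltP => s0; last by rewrite !mulr0.
have x0w := ltW x0; have s1w := ltW s1; have s0w := ltW s0.
rewrite (powRM _ x0w s1w) (powRM _ x0w s0w).
rewrite (_ : a + b - 1 = 1 + (a - 1) + (b - 1)); last by ring.
rewrite !powRD_gt0// (powRr1 x0w); ring.
Qed.

(** The product of [expR (- (x - s))] and [expR (- s)] does not depend on [s], so the convolution of
    the two Gamma integrands is [expR (- x)] times that of the powers; [integral_nconv] integrates
    it. *)
Lemma egammaM a b : 0 < a -> 0 < b ->
  (egamma a * egamma b = ebeta a b * egamma (a + b))%E.
Proof.
move=> a0 b0.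
have e0 c t : (0 <= (pw c t * expR (- t))%:E)%E.
  by rewrite lee_fin mulr_ge0 ?pw_ge0 ?expR_ge0.
have p0 c t : (0 <= (EFin \o pw c) t)%E by rewrite lee_fin pw_ge0.
rewrite /egamma -(integral_nconv (@measurable_egamma a) (@measurable_egamma b))//.
rewrite -ge0_integralZl//; [|exact: measurable_egamma|exact: nconv_ge0].
apply: eq_integral => x _; rewrite EFinM muleA [X in (X * _)%E]muleC -nconv_pw muleC.
have mphi : measurable_fun [set: R] (fun s => (EFin \o pw a) (x - s)%R * (EFin \o pw b) s)%E.
  exact: (measurable_nconv_section x (@measurable_EFin_pw a) (@measurable_EFin_pw b)).
rewrite -(@ge0_integralZl _ _ _ mu _ measurableT _ mphi (expR (- x))%:E
  (fun s _ => mule_ge0 (p0 a _) (p0 b _))); last by rewrite lee_fin expR_ge0.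
apply: eq_integral => s _; rewrite /= -!EFinM; congr EFin.
rewrite (_ : - x = - (x - s) + - s); last by ring.
rewrite expRD; ring.
Qed.

Local Opaque Gamma.

(** The kernel of the Riemann-Liouville integral of order [a]; dividing by [Gamma a] is what makes
    these kernels a convolution semigroup. *)
Definition rlk a t : R := pw a t / Gamma a.

Lemma rlk_ge0 a t : 0 < a -> 0 <= rlk a t.
Proof. by move=> a0; rewrite mulr_ge0 ?pw_ge0// invr_ge0 ltW ?Gamma_gt0. Qed.

Lemma measurable_rlk a : measurable_fun [set: R] (rlk a).
Proof. by apply: measurable_funM => //; exact: measurable_pw. Qed.

Lemma nconv_rlk a b x : 0 < a -> 0 < b ->
  nconv (EFin \o rlk a) (EFin \o rlk b) x = (rlk (a + b) x)%:E.
Proof.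
move=> a0 b0; have ab0 : 0 < a + b by rewrite addr_gt0.
have Ga := Gamma_gt0 a0; have Gb := Gamma_gt0 b0; have Gab := Gamma_gt0 ab0.
have p0 c t : (0 <= (EFin \o pw c) t)%E by rewrite lee_fin pw_ge0.
transitivity (nconv (fun t => (Gamma a)^-1%:E * (EFin \o pw a) t)%E
  (fun t => (Gamma b)^-1%:E * (EFin \o pw b) t)%E x).
  by congr nconv; apply/funext => t /=; rewrite -EFinM mulrC.
have Gi c : 0 < c -> 0 <= (Gamma c)^-1 by move=> c0; rewrite invr_ge0 ltW ?Gamma_gt0.
rewrite (nconvZ x (Gi _ a0) (Gi _ b0) (@measurable_EFin_pw a) (@measurable_EFin_pw b)
  (p0 a) (p0 b)) nconv_pw.
have : ebeta a b = (Gamma a * Gamma b / Gamma (a + b))%:E.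
  have := egammaM a0 b0; rewrite !egammaE// -EFinM.
  have := nconv_ge0 1 (p0 a) (p0 b); rewrite -/(ebeta a b).
  (* An infinite Beta integral would make the finite product [Gamma a * Gamma b] infinite. *)
  case: (ebeta a b) => [r _ /=|_|//]; last by rewrite mulyr gtr0_sg// mul1e.
  by rewrite -EFinM => -[->]; rewrite mulfK ?gt_eqF.
move=> ->; rewrite -!EFinM; congr EFin; rewrite /rlk.
move: (Gamma a) (Gamma b) (Gamma (a + b)) (pw (a + b) x) Ga Gb Gab => A B C D A0 B0 C0.
by field; rewrite !gt_eqF.
Qed.

End PowerKernel.

(** * Complex-valued integrals *)

Section ComplexModulus.
Context {R : realType}.
Implicit Types (z w : R[i]) (a : R).

(** The norm of [R[i]] takes its values in [R[i]]; integrals and series bounds want a real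
    modulus. *)
Definition cmod z : R := complex.Re `|z|.

Lemma normC_cmod z : `|z| = (cmod z)%:C.
Proof. by []. Qed.

Lemma cReD z w : complex.Re (z + w) = complex.Re z + complex.Re w.
Proof. by case: z w => ? ? [? ?]. Qed.
Lemma cImD z w : complex.Im (z + w) = complex.Im z + complex.Im w.
Proof. by case: z w => ? ? [? ?]. Qed.
Lemma cReM z w : complex.Re (z * w) =
  complex.Re z * complex.Re w - complex.Im z * complex.Im w.
Proof. by case: z w => ? ? [? ?]. Qed.
Lemma cImM z w : complex.Im (z * w) =
  complex.Re z * complex.Im w + complex.Im z * complex.Re w.
Proof. by case: z w => ? ? [? ?]. Qed.
Lemma cReN z : complex.Re (- z) = - complex.Re z.
Proof. by case: z. Qed.
Lemma cImN z : complex.Im (- z) = - complex.Im z.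
Proof. by case: z. Qed.

Lemma complex_ext z w : complex.Re z = complex.Re w -> complex.Im z = complex.Im w -> z = w.
Proof. by case: z w => ? ? [? ?] /= -> ->. Qed.

Lemma cmodM z w : cmod (z * w) = cmod z * cmod w.
Proof. by rewrite /cmod normrM cReM/= mulr0 subr0. Qed.

Lemma cmod0 : cmod 0 = 0.
Proof. by rewrite /cmod normr0. Qed.

Lemma cmod_ge0 z : 0 <= cmod z.
Proof. by case: z => a b; exact: sqrtr_ge0. Qed.

Lemma cmodE z : cmod z = Num.sqrt (complex.Re z ^+ 2 + complex.Im z ^+ 2).
Proof. by case: z. Qed.

Lemma cmod_real a : cmod a%:C = `|a|.
Proof. by rewrite cmodE/= expr0n/= addr0 sqrtr_sqr. Qed.

Lemma ler_cmodD z w : cmod (z + w) <= cmod z + cmod w.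
Proof. by have := ler_normD z w; rewrite !normC_cmod -rmorphD/= lecR. Qed.

Lemma ler_cmod_sum I (r : seq I) (P : pred I) (F : I -> R[i]) :
  cmod (\sum_(i <- r | P i) F i) <= \sum_(i <- r | P i) cmod (F i).
Proof.
elim/big_ind2 : _ => [|z x w y zx wy|//]; first by rewrite cmod0.
by apply: le_trans (ler_cmodD _ _) _; exact: lerD.
Qed.

Lemma cmodX z n : cmod (z ^+ n) = cmod z ^+ n.
Proof.
elim: n => [|n IH]; first by rewrite !expr0 (cmod_real 1) normr1.
by rewrite !exprS cmodM IH.
Qed.

Lemma normr_Re_le z : `|complex.Re z| <= cmod z.
Proof. by rewrite cmodE -sqrtr_sqr ler_wsqrtr// lerDl sqr_ge0. Qed.

Lemma normr_Im_le z : `|complex.Im z| <= cmod z.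
Proof. by rewrite cmodE -sqrtr_sqr ler_wsqrtr// lerDr sqr_ge0. Qed.

Lemma cmod_le_ReIm z : cmod z <= `|complex.Re z| + `|complex.Im z|.
Proof.
rewrite cmodE -[leRHS]ger0_norm ?addr_ge0// -sqrtr_sqr ler_wsqrtr//.
by rewrite sqrrD !real_normK ?num_real// lerD2r lerDl mulrn_wge0// mulr_ge0.
Qed.

Lemma cmod_eq0 z : cmod z = 0 -> z = 0.
Proof. by move=> z0; apply/eqP; rewrite -normr_eq0 normC_cmod z0. Qed.

End ComplexModulus.

Section ComplexMeasurable.
Context {R : realType} d (T : measurableType d).
Implicit Types (D : set T) (f g : T -> R[i]).

Definition cmeasurable D f := measurable_fun D (fun x => complex.Re (f x)) /\
  measurable_fun D (fun x => complex.Im (f x)).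

Lemma cmeasurableM D f g : cmeasurable D f -> cmeasurable D g ->
  cmeasurable D (fun x => f x * g x).
Proof.
move=> [f1 f2] [g1 g2]; split.
  rewrite (_ : (fun _ => _) = fun x => complex.Re (f x) * complex.Re (g x) -
    complex.Im (f x) * complex.Im (g x)); last by apply/funext => x; rewrite cReM.
  by apply: measurable_funB; exact: measurable_funM.
rewrite (_ : (fun _ => _) = fun x => complex.Re (f x) * complex.Im (g x) +
  complex.Im (f x) * complex.Re (g x)); last by apply/funext => x; rewrite cImM.
by apply: measurable_funD; exact: measurable_funM.
Qed.

Lemma cmeasurableD D f g : cmeasurable D f -> cmeasurable D g ->
  cmeasurable D (fun x => f x + g x).
Proof.
move=> [f1 f2] [g1 g2]; split.
  rewrite (_ : (fun _ => _) = fun x => complex.Re (f x) + complex.Re (g x)).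
    exact: measurable_funD.
  by apply/funext => x; rewrite cReD.
rewrite (_ : (fun _ => _) = fun x => complex.Im (f x) + complex.Im (g x)).
  exact: measurable_funD.
by apply/funext => x; rewrite cImD.
Qed.

Lemma cmeasurable_cst D c : cmeasurable D (fun=> c : R[i]).
Proof. by split; exact: measurable_cst. Qed.

Lemma cmeasurable_sum D n (F : 'I_n -> T -> R[i]) :
  (forall i, cmeasurable D (F i)) -> cmeasurable D (fun x => \sum_(i < n) F i x).
Proof.
elim: n F => [|n IH] F mF.
  rewrite (_ : (fun _ => _) = fun=> 0); first exact: cmeasurable_cst.
  by apply/funext => x; rewrite big_ord0.
rewrite (_ : (fun _ => _) = fun x => \sum_(i < n) F (widen_ord (leqnSn n) i) x + F ord_max x).
  by apply: cmeasurableD => //; exact: IH.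
by apply/funext => x; rewrite big_ord_recr.
Qed.

Lemma cmeasurable_real D (h : T -> R) : measurable_fun D h ->
  cmeasurable D (fun x => (h x)%:C).
Proof. by move=> mh; split => //=; exact: measurable_cst. Qed.

Lemma measurable_cmod D f : cmeasurable D f -> measurable_fun D (fun x => cmod (f x)).
Proof.
move=> [f1 f2].
rewrite (_ : (fun _ => _) = (fun y => y `^ 2^-1) \o
    (fun x => complex.Re (f x) ^+ 2 + complex.Im (f x) ^+ 2)).
  apply: measurableT_comp; first exact: measurable_powR.
  by apply: measurable_funD; apply: measurable_funX.
apply/funext => x /=; rewrite cmodE powR12_sqrt// addr_ge0// sqr_ge0//.
Qed.

Lemma measurable_EFin_cmod D f : cmeasurable D f ->
  measurable_fun D (fun x => (cmod (f x))%:E).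
Proof. by move=> mf; apply/measurable_EFinP; exact: measurable_cmod. Qed.

Lemma cmeasurableS D E f : measurable E -> D `<=` E -> cmeasurable E f -> cmeasurable D f.
Proof. by move=> mE DE [f1 f2]; split; exact: measurable_funS DE _. Qed.

End ComplexMeasurable.

Lemma cmeasurableT_comp {R : realType} d1 d2 (T1 : measurableType d1) (T2 : measurableType d2)
  (f : T2 -> R[i]) (h : T1 -> T2) : cmeasurable [set: T2] f -> measurable_fun [set: T1] h ->
  cmeasurable [set: T1] (fun x => f (h x)).
Proof. by move=> [f1 f2] mh; split; [exact: measurableT_comp f1 mh|exact: measurableT_comp f2 mh]. Qed.

Section ComplexIntegral.
Context {R : realType}.
Local Notation mu := (@lebesgue_measure R).
Implicit Types (D : set R) (f g : R -> R[i]).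

Lemma cintegrableP D g : measurable D -> cintegrable D g <->
  cmeasurable D g /\ (\int[mu]_(x in D) (cmod (g x))%:E < +oo)%E.
Proof.
move=> mD; split=> [[gR gI]|[[g1 g2] goo]].
  have mg : cmeasurable D g.
    by split; apply/measurable_EFinP; [case/integrableP: gR|case/integrableP: gI].
  split => //.
  apply: (@le_lt_trans _ _ (\int[mu]_(x in D) (`|(complex.Re (g x))%:E| + `|(complex.Im (g x))%:E|))%E).
    apply: ge0_le_integral => //.
    - by move=> x _; rewrite lee_fin cmod_ge0.
    - exact: measurable_EFin_cmod.
    - by apply: emeasurable_funD; apply: measurableT_comp => //; apply/measurable_EFinP;
        case: mg.
    - by move=> x _; rewrite lee_fin cmod_le_ReIm.
  rewrite ge0_integralD//; last 2 first.
  - by apply: measurableT_comp => //; apply/measurable_EFinP; case: mg.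
  - by apply: measurableT_comp => //; apply/measurable_EFinP; case: mg.
  by apply: lte_add_pinfty; [case/integrableP: gR|case/integrableP: gI].
have mg : cmeasurable D g by [].
split; apply/integrableP; split.
- exact/measurable_EFinP.
- apply: le_lt_trans goo; apply: ge0_le_integral => //.
  + by apply: measurableT_comp => //; exact/measurable_EFinP.
  + exact: measurable_EFin_cmod.
  + by move=> x _; rewrite lee_fin normr_Re_le.
- exact/measurable_EFinP.
- apply: le_lt_trans goo; apply: ge0_le_integral => //.
  + by apply: measurableT_comp => //; exact/measurable_EFinP.
  + exact: measurable_EFin_cmod.
  + by move=> x _; rewrite lee_fin normr_Im_le.
Qed.

Lemma cintegrableD D f g : measurable D -> cintegrable D f -> cintegrable D g ->
  cintegrable D (fun x => f x + g x).
Proof.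
move=> mD [f1 f2] [g1 g2]; split.
  rewrite (_ : (fun _ => _) = fun x => (complex.Re (f x))%:E + (complex.Re (g x))%:E)%E.
    exact: integrableD.
  by apply/funext => x; rewrite cReD.
rewrite (_ : (fun _ => _) = fun x => (complex.Im (f x))%:E + (complex.Im (g x))%:E)%E.
  exact: integrableD.
by apply/funext => x; rewrite cImD.
Qed.

Lemma cintegralD D f g : measurable D -> cintegrable D f -> cintegrable D g ->
  cintegral D (fun x => f x + g x) = cintegral D f + cintegral D g.
Proof.
move=> mD [f1 f2] [g1 g2]; apply: complex_ext; rewrite ?cReD ?cImD /cintegral/=.
  by rewrite -RintegralD//; congr Rintegral; apply/funext => x; rewrite cReD.
by rewrite -RintegralD//; congr Rintegral; apply/funext => x; rewrite cImD.
Qed.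

Lemma cintegrableZl D c f : measurable D -> cintegrable D f ->
  cintegrable D (fun x => c * f x).
Proof.
move=> mD [f1 f2]; split.
  rewrite (_ : (fun _ => _) = fun x => (complex.Re c)%:E * (complex.Re (f x))%:E -
      (complex.Im c)%:E * (complex.Im (f x))%:E)%E.
    by apply: integrableB => //; exact: integrableZl.
  by apply/funext => x; rewrite cReM EFinB !EFinM.
rewrite (_ : (fun _ => _) = fun x => (complex.Re c)%:E * (complex.Im (f x))%:E +
    (complex.Im c)%:E * (complex.Re (f x))%:E)%E.
  by apply: integrableD => //; exact: integrableZl.
by apply/funext => x; rewrite cImM EFinD !EFinM.
Qed.

Lemma cintegralZl D c f : measurable D -> cintegrable D f ->
  cintegral D (fun x => c * f x) = c * cintegral D f.
Proof.
move=> mD [f1 f2].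
have Z (a : R) (h : R -> R) : mu.-integrable D (EFin \o h) ->
    mu.-integrable D (EFin \o (fun x => a * h x)).
  move=> ih; rewrite (_ : _ \o _ = fun x => a%:E * (EFin \o h) x)%E.
    exact: integrableZl.
  by apply/funext => x /=; rewrite EFinM.
apply: complex_ext; rewrite ?cReM ?cImM /cintegral/=.
  rewrite -!RintegralZl// -RintegralB//; [|exact: Z|exact: Z].
  by congr Rintegral; apply/funext => x; rewrite cReM.
rewrite -!RintegralZl// -RintegralD//; [|exact: Z|exact: Z].
by congr Rintegral; apply/funext => x; rewrite cImM.
Qed.

Lemma cintegral0 D : cintegral D (fun=> 0) = 0.
Proof. by apply: complex_ext; rewrite /cintegral/= /Rintegral integral0. Qed.

(** The factor 2 comes from bounding real and imaginary parts separately; the bound serves for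
    finiteness and for smallness, where a constant is harmless. *)
Lemma cmod_cintegral D f : measurable D ->  cintegrable D f ->
  ((cmod (cintegral D f))%:E <= 2%:E * \int[mu]_(x in D) (cmod (f x))%:E)%E.
Proof.
move=> mD intf; have [f1 f2] := intf.
have /(cintegrableP _ mD)[mf foo] := intf.
have I (h : R -> R) : mu.-integrable D (EFin \o h) -> measurable_fun D h ->
    (forall x, `|h x| <= cmod (f x)) ->
    (`|\int[mu]_(x in D) h x|%:E <= \int[mu]_(x in D) (cmod (f x))%:E)%E.
  move=> ih mh hf; rewrite EFin_normr_Rintegral//.
  have mh' : measurable_fun D (EFin \o h) by exact/measurable_EFinP.
  apply: le_trans (le_abse_integral mu mD mh') _.
  apply: ge0_le_integral => //.
  - exact: measurableT_comp.
  - exact: measurable_EFin_cmod.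
  - by move=> x _; rewrite lee_fin hf.
apply: le_trans (_ : (`|complex.Re (cintegral D f)| + `|complex.Im (cintegral D f)|)%:E <= _)%E.
  by rewrite lee_fin cmod_le_ReIm.
rewrite EFinD (_ : 2%:E = 1 + 1)%E// ge0_muleDl// !mul1e.
by apply: leeD; apply: I => //; [case: mf|move=> x; exact: normr_Re_le|case: mf|
  move=> x; exact: normr_Im_le].
Qed.

Lemma cintegral_mkcond D f :
  cintegral D f = cintegral setT (fun x => if x \in D then f x else 0).
Proof.
apply: complex_ext; rewrite /cintegral/= Rintegral_mkcond; congr Rintegral;
  by apply/funext => x; rewrite patchE; case: ifP.
Qed.

Lemma eq_cintegral D f g : (forall x, D x -> f x = g x) -> cintegral D f = cintegral D g.
Proof.
move=> fg; apply: complex_ext; apply: eq_Rintegral => x;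
  by rewrite inE => /fg ->.
Qed.

Lemma eq_cintegrable D f g : (forall x, D x -> f x = g x) -> measurable D ->
  cintegrable D f -> cintegrable D g.
Proof.
move=> fg mD [f1 f2]; split.
  by move: f1; apply: eq_integrable => // x; rewrite inE => /fg ->.
by move: f2; apply: eq_integrable => // x; rewrite inE => /fg ->.
Qed.

Lemma cFubini (F : R -> R -> R[i]) :
  cmeasurable [set: R * R] (fun z => F z.1 z.2) ->
  (\int[mu]_x \int[mu]_y (cmod (F x y))%:E < +oo)%E ->
  [/\ {ae mu, forall x, cintegrable setT (F x)},
      {ae mu, forall y, cintegrable setT (F ^~ y)} &
  cintegral setT (fun x => cintegral setT (F x)) =
  cintegral setT (fun y => cintegral setT (F ^~ y))].
Proof.
move=> mF Foo; have [m1 m2] := mF.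
have I (p : R[i] -> R) : (forall z, `|p z| <= cmod z) ->
    measurable_fun [set: R * R] (fun z => p (F z.1 z.2)) ->
    [/\ {ae mu, forall x, mu.-integrable setT (fun y => (p (F x y))%:E)},
        {ae mu, forall y, mu.-integrable setT (fun x => (p (F x y))%:E)} &
        \int[mu]_x \int[mu]_y p (F x y) = \int[mu]_y \int[mu]_x p (F x y)].
  move=> pz mp.
  have mp' : measurable_fun [set: measurableTypeR R * measurableTypeR R]
      (fun z : R * R => (p (F z.1 z.2))%:E) by exact/measurable_EFinP.
  have int : (mu \x mu)%E.-integrable setT (fun z : R * R => (p (F z.1 z.2))%:E).
    apply/(integrable12ltyP mu mu mp'); apply: le_lt_trans Foo.
    have mc : measurable_fun [set: R * R] (fun z => (cmod (F z.1 z.2))%:E).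
      exact: measurable_EFin_cmod.
    apply: ge0_le_integral => //.
    - by move=> x _; exact: integral_ge0.
    - apply: (measurable_lebesgue_section (F := fun x y => `|(p (F x y))%:E|%E)) => //.
      exact: measurableT_comp.
    - by apply: (measurable_lebesgue_section (F := fun x y => (cmod (F x y))%:E)) => // x y;
      rewrite lee_fin cmod_ge0.
    move=> x _; apply: ge0_le_integral => //.
    - apply: measurableT_comp => //.
      exact: (measurableT_comp mp' (measurable_fun_pair (measurable_cst x) (@measurable_id _ _ setT))).
    - exact: (measurableT_comp mc (measurable_fun_pair (measurable_cst x) (@measurable_id _ _ setT))).
    - by move=> y _; rewrite lee_fin.
  split; [exact: (ae_integrable1 int)|exact: (ae_integrable2 int)|].
  (* [Rintegral] applies [fine] to the inner integral, which is harmless only where that integral is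
     finite, that is, almost everywhere. *)
  have E : {ae mu, forall x, (\int[mu]_y (p (F x y))%:E)%E \is a fin_num}.
    have := ae_integrable1 int; apply: filterS => x /= ix.
    exact: integrable_fin_num.
  have E' : {ae mu, forall y, (\int[mu]_x (p (F x y))%:E)%E \is a fin_num}.
    have := ae_integrable2 int; apply: filterS => x /= ix.
    exact: integrable_fin_num.
  have i1 := measurable_fubini_F int.
  have i2 := measurable_fubini_G int.
  rewrite /Rintegral; congr fine.
  transitivity (\int[mu]_x \int[mu]_y (p (F x y))%:E)%E.
    apply: ae_eq_integral => //.
      by apply/measurable_EFinP; apply: measurableT_comp i1.
    move: E; apply: filterS; first exact: (ae_filter_ringOfSetsType mu).
    by move=> x /= xf _; rewrite fineK.
  rewrite (Fubini int); apply: ae_eq_integral => //.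
    by apply/measurable_EFinP; apply: measurableT_comp i2.
  move: E'; apply: filterS; first exact: (ae_filter_ringOfSetsType mu).
  by move=> x /= xf _; rewrite fineK.
have [r1 r2 r3] := I _ (@normr_Re_le R) m1.
have [s1 s2 s3] := I _ (@normr_Im_le R) m2.
split.
- move: r1 s1; apply: filterS2; first exact: (ae_filter_ringOfSetsType mu).
  by move=> x h1 h2; split.
- move: r2 s2; apply: filterS2; first exact: (ae_filter_ringOfSetsType mu).
  by move=> x h1 h2; split.

by apply: complex_ext; [exact: r3|exact: s3].
Qed.

Lemma cintegral_shift b f : cmeasurable [set: R] f ->
  cintegral setT (fun x => f (x - b)) = cintegral setT f.
Proof.
move=> [m1 m2].
have H (h : R -> R) : measurable_fun [set: R] h ->
    \int[mu]_x h (x - b) = \int[mu]_x h x.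
  move=> mh; have mh' : measurable_fun [set: R] (EFin \o h) by exact/measurable_EFinP.
  rewrite /Rintegral; congr fine; rewrite integralE [RHS]integralE; congr (_ - _)%E.
    rewrite -[RHS](ge0_integral_shift b (measurable_funepos mh'))//.
    by apply: eq_integral => x _; rewrite !funeposE.
  rewrite -[RHS](ge0_integral_shift b (measurable_funeneg mh'))//.
  by apply: eq_integral => x _; rewrite !funenegE.
by apply: complex_ext; [exact: (H _ m1)|exact: (H _ m2)].
Qed.

(** Fubini yields integrability of the product only. For [c = 0] this says nothing about [f], but
    then both sides vanish. *)
Lemma cintegralZl_nz c f : cintegrable setT (fun x => c * f x) ->
  cintegral setT (fun x => c * f x) = c * cintegral setT f.
Proof.
have [->|c0] := eqVneq c 0 => icf.
  by rewrite mul0r -[RHS](cintegral0 setT); apply: eq_cintegral => x _; rewrite mul0r.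
rewrite cintegralZl//; apply: eq_cintegrable (cintegrableZl c^-1 measurableT icf) => // x _.
by rewrite mulrA mulVf// mul1r.
Qed.

Import HBNNSimple.

(* The Lebesgue integral of the library is a supremum over simple functions,
   hence it ignores null sets even for nonmeasurable integrands. *)
Lemma ge0_le_integral_negligible (f g : R -> \bar R) (N : set R) :
  measurable N -> mu N = 0%E -> (forall x, 0 <= f x)%E -> (forall x, 0 <= g x)%E ->
  (forall x, ~ N x -> f x <= g x)%E -> (\int[mu]_x f x <= \int[mu]_x g x)%E.
Proof.
move=> mN N0 f0 g0 fg; rewrite !ge0_integralTE//; apply: ge_ereal_sup => _ [h /= hf <-].
have mNC : measurable (~` N) by exact: measurableC.
pose h' := mul_nnsfun h (@indic_nnsfun _ (measurableTypeR R) R _ mNC).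
have h'E x : h' x = h x * \1_(~` N) x by [].
apply: le_trans (_ : sintegral mu h' <= _)%E; last first.
  apply: ereal_sup_ubound => /=; exists h' => // x.
  rewrite h'E indicE; have [xN|xN] := boolP (x \in ~` N).
    by rewrite mulr1; apply: le_trans (hf x) _; apply: fg; rewrite inE in xN.
  by rewrite mulr0.
rewrite -!integralT_nnsfun le_eqVlt; apply/orP; left; apply/eqP.
apply: ge0_ae_eq_integral => //.
- by apply/measurable_EFinP; exact: measurable_funP.
- by apply/measurable_EFinP; exact: measurable_funP.
- by move=> x _; rewrite lee_fin.
- by move=> x _; rewrite lee_fin.
exists N; split => // x /= hx; apply: contrapT => xN; apply: hx => _.
by rewrite /= /mindic indicE mem_set// mulr1.
Qed.

(** Meant for integrands such as [cderive g], which are controlled outside a null set only and whose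
    measurability is not at hand. *)
Lemma ae_eq_integral_nonmeasurable D (f g : R -> \bar R) :
  {ae mu, forall x, D x -> f x = g x} ->
  (\int[mu]_(x in D) f x = \int[mu]_(x in D) g x)%E.
Proof.
move=> [N [mN N0 fgN]]; rewrite integral_mkcond [RHS]integral_mkcond.
rewrite integralE [RHS]integralE.
have E x : ~ N x -> (f \_ D) x = (g \_ D) x.
  move=> Nx; rewrite !patchE; case: ifPn => //; rewrite inE => Dx.
  by apply: contrapT => h; apply: Nx; apply: fgN => /= /(_ Dx).
by congr (_ - _)%E; apply/eqP; rewrite eq_le; apply/andP; split;
  apply: ge0_le_integral_negligible mN N0 _ _ _ => // x /E;
  rewrite /= ?funeposE ?funenegE => ->.
Qed.

Lemma ae_eq_cintegral D f g : {ae mu, forall x, D x -> f x = g x} ->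
  cintegral D f = cintegral D g.
Proof.
move=> fg; apply: complex_ext; rewrite /cintegral/= /Rintegral; congr fine;
  apply: ae_eq_integral_nonmeasurable; move: fg;
  (apply: filterS; first exact: (ae_filter_ringOfSetsType mu));
  by move=> x h /h ->.
Qed.

End ComplexIntegral.

(** * Convolution of functions on the half-line *)

Section CausalConvolution.
Context {R : realType}.
Local Notation mu := (@lebesgue_measure R).
Implicit Types (p q r : R -> R[i]) (x b : R).

Definition causal q x : R[i] := if 0 <= x then q x else 0.

Definition amod q x : \bar R := (cmod (causal q x))%:E.

Definition cconv p q x : R[i] := cintegral `[0, x] (fun s => p (x - s) * q s).

Lemma causal_ge0 q x : 0 <= x -> causal q x = q x.
Proof. by rewrite /causal => ->. Qed.

Lemma causal_lt0 q x : x < 0 -> causal q x = 0.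
Proof. by rewrite /causal leNgt => ->. Qed.

Lemma cconvE p q x : cconv p q x = cintegral setT (fun s => causal p (x - s) * causal q s).
Proof.
rewrite /cconv cintegral_mkcond; apply: eq_cintegral => s _.
have [s0|s0] := ltP s 0.
  rewrite (causal_lt0 _ s0) mulr0 ifF//; apply/negbTE/negP.
  by rewrite inE/= in_itv/= leNgt s0.
have [xs|xs] := ltP x s.
  rewrite [causal p _]causal_lt0 ?subr_lt0// mul0r ifF//; apply/negbTE/negP.
  by rewrite inE/= in_itv/= [s <= x]leNgt xs andbF.
by rewrite !causal_ge0 ?subr_ge0// mem_set//= in_itv/= s0.
Qed.

Lemma amod_ge0 q x : (0 <= amod q x)%E.
Proof. by rewrite lee_fin cmod_ge0. Qed.

#[local] Hint Resolve amod_ge0 : core.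

Lemma amod_lt0 q x : x < 0 -> amod q x = 0%E.
Proof. by move=> x0; rewrite /amod causal_lt0// cmod0. Qed.

Lemma loc_integrable_causal q : loc_integrable q -> cmeasurable [set: R] (causal q).
Proof.
move=> iq.
pose I (n : nat) : set R := [set` `[0, n%:R]].
have H (h : R[i] -> R) : h 0 = 0 ->
    (forall b, mu.-integrable `[0, b] (fun x => (h (q x))%:E)) ->
    measurable_fun [set: R] (fun x => h (causal q x)).
  move=> h0 ih; apply: (@measurable_fun_cvg _ _ _ _ (fun n => (h \o q) \_ (I n))).
    move=> n; apply/(measurable_restrictT _ _).1; first exact: measurable_itv.
    by apply/measurable_EFinP; case/integrableP: (ih n%:R).
  move=> x _; apply: cvg_near_cst; near=> n.
  rewrite patchE; have [x0|x0] := ltP x 0.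
    rewrite causal_lt0// h0 ifF//; apply/negbTE/negP.
    by rewrite /I inE/= in_itv/= leNgt x0.
  rewrite causal_ge0// mem_set// /I/= in_itv/= x0/=.
  by near: n; exact: nbhs_infty_ger.
by split; apply: H => // b; case: (iq b).
Unshelve. all: by end_near. Qed.

Lemma loc_integrableP q : loc_integrable q <->
  cmeasurable [set: R] (causal q) /\
  forall b, (\int[mu]_(x in `[0%R, b]) amod q x < +oo)%E.
Proof.
have mI b : measurable ([set` `[0, b]] : set R) by exact: measurable_itv.
have E b x : [set` `[0%R, b]] x -> causal q x = q x.
  by rewrite /= in_itv/= => /andP[x0 _]; rewrite causal_ge0.
split=> [iq|[mq foo] b].
  split=> [|b]; first exact: loc_integrable_causal.
  have /(cintegrableP _ (mI b))[_] := iq b.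
  apply: le_lt_trans; rewrite le_eqVlt; apply/orP; left; apply/eqP.
  by apply: eq_integral => x; rewrite inE => /E; rewrite /amod => ->.
apply: (eq_cintegrable (E b)) => //; apply/(cintegrableP _ (mI b)); split => //.
by apply: cmeasurableS mq.
Qed.

Lemma measurable_amod q : cmeasurable [set: R] (causal q) -> measurable_fun [set: R] (amod q).
Proof. exact: measurable_EFin_cmod. Qed.

Lemma cmeasurable_cconv_kernel p q : cmeasurable [set: R] (causal p) ->
  cmeasurable [set: R] (causal q) ->
  cmeasurable [set: R * R] (fun z => causal p (z.1 - z.2) * causal q z.2).
Proof.
move=> mp mq; apply: cmeasurableM.
  by apply: (cmeasurableT_comp mp); exact: measurable_funB.
exact: (cmeasurableT_comp mq).
Qed.

Lemma cmeasurable_cconv_section p q x : cmeasurable [set: R] (causal p) ->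
  cmeasurable [set: R] (causal q) ->
  cmeasurable [set: R] (fun s => causal p (x - s) * causal q s).
Proof.
move=> mp mq; apply: cmeasurableM => //.
by apply: (cmeasurableT_comp mp); exact: measurable_funB.
Qed.

Lemma cconv_integrable p q x : cmeasurable [set: R] (causal p) ->
  cmeasurable [set: R] (causal q) -> (nconv (amod p) (amod q) x < +oo)%E ->
  cintegrable setT (fun s => causal p (x - s) * causal q s).
Proof.
move=> mp mq pq; apply/cintegrableP => //; split; first exact: cmeasurable_cconv_section.
apply: le_lt_trans pq; rewrite le_eqVlt; apply/orP; left; apply/eqP.
by apply: eq_integral => s _; rewrite cmodM EFinM.
Qed.

(** No integrability is assumed: each component is [fine] of a difference of integrals of positive
    and negative parts, both measurable in the parameter by Tonelli. *)
Lemma cmeasurable_cconv p q : cmeasurable [set: R] (causal p) ->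
  cmeasurable [set: R] (causal q) -> cmeasurable [set: R] (cconv p q).
Proof.
move=> mp mq.
have [m1 m2] := cmeasurable_cconv_kernel mp mq.
have H (h : R * R -> R) : measurable_fun [set: R * R] h ->
    measurable_fun [set: R] (fun x => \int[mu]_s h (x, s)).
  move=> mh; apply: measurableT_comp => //.
  rewrite (_ : (fun _ => _) = fun x => \int[mu]_s ((EFin \o h)^\+ (x, s)) -
      \int[mu]_s ((EFin \o h)^\- (x, s)))%E; last first.
    by apply/funext => x; rewrite integralE; congr (_ - _)%E; apply: eq_integral => s _;
      rewrite ?funeposE ?funenegE.
  have mh' : measurable_fun [set: R * R] (EFin \o h) by exact/measurable_EFinP.
  apply: emeasurable_funB.
    apply: (measurable_lebesgue_section (F := fun x s => (EFin \o h)^\+ (x, s))%E) => //.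
    rewrite (_ : (fun _ => _) = (EFin \o h)^\+%E); first exact: measurable_funepos.
    by apply/funext => -[].
  apply: (measurable_lebesgue_section (F := fun x s => (EFin \o h)^\- (x, s))%E) => //.
  rewrite (_ : (fun _ => _) = (EFin \o h)^\-%E); first exact: measurable_funeneg.
  by apply/funext => -[].
split.
  rewrite (_ : (fun _ => _) = fun x => \int[mu]_s complex.Re (causal p (x - s) * causal q s)).
    exact: (H _ m1).
  by apply/funext => x; rewrite cconvE.
rewrite (_ : (fun _ => _) = fun x => \int[mu]_s complex.Im (causal p (x - s) * causal q s)).
  exact: (H _ m2).
by apply/funext => x; rewrite cconvE.
Qed.

Lemma cmeasurable_causal q : cmeasurable [set: R] q -> cmeasurable [set: R] (causal q).
Proof.
have mb : measurable_fun [set: R] (fun x : R => 0 <= x) by exact: measurable_fun_ler.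
move=> [q1 q2]; split.
  rewrite (_ : (fun _ => _) = fun x => if 0 <= x then complex.Re (q x) else 0).
    by apply: measurable_fun_ifT.
  by apply/funext => x; rewrite /causal; case: ifP.
rewrite (_ : (fun _ => _) = fun x => if 0 <= x then complex.Im (q x) else 0).
  by apply: measurable_fun_ifT.
by apply/funext => x; rewrite /causal; case: ifP.
Qed.

Lemma cmod_cconv_le p q x : cmeasurable [set: R] (causal p) ->
  cmeasurable [set: R] (causal q) ->
  ((cmod (cconv p q x))%:E <= 2%:E * nconv (amod p) (amod q) x)%E.
Proof.
move=> mp mq.
have := nconv_ge0 x (amod_ge0 p) (amod_ge0 q).
case E : (nconv (amod p) (amod q) x) => [r| |] // _; last first.
  by rewrite mulry gtr0_sg// mul1e leey.
rewrite -E cconvE; apply: le_trans (cmod_cintegral measurableT _) _.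
  by apply: cconv_integrable => //; rewrite E ltry.
apply: lee_pmul => //; first by apply: integral_ge0 => s _; rewrite lee_fin cmod_ge0.
rewrite le_eqVlt; apply/orP; left; apply/eqP.
by apply: eq_integral => s _; rewrite cmodM EFinM.
Qed.

Lemma loc_integrable_cconv p q : loc_integrable p -> loc_integrable q ->
  loc_integrable (cconv p q).
Proof.
move=> /loc_integrableP[mp ip] /loc_integrableP[mq iq].
have mc := cmeasurable_cconv mp mq; have mcc := cmeasurable_causal mc.
have mAp := measurable_amod mp; have mAq := measurable_amod mq.
have mN := measurable_nconv mAp mAq (amod_ge0 p) (amod_ge0 q).
have N0 x := nconv_ge0 x (amod_ge0 p) (amod_ge0 q).
apply/loc_integrableP; split=> // b.
have mI : measurable ([set` `[0, b]] : set R) by exact: measurable_itv.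
apply: (@le_lt_trans _ _ (\int[mu]_(x in `[0%R, b]) (2%:E * nconv (amod p) (amod q) x))%E).
  apply: ge0_le_integral => //.
  - by apply: measurable_funTS; exact: measurable_amod.
  - by apply: measurable_funeM; exact: measurable_funTS.
  move=> x; rewrite /= in_itv/= => /andP[x0 _].
  by rewrite /amod causal_ge0//; exact: cmod_cconv_le.
rewrite ge0_integralZl//; last exact: measurable_funTS.
rewrite lte_mul_pinfty//.
apply: le_lt_trans (integral_nconv_itv b mAp mAq (amod_ge0 p) (amod_ge0 q)
  (@amod_lt0 p) (@amod_lt0 q)) _.
by apply: lte_mul_pinfty => //; [exact: integral_ge0|rewrite ge0_fin_numE//; exact: integral_ge0].
Qed.

(** A local form of Young's inequality for integrable functions: on each [[0, n]] the convolution of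
    the moduli has a finite integral, hence finite values almost everywhere. *)
Lemma ae_nconv_lty p q : loc_integrable p -> loc_integrable q ->
  {ae mu, forall x, (nconv (amod p) (amod q) x < +oo)%E}.
Proof.
move=> /loc_integrableP[mp ip] /loc_integrableP[mq iq].
have mAp := measurable_amod mp; have mAq := measurable_amod mq.
have mN := measurable_nconv mAp mAq (amod_ge0 p) (amod_ge0 q).
have N0 x := nconv_ge0 x (amod_ge0 p) (amod_ge0 q).
have H (n : nat) : {ae mu, forall x, `[0, n%:R]%classic x -> (nconv (amod p) (amod q) x < +oo)%E}.
  have mI : measurable ([set` `[0, n%:R]] : set R) by exact: measurable_itv.
  have int : mu.-integrable `[0, n%:R] (nconv (amod p) (amod q)).
    apply/integrableP; split; first exact: measurable_funTS.
    under eq_integral do rewrite gee0_abs//.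
    apply: le_lt_trans (integral_nconv_itv n%:R mAp mAq (amod_ge0 p) (amod_ge0 q)
      (@amod_lt0 p) (@amod_lt0 q)) _.
    apply: lte_mul_pinfty => //; first by apply: integral_ge0.
  by rewrite ge0_fin_numE//; apply: integral_ge0.
  have := @integrable_ae _ (measurableTypeR R) R mu _ mI _ int.
  apply: filterS => x h /h.
  by rewrite ge0_fin_numE.
have : {ae mu, forall x, forall n : nat, `[0, n%:R]%classic x -> (nconv (amod p) (amod q) x < +oo)%E}.
  exact/ae_foralln.
apply: filterS; first exact: (ae_filter_ringOfSetsType mu).
move=> x h; have [x0|x0] := ltP x 0.
  rewrite (_ : nconv _ _ _ = 0%E)// /nconv integral0_eq// => s _.
  have [s0|s0] := ltP s 0; first by rewrite [X in (_ * X)%E]amod_lt0// mule0.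
  by rewrite amod_lt0 ?mul0e// subr_lt0 (lt_le_trans x0).
by apply: (h (Num.truncn x).+1); rewrite /= in_itv/= x0 ltW// truncnS_gt.
Qed.

Lemma cconv_lt0 p q x : x < 0 -> cconv p q x = 0.
Proof.
move=> x0; rewrite cconvE -[RHS](cintegral0 setT); apply: eq_cintegral => s _.
have [s0|s0] := ltP s 0; first by rewrite (causal_lt0 _ s0) mulr0.
by rewrite causal_lt0 ?mul0r// subr_lt0 (lt_le_trans x0).
Qed.

Lemma causal_cconv p q x : causal (cconv p q) x = cconv p q x.
Proof. by rewrite /causal; case: leP => // x0; rewrite cconv_lt0. Qed.

(** At [s = x] the kernel is evaluated at 0, where its value is a convention; this endpoint and the
    point 0 form a null set. *)
Lemma eq_cconv p p' q q' x : (forall t, 0 < t -> p t = p' t) ->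
  {ae mu, forall t, 0 < t -> q t = q' t} -> cconv p q x = cconv p' q' x.
Proof.
move=> pp' qq'; apply: ae_eq_cintegral.
have nx : {ae mu, forall t, t <> x}.
  exists [set x]; split => //; first exact: lebesgue_measure_set1.
  by move=> t /= /contrapT.
have n0 : {ae mu, forall t, t <> 0}.
  exists [set 0]; split => //; first exact: lebesgue_measure_set1.
  by move=> t /= /contrapT.
move: qq' nx n0; apply: filterS3; first exact: (ae_filter_ringOfSetsType mu).
move=> t h tx t0 /=; rewrite in_itv/= => /andP[t0' tx'].
rewrite h ?pp' ?subr_gt0//; rewrite lt_neqAle ?tx' ?t0' andbT; first exact/eqP.
by apply/eqP => t00; apply: t0.
Qed.

(** Fubini for the fixed [x]: the integrability it requires is finiteness of the iterated
    convolution of moduli at that single point, so associativity is pointwise. *)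
Lemma cconvA p q r x : cmeasurable [set: R] (causal p) ->
  cmeasurable [set: R] (causal q) -> cmeasurable [set: R] (causal r) ->
  (nconv (amod p) (nconv (amod q) (amod r)) x < +oo)%E ->
  cconv p (cconv q r) x = cconv (cconv p q) r x.
Proof.
move=> mp mq mr foo.
pose F s t := causal p (x - s) * (causal q (s - t) * causal r t).
have mF : cmeasurable [set: R * R] (fun z => F z.1 z.2).
  apply: cmeasurableM; last exact: cmeasurable_cconv_kernel.
  by apply: (cmeasurableT_comp mp); exact: measurable_funB.
have Foo : (\int[mu]_s \int[mu]_t (cmod (F s t))%:E < +oo)%E.
  apply: le_lt_trans foo; rewrite le_eqVlt; apply/orP; left; apply/eqP.
  apply: eq_integral => s _; rewrite -ge0_integralZl//.
  - by apply: eq_integral => t _; rewrite !cmodM !EFinM.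
  - exact: measurable_nconv_section _ (measurable_amod mq) (measurable_amod mr).
  - by move=> t _; exact: mule_ge0.
have [F1 F2 F12] := cFubini mF Foo.
transitivity (cintegral setT (fun s => cintegral setT (F s))).
  rewrite cconvE; apply: ae_eq_cintegral; move: F1.
  apply: filterS; first exact: (ae_filter_ringOfSetsType mu).
  by move=> s Fs _; rewrite (cintegralZl_nz Fs) causal_cconv cconvE.
rewrite F12 cconvE; apply: ae_eq_cintegral; move: F2.
apply: filterS; first exact: (ae_filter_ringOfSetsType mu).
move=> t Ft _; rewrite causal_cconv mulrC cconvE.
have FE : F ^~ t = fun s => causal r t * (causal p (x - s) * causal q (s - t)).
  by apply/funext => s; rewrite /F mulrA mulrC.
rewrite FE in Ft *; rewrite (cintegralZl_nz Ft); congr (_ * _).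
rewrite -(cintegral_shift t (cmeasurable_cconv_section (x - t) mp mq)).
apply: eq_cintegral => s _; congr (causal p _ * _).
by rewrite opprB addrA subrK.
Qed.

End CausalConvolution.

Local Opaque Gamma.

(** * Complex series *)

Section ComplexLimits.
Context {R : realType}.
Implicit Types (u v : nat -> R[i]) (z l : R[i]).

Lemma ltc0_real (e : R[i]) : 0 < e -> e = (complex.Re e)%:C /\ 0 < complex.Re e.
Proof. by case: e => a b; rewrite ltcE/= => /andP[/eqP -> ->]. Qed.

Lemma ccvgP T (F : set_system T) (FF : Filter F) (f : T -> R[i]) l :
  ((f x : R[i]^o) @[x --> F] --> (l : R[i]^o)) <->
  (complex.Re (f x) @[x --> F] --> complex.Re l) /\
  (complex.Im (f x) @[x --> F] --> complex.Im l).
Proof.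
split=> [/cvgrPdist_lt fl|[/cvgrPdist_lt f1 /cvgrPdist_lt f2]].
  split; apply/cvgrPdist_lt => e e0.
    have e0' : 0 < e%:C :> R[i] by rewrite ltcR.
    apply: filterS (fl _ e0') => x; rewrite normC_cmod ltcR; apply: le_lt_trans.
    by rewrite -cReN -cReD; exact: normr_Re_le.
  have e0' : 0 < e%:C :> R[i] by rewrite ltcR.
  apply: filterS (fl _ e0') => x; rewrite normC_cmod ltcR; apply: le_lt_trans.
  by rewrite -cImN -cImD; exact: normr_Im_le.
apply/cvgrPdist_lt => e /ltc0_real[-> e0].
have e20 : 0 < complex.Re e / 2 by rewrite divr_gt0.
apply: filterS2 (f1 _ e20) (f2 _ e20) => x h1 h2.
rewrite normC_cmod ltcR; apply: le_lt_trans (cmod_le_ReIm _) _.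
by rewrite !(cReD, cImD, cReN, cImN) [ltRHS]splitr ltrD.
Qed.

Lemma ccvg_unique T (F : set_system T) (FF : ProperFilter F) (f : T -> R[i]) z l :
  (f x : R[i]^o) @[x --> F] --> (z : R[i]^o) ->
  (f x : R[i]^o) @[x --> F] --> (l : R[i]^o) -> z = l.
Proof.
move=> /ccvgP[z1 z2] /ccvgP[l1 l2].
apply: complex_ext; [exact: (cvg_unique _ z1 l1)|exact: (cvg_unique _ z2 l2)].
Qed.

Lemma csum_lim u l : (cseries u n @[n --> \oo] --> (l : R[i]^o)) -> csum u = l.
Proof.
move=> ul; have cu : cvgn (cseries u) by apply/cvg_ex; exists l.
exact: (ccvg_unique _ cu ul).
Qed.

Lemma cseriesE u n : cseries u n = \sum_(k < n) u k :> R[i].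
Proof. by rewrite /cseries /series/= big_mkord. Qed.

Lemma Re_cseries u n : complex.Re (cseries u n) = series (fun k => complex.Re (u k)) n.
Proof.
rewrite /cseries /series /=; elim: n => [|n IH]; first by rewrite !big_nil.
by rewrite !big_nat_recr//= cReD IH.
Qed.

Lemma Im_cseries u n : complex.Im (cseries u n) = series (fun k => complex.Im (u k)) n.
Proof.
rewrite /cseries /series /=; elim: n => [|n IH]; first by rewrite !big_nil.
by rewrite !big_nat_recr//= cImD IH.
Qed.

Lemma cseries_cvg u (M : R) : (forall n, \sum_(k < n) cmod (u k) <= M) -> cvgn (cseries u).
Proof.
move=> uM.
have H (h : R[i] -> R) : (forall z, `|h z| <= cmod z) -> cvgn (series (fun k => h (u k))).
  move=> hc; apply: normed_cvg; apply: nondecreasing_is_cvgn.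
    by apply: nondecreasing_series => n _ _; exact: normr_ge0.
  exists M => _ [n _ <-].
    rewrite -[X in X <= _]/(\sum_(0 <= k < n) `|h (u k)|) big_mkord; apply: le_trans (uM n).
  by apply: ler_sum => k _; exact: hc.
have [/cvg_ex[/= a ua] /cvg_ex[/= b ub]] := (H _ (@normr_Re_le R), H _ (@normr_Im_le R)).
apply/cvg_ex; exists (a +i* b); apply/ccvgP; split.
  by rewrite (_ : (fun _ => _) = series (fun k => complex.Re (u k)))//; apply/funext => n; exact: Re_cseries.
by rewrite (_ : (fun _ => _) = series (fun k => complex.Im (u k)))//; apply/funext => n; exact: Im_cseries.
Qed.

Lemma cmod_lim_le (f : nat -> R[i]) l (M : R) :
  (f n : R[i]^o) @[n --> \oo] --> (l : R[i]^o) -> (forall n, cmod (f n) <= M) -> cmod l <= M.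
Proof.
move=> /cvgrPdist_lt fl fM; apply/ler_addgt0Pr => e e0.
have e0' : 0 < e%:C :> R[i] by rewrite ltcR.
have [n _ /(_ n (leqnn n))] := fl _ e0'.
rewrite normC_cmod ltcR => h.
rewrite -(subrK (f n) l) [leRHS]addrC; apply: le_trans (ler_cmodD _ _) _.
by apply: lerD; [exact: ltW|exact: fM].
Qed.

Lemma cmod_csum_le u (M : R) : (forall n, \sum_(k < n) cmod (u k) <= M) -> cmod (csum u) <= M.
Proof.
move=> uM; apply: (cmod_lim_le (cseries_cvg uM)) => n.
by rewrite big_mkord; apply: le_trans (uM n); exact: ler_cmod_sum.
Qed.

Lemma ccvgZ T (F : set_system T) (FF : Filter F) (f : T -> R[i]) c l :
  (f x : R[i]^o) @[x --> F] --> (l : R[i]^o) ->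
  (c * f x : R[i]^o) @[x --> F] --> (c * l : R[i]^o).
Proof.
move=> /ccvgP[f1 f2]; apply/ccvgP; split.
  rewrite (_ : (fun _ => _) = fun x => complex.Re c * complex.Re (f x) -
    complex.Im c * complex.Im (f x)); last by apply/funext => x; rewrite cReM.
  by rewrite cReM; apply: cvgB; apply: cvgMr; [exact: f1|exact: f2].
rewrite (_ : (fun _ => _) = fun x => complex.Re c * complex.Im (f x) +
  complex.Im c * complex.Re (f x)); last by apply/funext => x; rewrite cImM.
by rewrite cImM; apply: cvgD; apply: cvgMr; [exact: f2|exact: f1].
Qed.

Lemma ccvgD T (F : set_system T) (FF : Filter F) (f h : T -> R[i]) l z :
  (f x : R[i]^o) @[x --> F] --> (l : R[i]^o) -> (h x : R[i]^o) @[x --> F] --> (z : R[i]^o) ->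
  (f x + h x : R[i]^o) @[x --> F] --> (l + z : R[i]^o).
Proof.
move=> /ccvgP[f1 f2] /ccvgP[h1 h2]; apply/ccvgP; rewrite cReD cImD; split.
  rewrite (_ : (fun _ => _) = fun x => complex.Re (f x) + complex.Re (h x)).
    exact: cvgD.
  by apply/funext => x; rewrite cReD.
rewrite (_ : (fun _ => _) = fun x => complex.Im (f x) + complex.Im (h x)).
  exact: cvgD.
by apply/funext => x; rewrite cImD.
Qed.

Lemma ccvgM T (F : set_system T) (FF : Filter F) (f h : T -> R[i]) l z :
  (f x : R[i]^o) @[x --> F] --> (l : R[i]^o) -> (h x : R[i]^o) @[x --> F] --> (z : R[i]^o) ->
  (f x * h x : R[i]^o) @[x --> F] --> (l * z : R[i]^o).
Proof.
move=> /ccvgP[f1 f2] /ccvgP[h1 h2]; apply/ccvgP; rewrite cReM cImM; split.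
  rewrite (_ : (fun _ => _) = fun x => complex.Re (f x) * complex.Re (h x) -
    complex.Im (f x) * complex.Im (h x)); last by apply/funext => x; rewrite cReM.
  by apply: cvgB; apply: cvgM.
rewrite (_ : (fun _ => _) = fun x => complex.Re (f x) * complex.Im (h x) +
  complex.Im (f x) * complex.Re (h x)); last by apply/funext => x; rewrite cImM.
by apply: cvgD; apply: cvgM.
Qed.

Lemma rcM (a b : R) : (a * b)%:C = a%:C * b%:C.
Proof. by apply: complex_ext => /=; rewrite ?(mul0r, mulr0, subr0, addr0). Qed.

Lemma csumZ c u : cvgn (cseries u) -> csum (fun k => c * u k) = c * csum u.
Proof.
move=> cu; apply: csum_lim.
rewrite (_ : cseries _ = fun n => c * cseries u n); first exact: ccvgZ.
by apply/funext => n; rewrite !cseriesE mulr_sumr.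
Qed.

End ComplexLimits.

(** * Cauchy products of absolutely convergent double series *)

Section CauchyProduct.
Context {R : realType}.
Implicit Types (a : nat -> nat -> R[i]).

Lemma sum_triangle (V : zmodType) (a : nat -> nat -> V) N M : (N <= M)%N ->
  \sum_(n < N) \sum_(k < n.+1) a k (n - k)%N =
  \sum_(k < M) \sum_(j < M) (if (k + j < N)%N then a k j else 0).
Proof.
elim: N => [|N IH] NM.
  by rewrite big_ord0 big1// => k _; rewrite big1.
rewrite big_ord_recr/= IH; last exact: ltnW.
have -> : \sum_(k < N.+1) a k (N - k)%N =
    \sum_(k < M) \sum_(j < M) (if (k + j == N)%N then a k j else 0).
  rewrite (big_ord_widen M (fun k => a k (N - k)%N) NM) big_mkcond/=.
  apply: eq_bigr => k _; case: ltnP => [kN|Nk].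
    have jM : (N - k < M)%N by rewrite (leq_ltn_trans (leq_subr _ _)).
    rewrite (bigD1 (Ordinal jM))//= subnKC// eqxx big1 ?addr0// => j /eqP jN.
    by rewrite ifF//; apply/negbTE/eqP => E; apply: jN; apply/val_inj; rewrite /= -E addKn.
  rewrite big1// => j _; rewrite ifF//; apply/negbTE/eqP => E.
  by move: Nk; rewrite -E ltnNge leq_addr.
rewrite -big_split; apply: eq_bigr => k _ /=; rewrite -big_split; apply: eq_bigr => j _ /=.
by rewrite [in RHS]ltnS; case: ltngtP => // h; rewrite ?addr0 ?add0r.
Qed.

(** The square of side [N] contains the triangle [k + j < N] and lies in the triangle
    [k + j < N + N], so the difference is at most a Cauchy difference of the convergent sequence
    [T]. *)
Lemma square_triangle_cvg a (C : R) :
  (forall N, \sum_(n < N) \sum_(k < n.+1) cmod (a k (n - k)%N) <= C) ->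
  ((\sum_(k < N) \sum_(j < N) a k j - \sum_(n < N) \sum_(k < n.+1) a k (n - k)%N
    : R[i]^o) @[N --> \oo] --> (0 : R[i]^o)).
Proof.
move=> aC; pose T N := \sum_(n < N) \sum_(k < n.+1) cmod (a k (n - k)%N).
have ndT : nondecreasing_seq T.
  apply/nondecreasing_seqP => n; rewrite /T big_ord_recr/= lerDl sumr_ge0// => k _.
  exact: cmod_ge0.
have cT : cvgn T by apply: nondecreasing_is_cvgn => //; exists C => _ [n _ <-]; exact: aC.
have le N : cmod (\sum_(k < N) \sum_(j < N) a k j -
    \sum_(n < N) \sum_(k < n.+1) a k (n - k)%N) <= T (N + N)%N - T N.
  have NN : (N <= N + N)%N by rewrite leq_addr.
  have sq : \sum_(k < N) \sum_(j < N) a k j = \sum_(k < N + N) \sum_(j < N + N)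
      (if (k < N)%N && (j < N)%N then a k j else 0).
    rewrite (big_ord_widen _ (fun k => \sum_(j < N) a k j) NN) big_mkcond/=.
    apply: eq_bigr => k _; case: ifP => kN; last by rewrite big1.
    by rewrite (big_ord_widen _ (fun j => a k j) NN) big_mkcond/=.
  rewrite sq (sum_triangle a NN) -sumrB.
  rewrite /T (sum_triangle (fun k j => cmod (a k j)) NN)
    (sum_triangle (fun k j => cmod (a k j)) (leqnn (N + N))) -sumrB.
  apply: le_trans (ler_cmod_sum _ _ _) _; apply: ler_sum => k _.
  rewrite -!sumrB; apply: le_trans (ler_cmod_sum _ _ _) _; apply: ler_sum => j _.
  have [kj|kj] := ltnP (k + j) N.
    have kN : (k < N)%N by rewrite (leq_ltn_trans _ kj)// leq_addr.
    have jN : (j < N)%N by rewrite (leq_ltn_trans _ kj)// leq_addl.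
    by rewrite kN jN/= !subrr cmod0 ifT ?subrr// (leq_trans kj).
  rewrite !subr0; case: ifPn => [/andP[kN jN]|_]; last first.
    by rewrite cmod0; case: ifP => // _; exact: cmod_ge0.
  by rewrite ifT// -addnS leq_add// ltnW.
apply/cvgrPdist_lt => e /ltc0_real[-> e0].
have cT2 : T (N + N)%N @[N --> \oo] --> limn T.
  apply: cvg_comp cT; apply/cvgnyPge => A; near=> N.
  by rewrite (leq_trans _ (leq_addr _ _))//; near: N; exact: nbhs_infty_ge.
have : T (N + N)%N - T N @[N --> \oo] --> limn T - limn T by exact: cvgB.
rewrite subrr => /cvgrPdist_lt/(_ _ e0); apply: filterS => N.
rewrite sub0r normrN => h; rewrite sub0r normrN normC_cmod ltcR.
by apply: le_lt_trans (le N) (le_lt_trans (ler_norm _) h).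
Unshelve. all: by end_near. Qed.

End CauchyProduct.

(** * Pochhammer symbols: geometric growth and the Vandermonde identity *)

Section Pochhammer.
Context {R : realType}.
Implicit Types (a b g : R).

Lemma pochhammerS a k : pochhammer a k.+1 = pochhammer a k * (a + k%:R).
Proof. by rewrite /pochhammer big_ord_recr. Qed.

Lemma pochhammerSl a k : pochhammer a k.+1 = a * pochhammer (a + 1) k.
Proof.
rewrite /pochhammer big_ord_recl/= addr0; congr (_ * _); apply: eq_bigr => i _.
by rewrite /bump/= add1n -natr1; ring.
Qed.

Lemma pochhammer_ge0 a k : 0 <= a -> 0 <= pochhammer a k.
Proof. by move=> a0; apply: prodr_ge0 => i _; rewrite addr_ge0. Qed.

Lemma le_pochhammer a b k : `|a| <= b -> `|pochhammer a k| <= pochhammer b k.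
Proof.
move=> ab; rewrite /pochhammer normr_prod; apply: ler_prod => i _.
rewrite normr_ge0 /=; apply: le_trans (ler_normD _ _) _.
by rewrite [`|i%:R|]ger0_norm// lerD2r.
Qed.

(** Divided by the factorial of [k], the left side counts the multisets of size [k] in a set of size
    [G], a binomial coefficient; hence the power of 2. The double induction is Pascal's rule. *)
Lemma pochhammer_nat_le (G k : nat) : pochhammer (G%:R : R) k <= 2 ^+ (G + k) * k`!%:R.
Proof.
elim: G k => [|G IH] [|k].
- by rewrite /pochhammer big_ord0 fact0 mulr1.
- by rewrite pochhammerSl mul0r mulr_ge0// exprn_ge0.
- by rewrite /pochhammer big_ord0 fact0 mulr1 exprn_ege1// ler1n.
elim: k => [|k IHk].
  rewrite pochhammerSl /pochhammer big_ord0 mulr1 factS fact0 mulr1.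
  by rewrite -natrX ler_nat (leq_trans (ltnW (ltn_expl G.+1 (ltnSn 1))))// leq_exp2l// leq_addr.
have -> : pochhammer (G.+1%:R : R) k.+2 =
    pochhammer G%:R k.+2 + k.+2%:R * pochhammer G.+1%:R k.+1.
  by rewrite pochhammerS [pochhammer G%:R _]pochhammerSl natr1 -!natr1; ring.
apply: le_trans (lerD (IH k.+2) (ler_wpM2l (ler0n _ _) IHk)) _.
rewrite [k.+2`!]factS natrM [in leRHS]addSn [in leLHS]addnS exprS.
by rewrite le_eqVlt; apply/orP; left; apply/eqP; rewrite !addnS !exprS; ring.
Qed.

Lemma pochhammer_fact_le g (G : nat) k : `|g| <= G%:R ->
  `|pochhammer g k / k`!%:R| <= 2 ^+ (G + k).
Proof.
move=> gG; have k0 : 0 < k`!%:R :> R by rewrite ltr0n fact_gt0.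
rewrite normrM normfV (ger0_norm (ltW k0)) ler_pdivrMr//.
exact: le_trans (le_pochhammer k gG) (pochhammer_nat_le _ _).
Qed.

(** The coefficient of [z ^ n] in the product of [(1 - z) ^ (- a)] and [(1 - z) ^ (- b)]. The
    induction multiplies by [n.+1] and splits [a + b + n] into [a + k] and [b + (n - k)], the
    product rule of differentiation read on coefficients. *)
Lemma pochhammer_vandermonde a b n : pochhammer (a + b) n / n`!%:R =
  \sum_(k < n.+1) (pochhammer a k / k`!%:R) * (pochhammer b (n - k) / (n - k)`!%:R).
Proof.
pose c (x : R) k := pochhammer x k / k`!%:R.
have cS x k : k.+1%:R * c x k.+1 = c x k * (x + k%:R).
  rewrite /c pochhammerS factS natrM invfM; field.
  by rewrite pnatr_eq0 -lt0n fact_gt0 nat1r pnatr_eq0.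
rewrite -/(c _ _) -[RHS]/(\sum_(k < n.+1) c a k * c b (n - k)%N).
elim: n => [|n IH].
  by rewrite big_ord1 subnn /c /pochhammer !big_ord0 fact0 divr1 mulr1.
have n0 : n.+1%:R != 0 :> R by rewrite pnatr_eq0.
apply: (mulfI n0); rewrite cS IH mulr_suml mulr_sumr.
transitivity (\sum_(k < n.+1) (k.+1%:R * c a k.+1) * c b (n - k)%N +
   \sum_(k < n.+1) c a k * ((n - k).+1%:R * c b (n - k).+1)).
  rewrite -big_split; apply: eq_bigr => k _ /=; rewrite !cS.
  have kn : (k <= n)%N by rewrite -ltnS.
  by rewrite natrB//; ring.
transitivity (\sum_(k < n.+2) (k%:R * c a k) * c b (n.+1 - k)%N +
   \sum_(k < n.+2) c a k * ((n.+1 - k)%:R * c b (n.+1 - k)%N)).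
  congr (_ + _).
    by rewrite [RHS]big_ord_recl/= mul0r mul0r add0r; apply: eq_bigr => k _.
  rewrite [RHS]big_ord_recr/= subnn mul0r mulr0 addr0; apply: eq_bigr => k _.
  by rewrite subSn// -ltnS.
rewrite -big_split; apply: eq_bigr => k _ /=.
have kn : (k <= n.+1)%N by rewrite -ltnS.
by rewrite natrB//; ring.
Qed.

End Pochhammer.

(** * Dominated convergence, and integrability of Riemann-Liouville kernels *)

Section ComplexIntegralLimits.
Context {R : realType}.
Local Notation mu := (@lebesgue_measure R).

Lemma cintegral_sum D n (F : 'I_n -> R -> R[i]) : measurable D ->
  (forall i, cintegrable D (F i)) ->
  cintegrable D (fun x => \sum_(i < n) F i x) /\
  cintegral D (fun x => \sum_(i < n) F i x) = \sum_(i < n) cintegral D (F i).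
Proof.
move=> mD; elim: n F => [|n IH] F iF.
  have E : (fun x => \sum_(i < 0) F i x) = fun=> 0 by apply/funext => x; rewrite big_ord0.
  rewrite E cintegral0 big_ord0; split => //.
  by split => /=; exact: integrable0.
have E : (fun x => \sum_(i < n.+1) F i x) =
    fun x => \sum_(i < n) F (widen_ord (leqnSn n) i) x + F ord_max x.
  by apply/funext => x; rewrite big_ord_recr.
have [i1 e1] := IH (fun i => F (widen_ord (leqnSn n) i)) (fun i => iF _).
rewrite E big_ord_recr/= -e1; split; first exact: cintegrableD.
exact: cintegralD.
Qed.

Lemma cdominated_cvg (F : nat -> R -> R[i]) (f : R -> R[i]) (h : R -> R) :
  (forall n, cmeasurable [set: R] (F n)) -> cmeasurable [set: R] f ->
  (forall x, (F n x : R[i]^o) @[n --> \oo] --> (f x : R[i]^o)) ->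
  mu.-integrable setT (EFin \o h) -> (forall n x, cmod (F n x) <= h x) ->
  (cintegral setT (F n) : R[i]^o) @[n --> \oo] --> (cintegral setT f : R[i]^o).
Proof.
move=> mF mf Ff ih Fh.
have H (p : R[i] -> R) : (forall z, `|p z| <= cmod z) ->
    (forall n, measurable_fun [set: R] (fun x => p (F n x))) ->
    measurable_fun [set: R] (fun x => p (f x)) ->
    (forall x, p (F n x) @[n --> \oo] --> p (f x)) ->
    \int[mu]_x p (F n x) @[n --> \oo] --> \int[mu]_x p (f x).
  move=> pc mpF mpf pFf.
  have mE n : measurable_fun [set: R] (fun x => (p (F n x))%:E) by exact/measurable_EFinP.
  have mf' : measurable_fun [set: R] (fun x => (p (f x))%:E) by exact/measurable_EFinP.
  have [] := @dominated_convergence _ (measurableTypeR R) R mu setT measurableT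
    (fun n x => (p (F n x))%:E) (fun x => (p (f x))%:E) (EFin \o h).
  - exact: mE.
  - exact: mf'.
  - by apply: aeW => x _; apply: cvg_EFin; [exact: nearW|exact: pFf].
  - exact: ih.
  - by apply: aeW => x n _; rewrite lee_fin; apply: le_trans (pc _) (Fh _ _).
  move=> ipf _ cv; apply: fine_cvg; rewrite fineK//.
  exact: integrable_fin_num.
apply/ccvgP; split.
- apply: H; [exact: normr_Re_le|by move=> n; case: (mF n)|by case: mf|].
  by move=> x; have /ccvgP[] := Ff x.
- apply: H; [exact: normr_Im_le|by move=> n; case: (mF n)|by case: mf|].
  by move=> x; have /ccvgP[] := Ff x.
Qed.

Lemma cmeasurable_lim (F : nat -> R -> R[i]) (f : R -> R[i]) :
  (forall n, cmeasurable [set: R] (F n)) ->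
  (forall x, (F n x : R[i]^o) @[n --> \oo] --> (f x : R[i]^o)) -> cmeasurable [set: R] f.
Proof.
move=> mF Ff; split.
  apply: (@measurable_fun_cvg _ _ _ _ (fun n x => complex.Re (F n x))).
    by move=> n; case: (mF n).
  by move=> x _; have /ccvgP[] := Ff x.
apply: (@measurable_fun_cvg _ _ _ _ (fun n x => complex.Im (F n x))).
  by move=> n; case: (mF n).
by move=> x _; have /ccvgP[] := Ff x.
Qed.

Lemma causal_rlk (a : R) t : causal (fun t => (rlk a t)%:C) t = (rlk a t)%:C.
Proof. by rewrite /causal; case: leP => // t0; rewrite /rlk /pw ltNge (ltW t0) mul0r. Qed.

Lemma amod_rlk (a : R) t : 0 < a -> amod (fun t => (rlk a t)%:C) t = (rlk a t)%:E.
Proof. by move=> a0; rewrite /amod causal_rlk cmod_real ger0_norm// rlk_ge0. Qed.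

Lemma rlk_le0 (a : R) t : t <= 0 -> rlk a t = 0.
Proof. by move=> t0; rewrite /rlk /pw ltNge t0 mul0r. Qed.

Lemma integral_rlk_lty (a b : R) : 0 < a -> (\int[mu]_(t in `[0%R, b]) (rlk a t)%:E < +oo)%E.
Proof.
move=> a0; have [b0|b0] := leP b 0.
  rewrite integral0_eq ?ltry// => t /=; rewrite in_itv/= => /andP[_ tb].
  by rewrite rlk_le0// (le_trans tb).
have m : measurable_fun [set: R] (fun t => (pw a t)%:E).
  by apply/measurable_EFinP; exact: measurable_pw.
rewrite -integral_itv_obnd_cbnd; last first.
  by apply: measurable_funTS; apply/measurable_EFinP; exact: measurable_rlk.
apply: (@le_lt_trans _ _ (((Gamma a)^-1)%:E * \int[mu]_(t in `]0%R, b]) (pw a t)%:E)%E).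
  rewrite -ge0_integralZl//=.
  - by apply: ge0_le_integral => //= [t _|||t _]; rewrite ?lee_fin ?rlk_ge0//;
      [apply: measurable_funTS; apply/measurable_EFinP; exact: measurable_rlk
      |apply: measurable_funeM; exact: measurable_funTS
      |rewrite /rlk mulrC].
  - exact: measurable_funTS.
  - by move=> t _; rewrite lee_fin pw_ge0.
  - by rewrite lee_fin invr_ge0 ltW// Gamma_gt0.
apply: le_lt_trans (_ : (((Gamma a)^-1)%:E * (b `^ a / a)%:E < +oo)%E); last by rewrite -EFinM ltry.
by rewrite lee_wpmul2l ?lee_fin ?invr_ge0 ?(ltW (Gamma_gt0 a0))// integral_pw_le.
Qed.

Lemma loc_integrable_le_rlk (q : R -> R[i]) m : 0 < m -> cmeasurable [set: R] q ->
  (forall b, 0 < b -> exists C, forall t, 0 < t <= b -> cmod (q t) <= C * rlk m t) ->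
  loc_integrable q.
Proof.
move=> m0 mq qC; have mcq := cmeasurable_causal mq.
apply/loc_integrableP; split=> // b.
have [b0|b0] := leP b 0.
  apply: le_lt_trans (_ : \int[mu]_(x in [set 0%R]) amod q x < +oo)%E.
    apply: (@ge0_subset_integral _ _ _ mu [set` `[0, b]] [set 0] (measurable_itv _)
      (measurable_set1 _)).
    - by apply: measurable_funTS; exact: measurable_amod.
    - by move=> x _; exact: amod_ge0.
    - move=> t /=; rewrite in_itv/= => /andP[t0 tb]; apply/eqP.
      by rewrite eq_le t0 (le_trans tb b0).
  by rewrite integral_set1 ltry.
have [C qCb] := qC _ b0.
have mA := measurable_amod mcq.
rewrite -integral_itv_obnd_cbnd; last exact: measurable_funTS.
have mr : measurable_fun [set: R] (fun t => (rlk m t)%:E).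
  by apply/measurable_EFinP; exact: measurable_rlk.
apply: (@le_lt_trans _ _ (`|C|%:E * \int[mu]_(t in `[0%R, b]) (rlk m t)%:E)%E); last first.
  by apply: lte_mul_pinfty => //; exact: integral_rlk_lty.
rewrite -integral_itv_obnd_cbnd; last exact: measurable_funTS.
rewrite -ge0_integralZl//=; last 2 first.
- exact: measurable_funTS.
- by move=> t _; rewrite lee_fin rlk_ge0.
apply: ge0_le_integral => //.
- by move=> t _; exact: amod_ge0.
- exact: measurable_funTS.
- by apply: measurable_funeM; exact: measurable_funTS.
move=> t /=; rewrite in_itv/= => tb; rewrite /amod causal_ge0; last by case/andP: tb => /ltW.
rewrite -EFinM lee_fin; apply: le_trans (qCb _ tb) _.
by rewrite ler_wpM2r ?rlk_ge0// ler_norm.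
Qed.

Lemma loc_integrable_rlk (m : R) : 0 < m -> loc_integrable (fun t => (rlk m t)%:C).
Proof.
move=> m0; apply: (loc_integrable_le_rlk m0).
  by apply: cmeasurable_real; exact: measurable_rlk.
by move=> b b0; exists 1 => t _; rewrite mul1r cmod_real ger0_norm// rlk_ge0.
Qed.

Lemma integrable_rlk_conv (a b x : R) : 0 < a -> 0 < b ->
  mu.-integrable setT (EFin \o (fun s => rlk a (x - s) * rlk b s)).
Proof.
move=> a0 b0; apply/integrableP; split.
  apply/measurable_EFinP; apply: measurable_funM; last exact: measurable_rlk.
  by apply: (measurableT_comp (measurable_rlk a)); exact: measurable_sub_cst.
rewrite (_ : (\int[mu]_x0 _)%E = (rlk (a + b) x)%:E) ?ltry//.
rewrite -nconv_rlk//; apply: eq_integral => s _ /=.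
by rewrite ger0_norm ?EFinM// mulr_ge0// rlk_ge0.
Qed.

Lemma cconv_rlk (a b x : R) : 0 < a -> 0 < b ->
  cconv (fun t => (rlk a t)%:C) (fun t => (rlk b t)%:C) x = (rlk (a + b) x)%:C.
Proof.
move=> a0 b0; rewrite cconvE; apply: complex_ext; rewrite /cintegral/=.
  transitivity (fine (nconv (EFin \o rlk a) (EFin \o rlk b) x)); last by rewrite nconv_rlk.
  rewrite /Rintegral; congr fine; apply: eq_integral => s _.
  by rewrite !causal_rlk/= mulr0 subr0 EFinM.
rewrite /Rintegral integral0_eq// => s _.
by rewrite !causal_rlk/= mulr0 mul0r addr0.
Qed.

End ComplexIntegralLimits.

(** * The Prabhakar kernels *)

Section MittagLefflerTerms.
Context {R : realType}.
Variables (rho : R) (omega : R[i]).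
Hypothesis rho0 : 0 < rho.
Implicit Types (m g t b : R).

Definition kcoef g k : R[i] := (pochhammer g k / k`!%:R)%:C * omega ^+ k.

(** Each term of the Prabhakar kernel is a multiple of a Riemann-Liouville kernel, so that terms can
    be convolved by [cconv_rlk]. *)
Definition kterm m g k t : R[i] := kcoef g k * (rlk (rho * k%:R + m) t)%:C.

Lemma kterm_index_gt0 m k : 0 < m -> 0 < rho * k%:R + m.
Proof. by move=> m0; rewrite ltr_wpDl// mulr_ge0// ltW. Qed.

Lemma ktermE m g k t : 0 < t ->
  (t `^ (m - 1))%:C * ((pochhammer g k / Gamma (rho * k%:R + m))%:C *
    ((omega * (t `^ rho)%:C) ^+ k / k`!%:R)) = kterm m g k t.
Proof.
move=> t0; rewrite /kterm /kcoef /rlk /pw t0 exprMn -rmorphXn/=.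
rewrite -powR_mulrn ?powR_ge0// -powRrM.
have -> : t `^ (rho * k%:R + m - 1) = t `^ (m - 1) * t `^ (rho * k%:R).
  by rewrite -powRD_gt0//; congr powR; ring.
rewrite -[k`!%:R : R[i]](rmorph_nat (real_complex R)).
rewrite !(rmorphM, fmorphV)/=; ring.
Qed.

Lemma sum_half_le (N : nat) : \sum_(k < N) (2^-1 : R) ^+ k <= 2.
Proof.
have -> : \sum_(k < N) (2^-1 : R) ^+ k = 2 - 2 * 2^-1 ^+ N.
  elim: N => [|N IH]; first by rewrite big_ord0 expr0 mulr1 subrr.
  by rewrite big_ord_recr/= IH exprS; field.
by rewrite gerBl mulr_ge0// exprn_ge0// invr_ge0.
Qed.

(* The point is the uniformity in m and g: taking B large makes the bound
   decay geometrically along (m, g) = (m0 + n m1, g0 + n g1). *)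
Lemma kterm_sum_le b : 0 < b -> exists2 B0, 0 < B0 & forall B, B0 <= B ->
  exists2 C, 0 <= C & forall m g (G : nat) t N, 0 < m -> `|g| <= G%:R -> 0 < t <= b ->
    \sum_(k < N) cmod (kterm m g k t) <= C * 2 ^+ G * B `^ (- m) * t `^ (m - 1).
Proof.
move=> b0; pose w := cmod omega.
have w0 : 0 <= w by exact: cmod_ge0.
have w40 : 0 < 4 * w + 1 by rewrite ltr_wpDl// mulr_ge0.
have y0 : 0 < b `^ rho * (4 * w + 1) by rewrite mulr_gt0// powR_gt0.
(* Chosen so that [B ^ rho >= 4 w b ^ rho]: the terms then have ratio at most 1/2, one factor 2
   being lost to the Pochhammer symbols. Adding 1 keeps the bound positive when [omega = 0]. *)
exists ((b `^ rho * (4 * w + 1)) `^ rho^-1); first exact: powR_gt0.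
move=> B B0B.
have B0 : 0 < B by apply: lt_le_trans B0B; exact: powR_gt0.
have Brho : b `^ rho * (4 * w + 1) <= B `^ rho.
  have {1}-> : b `^ rho * (4 * w + 1) = ((b `^ rho * (4 * w + 1)) `^ rho^-1) `^ rho.
    by rewrite -powRrM mulVf ?lt0r_neq0// powRr1// ltW.
  by apply: ge0_ler_powR => //; [exact: ltW|rewrite nnegrE powR_ge0|rewrite nnegrE ltW].
have [c c0 Gc] := Gamma_ge B0.
exists (2 / c); first by rewrite divr_ge0// ltW.
move=> m g G t N m0 gG /andP[t0 tb].
pose K := 2 ^+ G / c * B `^ (- m) * t `^ (m - 1).
have K0 : 0 <= K by rewrite !mulr_ge0 ?exprn_ge0 ?powR_ge0 ?invr_ge0// ltW.
have -> : 2 / c * 2 ^+ G * B `^ (- m) * t `^ (m - 1) = K * 2 by rewrite /K; ring.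
apply: le_trans (_ : K * \sum_(k < N) (2^-1) ^+ k <= _); last first.
  by rewrite ler_wpM2l// sum_half_le.
rewrite mulr_sumr; apply: ler_sum => k _.
have mk0 := kterm_index_gt0 k m0.
rewrite /kterm /kcoef !cmodM cmodX !cmod_real -/w (ger0_norm (rlk_ge0 t mk0)).
apply: (@le_trans _ _ (2 ^+ (G + k) * w ^+ k * (t `^ (m - 1) * (t `^ rho) ^+ k *
    (c^-1 * (B `^ (- m) * ((B `^ rho)^-1) ^+ k))))).
  apply: ler_pM; [by rewrite mulr_ge0// exprn_ge0|exact: rlk_ge0| |].
    by apply: ler_wpM2r; [exact: exprn_ge0|exact: pochhammer_fact_le].
  rewrite /rlk /pw t0; apply: ler_pM; rewrite ?powR_ge0 ?invr_ge0 ?(ltW (Gamma_gt0 mk0))//.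
    rewrite (_ : rho * k%:R + m - 1 = (m - 1) + rho * k%:R); last by ring.
    by rewrite powRD_gt0// powRrM powR_mulrn ?powR_ge0.
  have -> : c^-1 * (B `^ (- m) * (B `^ rho)^-1 ^+ k) = (c * B `^ (rho * k%:R + m))^-1.
    rewrite invfM powRD_gt0// invfM powRN powRrM powR_mulrn ?powR_ge0// exprVn; ring.
  by rewrite lef_pV2 ?posrE ?Gc ?Gamma_gt0// mulr_gt0// powR_gt0.
have -> : 2 ^+ (G + k) * w ^+ k * (t `^ (m - 1) * (t `^ rho) ^+ k *
    (c^-1 * (B `^ (- m) * (B `^ rho)^-1 ^+ k))) = K * (2 * w * t `^ rho / B `^ rho) ^+ k.
  by rewrite /K exprD !exprMn; ring.
have Br0 : 0 < B `^ rho by exact: powR_gt0.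
rewrite ler_wpM2l// lerXn2r ?nnegrE ?invr_ge0//.
  by rewrite !mulr_ge0 ?powR_ge0 ?invr_ge0// ltW.
rewrite ler_pdivrMr//; apply: le_trans (_ : 2 * w * b `^ rho <= _).
  rewrite ler_wpM2l ?mulr_ge0//; apply: ge0_ler_powR => //; rewrite ?nnegrE ltW//.
apply: le_trans (ler_wpM2l _ Brho); last by rewrite invr_ge0.
have : 0 <= b `^ rho by exact: powR_ge0.
set z := b `^ rho => z0; rewrite -subr_ge0.
by rewrite (_ : _ - _ = z / 2); [rewrite divr_ge0|field].
Qed.

End MittagLefflerTerms.

Lemma mittag_leffler_cvg {R : realType} (rho m g : R) (z : R[i]) : 0 < rho -> 0 < m ->
  cvgn (cseries (fun k => (pochhammer g k / Gamma (rho * k%:R + m))%:C *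
    (z ^+ k / k`!%:R))).
Proof.
(* At [t = 1] the powers of [t] disappear, so [z] can take the place of [omega]. *)
move=> rho0 m0; have [B0 B00 /(_ _ (lexx _))[C _ H]] := kterm_sum_le z rho0 (@ltr01 R).
have gG : `|g| <= (Num.truncn `|g|).+1%:R by apply: ltW; exact: truncnS_gt.
have := fun n => H m g _ 1 n m0 gG; rewrite ltr01 lexx => /(_ _ erefl) H1.
apply: (@cseries_cvg _ _ (C * 2 ^+ (Num.truncn `|g|).+1 * B0 `^ (- m) * 1 `^ (m - 1))) => n.
apply: le_trans (H1 n); rewrite le_eqVlt; apply/orP; left; apply/eqP.
by apply: eq_bigr => k _; rewrite -ktermE// !powR1 mul1r mulr1.
Qed.

Section Kernel.
Context {R : realType}.
Variables (rho : R) (omega : R[i]).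
Hypothesis rho0 : 0 < rho.
Local Notation mu := (@lebesgue_measure R).
Local Notation kterm := (kterm rho omega).
Implicit Types (m g t b x : R).

Definition ker m g t : R[i] :=
  (t `^ (m - 1))%:C * mittag_leffler rho m g (omega * (t `^ rho)%:C).

(** [ker] is the kernel as written in the definition of the operator. The version cut at 0 agrees
    with it for [t > 0], and is the limit of the sums of [kterm] and bounded by multiples of [rlk]
    also for [t <= 0]. *)
Definition kpos m g t : R[i] := if 0 < t then ker m g t else 0.

Lemma kpos_cvg m g t : 0 < m ->
  (\sum_(k < n) kterm m g k t : R[i]^o) @[n --> \oo] --> (kpos m g t : R[i]^o).
Proof.
move=> m0; rewrite /kpos; case: ltP => t0; last first.
  rewrite (_ : (fun _ => _) = fun=> 0); first exact: cvg_cst.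
  apply/funext => n; rewrite big1// => k _.
  by rewrite /kterm rlk_le0// mulr0.
have := ccvgZ (c := (t `^ (m - 1))%:C) _ (@mittag_leffler_cvg _ rho m g (omega * (t `^ rho)%:C) rho0 m0).
rewrite (_ : (fun n => _ * _) = fun n => \sum_(k < n) kterm m g k t); first exact.
apply/boolp.funext => n; rewrite big_mkord mulr_sumr; apply: eq_bigr => k _.
by rewrite ktermE.
Qed.

Lemma kpos_le_bound m g t M : 0 < m ->
  (forall N, \sum_(k < N) cmod (kterm m g k t) <= M) -> cmod (kpos m g t) <= M.
Proof.
move=> m0 H; apply: (cmod_lim_le (@kpos_cvg m g t m0)) => n.
by apply: le_trans (H n); exact: ler_cmod_sum.
Qed.

Lemma ker_le b : 0 < b -> exists2 B0, 0 < B0 & forall B, B0 <= B ->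
  exists2 C, 0 <= C & forall m g (G : nat) t, 0 < m -> `|g| <= G%:R -> 0 < t <= b ->
    cmod (ker m g t) <= C * 2 ^+ G * B `^ (- m) * t `^ (m - 1).
Proof.
move=> b0; have [B0 B00 H] := kterm_sum_le omega rho0 b0.
exists B0 => // B /H[C C0 HC]; exists C => // m g G t m0 gG tb.
have t0 : 0 < t by case/andP: tb.
have := @kpos_le_bound m g t _ m0 (fun N => HC m g G t N m0 gG tb).
by rewrite /kpos t0.
Qed.

Lemma kterm_le_rlk m g b : 0 < m -> 0 < b -> exists2 C, 0 <= C &
  forall t N, t <= b -> \sum_(k < N) cmod (kterm m g k t) <= C * rlk m t.
Proof.
move=> m0 b0; have [B0 B00 /(_ _ (lexx _))[C C0 H]] := kterm_sum_le omega rho0 b0.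
have gG : `|g| <= (Num.truncn `|g|).+1%:R by apply: ltW; exact: truncnS_gt.
set G := (Num.truncn `|g|).+1 in gG.
(* [Gamma m] undoes the normalisation of [rlk]. *)
exists (C * 2 ^+ G * B0 `^ (- m) * Gamma m).
  by rewrite !mulr_ge0 ?exprn_ge0 ?powR_ge0 ?(ltW (Gamma_gt0 m0)).
move=> t N tb; have [t0|t0] := leP t 0.
  rewrite rlk_le0// mulr0 big1// => k _; rewrite /kterm rlk_le0// mulr0 cmod0//.
have tb' : 0 < t <= b by rewrite t0.
apply: le_trans (H _ _ _ _ N m0 gG tb') _.
rewrite -[leRHS]mulrA /rlk /pw t0 (mulrC (Gamma m)) mulfVK//.
by rewrite gt_eqF// Gamma_gt0.
Qed.

Lemma kpos_le_rlk m g b : 0 < m -> 0 < b -> exists2 C, 0 <= C &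
  forall t, t <= b -> cmod (kpos m g t) <= C * rlk m t.
Proof.
move=> m0 b0; have [C C0 H] := kterm_le_rlk g m0 b0; exists C => // t tb.
by apply: kpos_le_bound => // N; exact: H.
Qed.

Lemma cmeasurable_kterm m g k : cmeasurable [set: R] (kterm m g k).
Proof.
apply: cmeasurableM; first exact: cmeasurable_cst.
by apply: cmeasurable_real; exact: measurable_rlk.
Qed.

Lemma causal_kpos m g t : causal (kpos m g) t = kpos m g t.
Proof. by rewrite /causal; case: leP => // t0; rewrite /kpos ltNge (ltW t0). Qed.

Lemma cmeasurable_kpos m g : 0 < m -> cmeasurable [set: R] (kpos m g).
Proof.
move=> m0; apply: (@cmeasurable_lim _ (fun n t => \sum_(k < n) kterm m g k t)).
  by move=> n; apply: cmeasurable_sum => k; exact: cmeasurable_kterm.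
by move=> t; exact: kpos_cvg.
Qed.

Lemma kterm_mul_integrable m g m' g' k j x : 0 < m -> 0 < m' ->
  cintegrable setT (fun s => kterm m g k (x - s) * kterm m' g' j s).
Proof.
move=> m0 m'0; have mk0 := kterm_index_gt0 rho0 k m0; have mj0 := kterm_index_gt0 rho0 j m'0.
rewrite (_ : (fun _ => _) = fun s => (kcoef omega g k * kcoef omega g' j) *
  (rlk (rho * k%:R + m) (x - s) * rlk (rho * j%:R + m') s)%:C); last first.
  by apply/funext => s; rewrite /kterm rcM; ring.
apply: cintegrableZl => //; split => /=; last exact: integrable0.
exact: integrable_rlk_conv.
Qed.

Lemma cintegral_kterm_mul m g m' g' k j x : 0 < m -> 0 < m' ->
  cintegral setT (fun s => kterm m g k (x - s) * kterm m' g' j s) =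
  kcoef omega g k * kcoef omega g' j * (rlk (rho * (k + j)%:R + (m + m')) x)%:C.
Proof.
move=> m0 m'0; have mk0 := kterm_index_gt0 rho0 k m0; have mj0 := kterm_index_gt0 rho0 j m'0.
rewrite (_ : (fun _ => _) = fun s => (kcoef omega g k * kcoef omega g' j) *
  ((rlk (rho * k%:R + m) (x - s))%:C * (rlk (rho * j%:R + m') s)%:C)); last first.
  by apply/funext => s; rewrite /kterm; ring.
have := cconv_rlk x mk0 mj0; rewrite cconvE.
under eq_cintegral do rewrite !causal_rlk.
move=> E; rewrite (cintegralZl _ measurableT).
  by rewrite E; congr (_ * (rlk _ x)%:C); rewrite natrD; ring.
rewrite (_ : (fun _ => _) = fun s => (rlk (rho * k%:R + m) (x - s) * rlk (rho * j%:R + m') s)%:C).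
  by split => /=; [exact: integrable_rlk_conv|exact: integrable0].
by apply/funext => s; rewrite rcM.
Qed.

Lemma kcoef_vandermonde g g' n : kcoef omega (g + g') n =
  \sum_(k < n.+1) kcoef omega g k * kcoef omega g' (n - k).
Proof.
rewrite /kcoef pochhammer_vandermonde rmorph_sum mulr_suml; apply: eq_bigr => k _.
have kn : (k <= n)%N by rewrite -ltnS.
rewrite -[complex_real_complex_def__canonical__GRing_RMorphism R _]/(_%:C) rcM.
have -> : omega ^+ n = omega ^+ k * omega ^+ (n - k) by rewrite -exprD subnKC.
ring.
Qed.

(** With [|g|] and [|g'|] all Pochhammer symbols are nonnegative, so Vandermonde read backwards
    bounds the triangles of moduli by the single series of superscript [|g| + |g'|]. *)
Lemma kterm_le_rlk_abs g g' m x : 0 < m -> 0 < x -> exists2 M, 0 <= M &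
  forall N, \sum_(n < N) \sum_(k < n.+1) cmod (kcoef omega g k * kcoef omega g' (n - k) *
    (rlk (rho * (k + (n - k))%:R + m) x)%:C) <= M.
Proof.
move=> m0 x0; have [C C0 HC] := kterm_le_rlk (`|g| + `|g'|) m0 x0.
exists (C * rlk m x); first by rewrite mulr_ge0// rlk_ge0.
move=> N; apply: le_trans (HC x N (lexx x)); apply: ler_sum => n _.
have kn0 := kterm_index_gt0 rho0 n m0.
rewrite /kterm /kcoef !cmodM !cmodX !cmod_real (ger0_norm (rlk_ge0 x kn0)).
rewrite ger0_norm; last by rewrite divr_ge0 ?pochhammer_ge0 ?addr_ge0.
rewrite pochhammer_vandermonde !mulr_suml; apply: ler_sum => k _.
have kn : (k <= n)%N by rewrite -ltnS.
have f0 (j : nat) : 0 < j`!%:R :> R by rewrite ltr0n fact_gt0.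
have P (a : R) j : `|pochhammer a j / j`!%:R| <= pochhammer `|a| j / j`!%:R.
  rewrite normrM normfV (ger0_norm (ltW (f0 j))) ler_wpM2r ?invr_ge0 ?(ltW (f0 j))//.
  exact: le_pochhammer.
rewrite subnKC// /kcoef !cmodM !cmodX !cmod_real (ger0_norm (rlk_ge0 x (kterm_index_gt0 rho0 n m0))).
rewrite ler_wpM2r ?rlk_ge0 ?kterm_index_gt0//.
have -> : cmod omega ^+ n = cmod omega ^+ k * cmod omega ^+ (n - k) by rewrite -exprD subnKC.
rewrite mulrACA ler_wpM2r ?mulr_ge0 ?exprn_ge0 ?cmod_ge0//.
by apply: ler_pM => //; exact: P.
Qed.

Lemma ker_kpos m g t : 0 < t -> ker m g t = kpos m g t.
Proof. by move=> t0; rewrite /kpos t0. Qed.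

Local Opaque kpos ker.

(** The product of two partial sums integrates to a square sum; dominated convergence passes to the
    limit under the integral, and [square_triangle_cvg] exchanges squares for the triangles that
    Vandermonde resums. *)
Lemma cconv_ker m g m' g' x : 0 < m -> 0 < m' -> 0 < x ->
  cconv (ker m g) (ker m' g') x = ker (m + m') (g + g') x.
Proof.
move=> m0 m'0 x0; have mm0 : 0 < m + m' by rewrite addr_gt0.
pose F n s := (\sum_(k < n) kterm m g k (x - s)) * (\sum_(j < n) kterm m' g' j s).
have [C C0 HC] := kterm_le_rlk g m0 x0; have [C' C'0 HC'] := kterm_le_rlk g' m'0 x0.
have -> : cconv (ker m g) (ker m' g') x = cconv (kpos m g) (kpos m' g') x.
  by apply: eq_cconv => [t /ker_kpos//|]; apply: aeW => t /ker_kpos.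
rewrite ker_kpos//.
pose a k j := kcoef omega g k * kcoef omega g' j * (rlk (rho * (k + j)%:R + (m + m')) x)%:C.
have sqE n : cintegral setT (F n) = \sum_(k < n) \sum_(j < n) a k j.
  have -> : F n = fun s => \sum_(k < n) \sum_(j < n) kterm m g k (x - s) * kterm m' g' j s.
    apply/funext => s; rewrite /F mulr_suml; apply: eq_bigr => k _.
    by rewrite mulr_sumr.
  have I k := cintegral_sum measurableT
    (fun j : 'I_n => @kterm_mul_integrable m g m' g' k j x m0 m'0).
  have [_ ->] := cintegral_sum measurableT (fun k : 'I_n => (I k).1).
  apply: eq_bigr => k _; rewrite (I k).2; apply: eq_bigr => j _.
  exact: cintegral_kterm_mul.
have triE n : \sum_(p < n) \sum_(k < p.+1) a k (p - k)%N =
    \sum_(p < n) kterm (m + m') (g + g') p x.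
  apply: eq_bigr => p _; rewrite /kterm kcoef_vandermonde mulr_suml; apply: eq_bigr => k _.
  by rewrite /a subnKC// -ltnS.
have cvF : (cintegral setT (F n) : R[i]^o) @[n --> \oo] -->
    (cintegral setT (fun s => kpos m g (x - s) * kpos m' g' s) : R[i]^o).
  apply: (@cdominated_cvg _ _ _ (fun s => C * C' * (rlk m (x - s) * rlk m' s))).
  - move=> n; apply: cmeasurableM; last first.
      by apply: cmeasurable_sum => k; exact: cmeasurable_kterm.
    apply: (@cmeasurableT_comp _ _ _ _ _ (fun t => \sum_(k < n) kterm m g k t)).
      by apply: cmeasurable_sum => k; exact: cmeasurable_kterm.
    exact: measurable_sub_cst.
  - apply: cmeasurableM; last exact: cmeasurable_kpos.
    by apply: (cmeasurableT_comp (cmeasurable_kpos g m0)); exact: measurable_sub_cst.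
  - by move=> s; apply: ccvgM; exact: kpos_cvg.
  - rewrite (_ : _ \o _ = fun s => (C * C')%:E * (rlk m (x - s) * rlk m' s)%:E)%E.
      by apply: integrableZl => //; exact: integrable_rlk_conv.
    by apply/funext => s /=; rewrite EFinM.
  move=> n s; rewrite /F cmodM.
  have r0 : 0 <= C * C' * (rlk m (x - s) * rlk m' s).
    by rewrite mulr_ge0 ?(mulr_ge0 C0 C'0)// mulr_ge0//; exact: rlk_ge0.
  have z0 a1 b1 c1 t : t <= 0 -> \sum_(k < c1) kterm a1 b1 k t = 0.
    by move=> t0; rewrite big1// => k _; rewrite /kterm rlk_le0// mulr0.
  have [s0|s0] := leP s 0; first by rewrite [X in _ * cmod X]z0// cmod0 mulr0.
  have [xs|xs] := leP (x - s) 0; first by rewrite z0// cmod0 mul0r.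
  rewrite mulrACA; apply: ler_pM; rewrite ?cmod_ge0//.
    by apply: le_trans (ler_cmod_sum _ _ _) _; apply: HC; rewrite gerBl ltW.
  apply: le_trans (ler_cmod_sum _ _ _) _; apply: HC'.
  by rewrite -subr_ge0 ltW.
have ck a1 b1 : causal (kpos a1 b1) = kpos a1 b1.
  by apply/boolp.funext => t; exact: causal_kpos.
rewrite cconvE (ck m g) (ck m' g').
have [M M0 HM] := kterm_le_rlk_abs g g' mm0 x0.
have sq := @square_triangle_cvg _ a M HM.
have := ccvgD _ sq (@kpos_cvg (m + m') (g + g') x mm0); rewrite add0r.
rewrite (_ : (fun n => _ - _ + _) = fun n => cintegral setT (F n)).
  by move=> h; exact: (ccvg_unique _ cvF (h _)).
by apply/funext => n; rewrite -triE subrK sqE.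
Qed.

End Kernel.

(** * Absolutely continuous functions are primitives *)

Section ChainVariation.
Context {R : realType}.
Implicit Types (f : R -> R) (l : seq (R * R)) (a b d e x : R).

(** Degenerate intervals are allowed: composing with a nondecreasing map may collapse some, and the
    result must still be a chain. *)
Definition chain l := all (fun p => p.1 <= p.2) l && pairwise (fun p q => p.2 <= q.1) l.

Definition chain_length l : R := \sum_(p <- l) (p.2 - p.1).

Definition chain_variation f l : R := \sum_(p <- l) `|f p.2 - f p.1|.

(* Ordered families of intervals are those cut out by the partitions that
   define the total variation. *)
Definition chain_ac f := forall e, 0 < e -> exists2 d, 0 < d &
  forall l, chain l -> chain_length l < d -> chain_variation f l <= e.

Lemma chain_variation_ge0 f l : 0 <= chain_variation f l.
Proof. by apply: sumr_ge0. Qed.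

Definition partition_chain a (s : seq R) := zip (a :: s) s.

Lemma itv_partition_chain a b s : itv_partition a b s ->
  [/\ chain (partition_chain a s), chain_length (partition_chain a s) = b - a,
    {in partition_chain a s, forall p, a <= p.1 /\ p.2 <= b} &
    forall f, chain_variation f (partition_chain a s) = variation a b f s].
Proof.
elim: s a => [|c s IH] a.
  move=> /itv_partition_nil ->; split=> //.
  - by rewrite /chain_length big_nil subrr.
  - by move=> f; rewrite /chain_variation big_nil /variation big_nil.
move=> /[dup] /itv_partition_cons/[dup] pc /IH[ch len dom var] pa.
have ac : a < c by case: pa => /= /andP[].
have cb : c <= b by exact: itv_partition_le pc.
have E : partition_chain a (c :: s) = (a, c) :: partition_chain c s by [].
split.
- move: ch; rewrite E /chain/= => /andP[-> ->]; rewrite (ltW ac) andbT/=.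
  by rewrite andbT; apply/allP => p /dom[].
- by rewrite E /chain_length big_cons/= -/(chain_length _) len; ring.
- move=> p; rewrite E in_cons => /orP[/eqP ->//|/dom[cp pb]].
  by split => //; exact: le_trans (ltW ac) cp.
- move=> f; rewrite E /chain_variation big_cons/= -/(chain_variation _ _) var.
  by rewrite /variation/= [RHS]big_nat_recl.
Qed.

Lemma chain_cat l1 l2 : chain (l1 ++ l2) =
  [&& chain l1, chain l2 & allrel (fun p q => p.2 <= q.1) l1 l2].
Proof.
rewrite /chain all_cat pairwise_cat.
by case: (all _ l1); case: (all _ l2); case: (allrel _ _ _); case: (pairwise _ _);
  case: (pairwise _ _).
Qed.

(** Cutting an interval of a chain by a partition keeps the total length, so the bound holds for
    every refinement. Suprema are taken one interval at a time, [l0] holding the intervals already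
    cut; near-optimal partitions need not be chosen simultaneously. *)
Lemma total_variation_chain_le f (e d : R) :
  (forall l, chain l -> chain_length l < d -> chain_variation f l <= e) ->
  forall l, chain l -> chain_length l < d ->
  (\sum_(p <- l) total_variation p.1 p.2 f <= e%:E)%E.
Proof.
move=> H.
suff P l l0 : chain (l0 ++ l) -> chain_length (l0 ++ l) < d ->
    ((chain_variation f l0)%:E + \sum_(p <- l) total_variation p.1 p.2 f <= e%:E)%E.
  move=> l cl ld; have := P l [::] cl ld.
  by rewrite /chain_variation big_nil add0e.
elim: l l0 => [|[a b] l IH] l0.
  by rewrite cats0 big_nil adde0 lee_fin => cl ld; exact: H.
move=> cl ld.
have ab : a <= b.
  by move: cl; rewrite chain_cat => /and3P[_ /andP[/= /andP[]]].
have step s : itv_partition a b s ->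
    ((chain_variation f l0)%:E + ((variation a b f s)%:E +
      \sum_(p <- l) total_variation p.1 p.2 f) <= e%:E)%E.
  move=> /itv_partition_chain[ch len dom var]; rewrite addeA -EFinD -var.
  have -> : chain_variation f l0 + chain_variation f (partition_chain a s) =
      chain_variation f (l0 ++ partition_chain a s).
    by rewrite /chain_variation big_cat.
  apply: IH; last first.
    by move: ld; rewrite /chain_length !big_cat/= big_cons -/(chain_length _) -len addrA.
  move: cl; rewrite -catA !chain_cat => /and3P[-> + /allrelP a0].
  rewrite (_ : (a, b) :: l = [:: (a, b)] ++ l)// chain_cat => /and3P[_ -> /allrelP a1] /=.
  rewrite ch /=; apply/andP; split.
    apply/allrelP => p q /dom[_ pb] ql; apply: le_trans pb _.
    by apply: (a1 (a, b)); rewrite ?inE.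
  apply/allrelP => p q pl0; rewrite mem_cat => /orP[/dom[aq _]|ql].
    by apply: le_trans aq; apply: (a0 p (a, b)); rewrite ?inE ?eqxx.
  by apply: a0 => //; rewrite inE ql orbT.
rewrite big_cons/=.
set X := (\sum_(_ <- _) _)%E in step *.
have X0 : (0 <= X)%E.
  rewrite /X big_seq; apply: sume_ge0 => p pl; apply: total_variation_ge0.
  move: cl; rewrite chain_cat => /and3P[_ /andP[/= /andP[_ /allP h] _] _].
  exact: h.
(* Finiteness of the remaining sum, seen on one partition, lets it cross the inequality before the
   supremum is taken. *)
have Xfin : X \is a fin_num.
  have [s sab] : exists s, itv_partition a b s.
    move: ab; rewrite le_eqVlt => /predU1P[->|ab]; last by exists [:: b]; exact: itv_partition1.
    by exists [::]; split => //=.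
  rewrite ge0_fin_numE//; apply: le_lt_trans (ltry e); apply: le_trans (step s sab).
  have v0 : (0 <= (variation a b f s)%:E)%E by rewrite lee_fin; exact: variation_ge0.
  rewrite addeA; apply: leeDr; rewrite adde_ge0// lee_fin; exact: chain_variation_ge0.
rewrite addeCA -leeBrDr; last by rewrite fin_numD Xfin.
apply: ge_ereal_sup => _ [_ [s sab <-] <-].
by rewrite leeBrDr ?fin_numD ?Xfin// addeCA; exact: step.
Qed.

Lemma total_variation_chain_ac f : chain_ac f -> forall e, 0 < e -> exists2 d, 0 < d &
  forall l, chain l -> chain_length l < d ->
  (\sum_(p <- l) total_variation p.1 p.2 f <= e%:E)%E.
Proof.
move=> acf e e0; have [d d0 H] := acf e e0; exists d => //.
exact: total_variation_chain_le H.
Qed.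

Lemma chain1 a b : a <= b -> chain [:: (a, b)].
Proof. by move=> ab; rewrite /chain/= ab. Qed.

(** If [d] answers [e = 1], the variation is at most 1 on intervals of length at most [d / 2], and
    finitely many of them cover [[a, x]]. *)
Lemma chain_ac_fin_num f a x : chain_ac f -> a <= x -> total_variation a x f \is a fin_num.
Proof.
move=> acf ax; have [d d0 H] := total_variation_chain_ac acf (@ltr01 R).
have d20 : 0 < d / 2 by rewrite divr_gt0.
have small y z : y <= z -> z - y <= d / 2 -> total_variation y z f \is a fin_num.
  move=> yz zy; rewrite ge0_fin_numE ?total_variation_ge0//.
  have := H [:: (y, z)] (chain1 yz); rewrite /chain_length !big_seq1/= => h.
  apply: le_lt_trans (h _) (ltry _); apply: le_lt_trans zy _.
  by rewrite gtr_pMr// invf_lt1// ltr1n.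
have P (n : nat) y : a <= y -> y - a <= (d / 2) *+ n -> total_variation a y f \is a fin_num.
  elim: n y => [|n IH] y ay yn.
    by apply: small => //; apply: le_trans yn _; rewrite mulr0n ltW.
  have [yd|yd] := leP (y - a) (d / 2); first exact: small.
  have h1 : a <= y - d / 2 by rewrite lerBrDr -lerBrDl ltW.
  have h2 : y - d / 2 <= y by rewrite gerBl ltW.
  rewrite (total_variationD f h1 h2) fin_numD IH//=; last first.
    by rewrite addrAC lerBlDr -mulrSr.
  by apply: small => //; rewrite subKr.
apply: (P (Num.truncn ((x - a) / (d / 2))).+1) => //.
by rewrite -mulr_natl -ler_pdivrMr// ltW// truncnS_gt.
Qed.

End ChainVariation.

(** * Dyadic exhaustion of open sets *)

Section DyadicCells.
Context {R : realType}.
Variables (b : R) (b0 : 0 < b).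
Implicit Types (n k j : nat) (x : R) (U : set R).

Definition dyad n k : R := b * k%:R / 2 ^+ n.

Definition cell n k : set R := [set` `]dyad n k, dyad n k.+1]].

Lemma le_dyad n k j : (k <= j)%N -> dyad n k <= dyad n j.
Proof.
move=> kj; rewrite /dyad ler_pM2r ?invr_gt0 ?exprn_gt0//.
by rewrite ler_pM2l// ler_nat.
Qed.

Lemma lt_dyad n k : dyad n k < dyad n k.+1.
Proof. by rewrite /dyad ltr_pM2r ?invr_gt0 ?exprn_gt0// ltr_pM2l// ltr_nat. Qed.

Lemma dyadS n k : dyad n.+1 k.*2 = dyad n k.
Proof.
rewrite /dyad exprS -muln2 natrM; field; rewrite ?expf_neq0 ?pnatr_eq0//.
Qed.

Lemma cell_split n k x : cell n k x ->
  exists j, [/\ cell n.+1 j x, cell n.+1 j `<=` cell n k & (j < k.+1.*2)%N].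
Proof.
rewrite /cell/= in_itv/= => /andP[kx xk].
have [xm|xm] := leP x (dyad n.+1 k.*2.+1).
  exists k.*2; split; last by rewrite doubleS.
    by rewrite /= in_itv/= dyadS kx.
  move=> y /=; rewrite !in_itv/= dyadS => /andP[-> /le_trans -> //].
  by rewrite -[leRHS]dyadS doubleS le_dyad.
exists k.*2.+1; split; last by rewrite doubleS.
  by rewrite /= in_itv/= xm -doubleS dyadS.
move=> y /=; rewrite !in_itv/= -doubleS dyadS => /andP[+ ->]; rewrite andbT.
by apply: le_lt_trans; rewrite -dyadS le_dyad.
Qed.

Lemma cell_cover n x : 0 < x <= b -> exists2 k, (k < 2 ^ n)%N & cell n k x.
Proof.
move=> xb; elim: n => [|n [k k2 /cell_split[j [jx _ jk]]]].
  by exists 0%N => //; rewrite /cell/= in_itv/= /dyad expr0 !divr1 mulr0 mulr1.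
by exists j => //; rewrite expnS mul2n; apply: leq_trans jk _; rewrite leq_double.
Qed.

Lemma cell_itv n k : (k < 2 ^ n)%N -> cell n k `<=` [set` `]0, b]].
Proof.
move=> kn y; rewrite /cell/= !in_itv/= => /andP[ky yk]; apply/andP; split.
  by apply: le_lt_trans ky; rewrite /dyad !mulr_ge0 ?invr_ge0 ?exprn_ge0// ltW.
apply: le_trans yk _; rewrite /dyad ler_pdivrMr ?exprn_gt0// ler_pM2l//.
by rewrite -natrX ler_nat.
Qed.

Lemma trivIset_cell n : trivIset setT (cell n).
Proof.
apply/trivIsetP.
have H i j : (i < j)%N -> cell n i `&` cell n j = set0.
  move=> ij; apply/seteqP; split => // x []; rewrite /cell/= !in_itv/= => /andP[_ xi] /andP[jx _].
  by have := lt_le_trans jx (le_trans xi (le_dyad n ij)); rewrite ltxx.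
by move=> i j _ _; rewrite neq_ltn => /orP[|] /H//; rewrite setIC.
Qed.

(** Absolute continuity speaks of finite families of intervals, null sets are enclosed in open sets:
    these finite unions, increasing with [n], link the two. *)
Definition dyadic_core U n : set R :=
  \big[setU/set0]_(k < 2 ^ n | `[< cell n k `<=` U >]) cell n k.

Lemma dyadic_coreP U n x : dyadic_core U n x <->
  exists k, [/\ (k < 2 ^ n)%N, cell n k `<=` U & cell n k x].
Proof.
rewrite /dyadic_core -(@bigcup_pred _ _ (fun k : 'I_(2 ^ n) => `[< cell n k `<=` U >]) (fun k : 'I_(2 ^ n) => cell n k)).
split=> [[k /asboolP kU kx]|[k [kn kU kx]]]; first by exists k.
by exists (Ordinal kn) => //; apply/asboolP.
Qed.

Lemma nondecreasing_dyadic_core U : nondecreasing_seq (dyadic_core U).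
Proof.
apply/nondecreasing_seqP => n; apply/subsetPset => x /dyadic_coreP[k [kn kU kx]].
have [j [jx jk jlt]] := cell_split kx; apply/dyadic_coreP; exists j; split => //.
  by rewrite expnS mul2n; apply: leq_trans jlt _; rewrite leq_double.
exact: subset_trans kU.
Qed.

Lemma measurable_dyadic_core U n : measurable (dyadic_core U n).
Proof. by apply: bigsetU_measurable => k _; exact: measurable_itv. Qed.

Lemma bigcup_dyadic_core U : open U ->
  \bigcup_n dyadic_core U n = U `&` [set` `]0, b]].
Proof.
move=> oU; apply/seteqP; split=> [x [n _ /dyadic_coreP[k [kn kU kx]]]|x [Ux xb]].
  by split; [exact: kU|exact: cell_itv kx].
have /nbhs_ballP[r /= r0 rU] := open_nbhs_nbhs (conj oU Ux).
have [n bn] : exists n, b < r * 2 ^+ n.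
  exists (Num.truncn (b / r)).+1; rewrite -ltr_pdivrMl// mulrC.
  apply: lt_trans (truncnS_gt _) _; rewrite -natrX ltr_nat; exact: ltn_expl.
have /(cell_cover n)[k kn kx] : 0 < x <= b by move: xb; rewrite /= in_itv.
exists n => //; apply/dyadic_coreP; exists k; split => // y ky; apply: rU.
have len : dyad n k.+1 - dyad n k < r.
  rewrite -mulrBl -mulrBr -natr1 addrAC subrr add0r mulr1.
  by rewrite ltr_pdivrMr ?exprn_gt0.
move: kx ky; rewrite /cell/= !in_itv/= /ball/= => /andP[kx xk] /andP[ky yk].
apply: le_lt_trans len; rewrite ler_norml; apply/andP; split.
  by rewrite opprB; apply: lerB => //; exact: ltW.
by apply: lerB => //; exact: ltW.
Qed.

Definition dyadic_chain U n :=
  [seq (dyad n k, dyad n k.+1) | k <- index_iota 0 (2 ^ n) & `[< cell n k `<=` U >]].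

Lemma chain_dyadic U n : chain (dyadic_chain U n).
Proof.
apply/andP; split.
  by apply/allP => p /mapP[k _ ->]/=; exact/ltW/lt_dyad.
rewrite pairwise_map; apply: pairwise_filter.
have : pairwise ltn (index_iota 0 (2 ^ n)).
  by rewrite -sorted_pairwise; [exact: iota_ltn_sorted|exact: ltn_trans].
by apply: sub_pairwise => i j /= ij; exact: le_dyad.
Qed.

(** Serves twice: for the Stieltjes measure of a monotone function, and with [g] the identity, where
    it computes the length of the chain. *)
Lemma content_dyadic_core (m : {measure set (measurableTypeR R) -> \bar R}) (g : R -> R) U n :
  (forall x y, x < y -> m [set` `]x, y]] = (g y - g x)%:E) ->
  m (dyadic_core U n) = (\sum_(p <- dyadic_chain U n) (g p.2 - g p.1))%:E.
Proof.
move=> mg; rewrite /dyadic_core measure_bigsetU_ord_cond; last 2 first.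
- by move=> k _; exact: measurable_itv.
- apply/trivIsetP => i j _ _ ij; have /trivIsetP := @trivIset_cell n.
  by apply.
rewrite /dyadic_chain big_map big_filter big_mkord -sumEFin.
by apply: eq_bigr => k _; rewrite -mg//; exact: lt_dyad.
Qed.

End DyadicCells.

(** * Densities of monotone absolutely continuous functions *)

Section MonotoneRepresentation.
Context {R : realType}.
Local Notation mu := (@lebesgue_measure R).
Implicit Types (G f : R -> R) (b x : R).

Lemma chain_ac_right_continuous G : chain_ac G -> right_continuous G.
Proof.
move=> acG x; apply/cvgrPdist_le => e e0; have [d d0 H] := acG e e0.
near=> t; rewrite distrC.
have xt : x < t by near: t; exact: nbhs_right_gt.
have := H [:: (x, t)] (chain1 (ltW xt)).
rewrite /chain_length /chain_variation !big_seq1/= => ->//.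
by rewrite ltrBlDl; near: t; apply: nbhs_right_lt; rewrite ltrDl.
Unshelve. all: by end_near. Qed.

Lemma chain_ac_monotone_density G b : 0 < b -> {homo G : x y / x <= y} -> chain_ac G ->
  exists h : R -> \bar R, [/\ forall x, h x \is a fin_num,
    mu.-integrable setT h &
    forall x, 0 <= x <= b -> (G x - G 0)%:E = (\int[mu]_(t in `]0%R, x]) h t)%E].
Proof.
move=> b0 ndG acG.
pose Gc := isCumulative.Build R _ R G ndG (chain_ac_right_continuous acG).
pose C : cumulative R R := HB.pack G Gc.
have [m mE] : exists m : {measure set (measurableTypeR R) -> \bar R},
    forall x y, x < y -> m [set` `]x, y]] = (G y - G x)%:E.
  exists (lebesgue_stieltjes_measure C) => x y xy.
  transitivity (wlength C [set` `]x, y]]).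
    by apply: (measurable_mu_extE (wlength C)); exact: is_ocitv.
  by rewrite wlength_itv/= lte_fin xy.
pose D : set R := [set` `]0, b]].
have mD : measurable (D : set (measurableTypeR R)) by exact: measurable_itv.
have moo : (m D < +oo)%E by rewrite mE// ltry.
(* Restricting to []0, b]] makes the Stieltjes measure finite; it is also the part of the line
   filled by the dyadic cells. *)
pose n : {finite_measure set (measurableTypeR R) -> \bar R} := mfrestr mD moo.
have acn : n `<< mu.
  apply/null_content_dominatesP => A mA A0.
  apply/eqP; rewrite eq_le measure_ge0 andbT; apply/lee_addgt0Pr => e e0; rewrite add0e.
  have [d d0 H] := acG e e0.
  have Aoo : (mu A < +oo)%E by rewrite A0 ltry.
  have [U [oU AU Ud]] := lebesgue_regularity_outer mA Aoo d0.
  have muU : (mu U < d%:E)%E.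
    rewrite -(setDUK AU) measureU ?A0 ?add0e//; last first.
      by apply/seteqP; split => // x [? []].
    by apply: measurableD => //; exact: open_measurable.
  have mU : measurable (U `&` D) by apply: measurableI => //; exact: open_measurable.
  (* The chain of each dyadic core has length at most [mu U < d], so its Stieltjes measure is at
     most [e]; continuity from below extends the bound to [U] in []0, b]]. *)
  have nU : (m (U `&` D) <= e%:E)%E.
    have := nondecreasing_cvg_mu (mu := m) (measurable_dyadic_core b U)
      _ (nondecreasing_dyadic_core b0 U).
    rewrite (bigcup_dyadic_core b0 oU) => /(_ mU) cm.
    have <- := cvg_lim (@ereal_hausdorff R) cm.
    apply: lime_le; [by apply/cvg_ex; eexists; exact: cm|near=> k].
    rewrite /= (content_dyadic_core b0 _ _ mE) lee_fin.
    have := H _ (chain_dyadic b0 U k); rewrite /chain_length -lte_fin.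
    have muE x y : x < y -> mu [set` `]x, y]] = (id y - id x)%:E.
      by move=> xy; rewrite lebesgue_measure_itv/= lte_fin xy.
    rewrite -(content_dyadic_core b0 _ _ muE).
    have -> : chain_variation G (dyadic_chain b U k) =
        \sum_(p <- dyadic_chain b U k) (G p.2 - G p.1).
      have /andP[/allP ch _] := chain_dyadic b0 U k.
      rewrite /chain_variation !big_seq; apply: eq_bigr => p /ch pp.
      by rewrite ger0_norm// subr_ge0 ndG.
    apply; apply: le_lt_trans muU; apply: le_measure; rewrite ?inE.
    - exact: measurable_dyadic_core.
    - exact: open_measurable.
    - by move=> x /dyadic_coreP[j [_ jU jx]]; exact: jU.
  by apply: le_trans nU; rewrite /n/= /mfrestr/= /mrestr; apply: le_measure;
    rewrite ?inE//; [exact: measurableI|exact: setSI].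
have [h [h0 hfin ih hE]] := radon_nikodym_sigma_finite acn.
exists h; split => // x /andP[x0 xb].
move: x0; rewrite le_eqVlt => /predU1P[<-|x0].
  by rewrite subrr set_itv_ge ?bnd_simp ?ltxx// integral_set0.
rewrite -hE; last exact: measurable_itv.
rewrite /n/= /mfrestr/= /mrestr setIidl ?mE//.
by move=> t; rewrite /D/= !in_itv/= => /andP[-> tx]; exact: le_trans tx xb.
Unshelve. all: by end_near. Qed.

End MonotoneRepresentation.

(** * Jordan decomposition and extension to the left end *)

Section RealDensity.
Context {R : realType}.
Local Notation mu := (@lebesgue_measure R).
Implicit Types (f g : R -> R) (b c x : R) (l : seq (R * R)).

Definition clamp (k : R -> R) l := [seq (k p.1, k p.2) | p <- l].

Lemma chain_clamp (k : R -> R) l : {homo k : x y / x <= y} ->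
  chain l -> chain (clamp k l).
Proof.
move=> mk /andP[/allP l1 l2]; apply/andP; split.
  by apply/allP => p /mapP[q /l1 ql ->]/=; exact: mk.
by rewrite /clamp pairwise_map; apply: sub_pairwise l2 => p q /=; exact: mk.
Qed.

Lemma chain_length_clamp (k : R -> R) l :
  (forall x y, x <= y -> k y - k x <= y - x) -> chain l ->
  chain_length (clamp k l) <= chain_length l.
Proof.
move=> mk /andP[/allP l1 _]; rewrite /chain_length big_map big_seq [leRHS]big_seq.
by apply: ler_sum => p /l1; exact: mk.
Qed.

Lemma chain_acD f g : chain_ac f -> chain_ac g -> chain_ac (f \+ g).
Proof.
move=> acf acg e e0; have e20 : 0 < e / 2 by rewrite divr_gt0.
have [d d0 df] := acf _ e20; have [d' d'0 dg] := acg _ e20.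
exists (Num.min d d'); first by rewrite lt_min d0.
move=> l cl; rewrite lt_min => /andP[ld ld'].
rewrite (splitr e); apply: le_trans (lerD (df l cl ld) (dg l cl ld')).
rewrite /chain_variation -big_split; apply: ler_sum => p _.
by rewrite /= opprD addrACA ler_normD.
Qed.

(** The variation from 0, continued by a constant to the left, because the Stieltjes measure asks
    for a monotone function on the whole line. *)
Definition clamped_variation f x : R := fine (total_variation 0 (Num.max 0 x) f).

Lemma clamped_variationB f x y : chain_ac f -> x <= y ->
  clamped_variation f y - clamped_variation f x =
  fine (total_variation (Num.max 0 x) (Num.max 0 y) f).
Proof.
move=> acf xy; rewrite /clamped_variation.
have x0 : 0 <= Num.max 0 x by rewrite le_max lexx.
have y0 : 0 <= Num.max 0 y by rewrite le_max lexx.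
have mxy : Num.max 0 x <= Num.max 0 y by rewrite ge_max y0/= le_max xy orbT.
rewrite (total_variationD f x0 mxy) fineD; [by rewrite addrAC subrr add0r| |];
  exact: chain_ac_fin_num.
Qed.

Lemma ler_maxB (r x y : R) : x <= y -> Num.max x r <= Num.max y r <= Num.max x r + (y - x).
Proof. by case: (leP x r); case: (leP y r); lra. Qed.

Lemma ler_minB (r x y : R) : x <= y -> Num.min x r <= Num.min y r <= Num.min x r + (y - x).
Proof. by case: (leP x r); case: (leP y r); lra. Qed.

Lemma ler_max0B (x y : R) : x <= y -> Num.max 0 y - Num.max 0 x <= y - x.
Proof. by move=> /(ler_maxB 0)/andP[_]; rewrite lerBlDl !(maxC 0). Qed.

Lemma homo_max0 : {homo Num.max (0 : R) : x y / x <= y}.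
Proof. by move=> x y /(ler_maxB 0)/andP[+ _]; rewrite !(maxC 0). Qed.

(** Jordan decomposition: [f] is the difference of the nondecreasing functions [F \+ f] and [F],
    where the variation [F] is absolutely continuous by [total_variation_chain_ac]. *)
Lemma chain_ac_density f b : 0 < b -> chain_ac f -> (forall x, x <= 0 -> f x = f 0) ->
  exists2 h : R -> R, mu.-integrable setT (EFin \o h) &
    forall x, 0 <= x <= b -> f x - f 0 = \int[mu]_(t in `[0, x]) h t.
Proof.
move=> b0 acf f0; pose F := clamped_variation f.
have fmax x : f (Num.max 0 x) = f x.
  by have [x0|x0] := leP 0 x => //; rewrite [RHS]f0// ltW.
have FB x y : x <= y -> (F y - F x)%:E = total_variation (Num.max 0 x) (Num.max 0 y) f.
  move=> xy; rewrite /F clamped_variationB// fineK//.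
  by apply: chain_ac_fin_num => //; exact: homo_max0.
have Ff x y : x <= y -> `|f y - f x| <= F y - F x.
  move=> xy; rewrite -lee_fin FB// -(fmax x) -(fmax y).
  by apply: total_variation_ge; exact: homo_max0.
have ndF : {homo F : x y / x <= y}.
  by move=> x y xy; rewrite -subr_ge0 (le_trans _ (Ff x y xy)).
have ndFf : {homo (F \+ f) : x y / x <= y}.
  move=> x y xy; have /ler_normlP[+ _] := Ff x y xy.
  by rewrite /=; lra.
have acF : chain_ac F.
  move=> e e0; have [d d0 H] := total_variation_chain_ac acf e0; exists d => // l cl ld.
  have /H : chain (clamp (Num.max 0) l) by exact: chain_clamp homo_max0 cl.
  rewrite /clamp big_map/= => le; rewrite -lee_fin.
  rewrite /chain_variation -sumEFin.
  apply: le_trans (le _).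
    rewrite big_seq [leRHS]big_seq; apply: lee_sum => p pl.
    have pp : p.1 <= p.2 by case/andP: cl => /allP/(_ p pl).
    by rewrite -FB// lee_fin ger0_norm// subr_ge0 ndF.
  by apply: le_lt_trans ld; apply: chain_length_clamp ler_max0B cl.
have [h1 [h1fin ih1 h1E]] := chain_ac_monotone_density b0 ndF acF.
have [h2 [h2fin ih2 h2E]] := chain_ac_monotone_density b0 ndFf (chain_acD acF acf).
pose h x := fine (h2 x) - fine (h1 x).
have hE : EFin \o h = (fun x => h2 x - h1 x)%E.
  by apply/funext => x; rewrite /= /h EFinB !fineK.
have ih : mu.-integrable setT (EFin \o h) by rewrite hE; exact: integrableB.
exists h => // x xb.
have ihx : mu.-integrable `]0, x] (EFin \o h) by apply: integrableS ih.
rewrite -Rintegral_itv_obnd_cbnd// /Rintegral.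
rewrite (_ : (fun t => (h t)%:E) = (fun t => h2 t - h1 t)%E)// integralB//; last 2 first.
- by apply: integrableS ih2.
- by apply: integrableS ih1.
by rewrite -h1E// -h2E//=; ring.
Qed.

Definition real_ac_itv f b := forall e, 0 < e -> exists2 d, 0 < d &
  forall (n : nat) (u v : 'I_n -> R),
    (forall i, [/\ u i \in `]0, b], v i \in `]0, b] & u i < v i]) ->
    (forall i j, i != j -> v i <= u j \/ v j <= u i) ->
    \sum_(i < n) (v i - u i) < d -> \sum_(i < n) `|f (v i) - f (u i)| < e.

(** The hypothesis controls [f] on []0, b]] only. The chain is therefore clamped to [[r, b]], and
    letting [r] tend to 0 replaces the value at the left end by the limit [c]. *)
Lemma real_ac_itv_chain_ac f b c : 0 < b -> real_ac_itv f b ->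
  f x @[x --> 0^'+] --> c ->
  chain_ac (fun x => if x <= 0 then c else f (Num.min x b)).
Proof.
move=> b0 acf fc e e0; have [d d0 H] := acf e e0; exists d => // l cl ld.
set g := (fun x => _).
have key r : 0 < r -> r <= b ->
    chain_variation (fun x => f (Num.min (Num.max x r) b)) l <= e.
  move=> r0 rb; pose k x := Num.min (Num.max x r) b.
  have mk : {homo k : x y / x <= y}.
    by move=> x y /(ler_maxB r)/andP[h1 h2]; have /andP[] := ler_minB b h1.
  have k1 x y : x <= y -> k y - k x <= y - x.
    move=> /(ler_maxB r)/andP[h1]; rewrite -lerBlDl; apply: le_trans.
    by rewrite lerBlDl; have /andP[] := ler_minB b h1.
  have kb x : k x \in `]0, b].
    by rewrite in_itv/= lt_min b0 ge_min lexx lt_max r0 !orbT.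
  (* Clamping collapses some intervals; the hypothesis wants proper ones, and the collapsed ones
     contribute nothing to the variation. *)
  pose l' := [seq p <- clamp k l | p.1 < p.2].
  have /andP[/allP cl1 cl2] := chain_clamp mk cl.
  have -> : chain_variation (fun x => f (k x)) l = chain_variation f l'.
    rewrite /chain_variation big_filter big_map/= [RHS]big_mkcond/= big_seq [RHS]big_seq.
    apply: eq_bigr => p pl; case: ltP => // kp.
    suff -> : k p.1 = k p.2 by rewrite subrr normr0.
    apply/eqP; rewrite eq_le kp andbT; apply: mk.
    by case/andP: cl => /allP/(_ p pl).
  have len : chain_length l' < d.
    apply: le_lt_trans ld; apply: le_trans (chain_length_clamp k1 cl).
    rewrite /chain_length big_filter [leRHS](bigID (fun p => p.1 < p.2))/= lerDl.
    rewrite big_seq_cond; apply: sumr_ge0 => p /andP[/cl1].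
    by rewrite subr_ge0.
  have pw : pairwise (fun p q => p.2 <= q.1) l' by exact: pairwise_filter.
  have := H (size l') (fun i => (nth (0, 0) l' i).1) (fun i => (nth (0, 0) l' i).2).
  rewrite /chain_variation /chain_length !(big_nth (0, 0)) !big_mkord in len *.
  move=> h; apply/ltW; apply: h => //.
  - move=> i; have : nth (0, 0) l' i \in l' by exact: mem_nth.
    by rewrite mem_filter => /andP[lt /mapP[p pl E]]; rewrite lt E !kb.
  - move=> i j; rewrite neq_ltn => /orP[ij|ji].
      by left; have /pairwiseP := pw; apply; rewrite ?inE.
    by right; have /pairwiseP := pw; apply; rewrite ?inE.
have lim x : f (Num.min (Num.max x r) b) @[r --> 0^'+] --> g x.
  rewrite /g; have [x0|x0] := leP x 0.
    apply: cvg_trans fc; apply: near_eq_cvg; near=> r.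
    have r0 : 0 < r by near: r; exact: nbhs_right_gt.
    have rb : r < b by near: r; exact: nbhs_right_lt.
    by rewrite max_r ?(le_trans x0 (ltW r0))// min_l// ltW.
  apply: cvg_near_cst; near=> r.
  by rewrite max_l//; near: r; exact: nbhs_right_le.
have : chain_variation (fun x => f (Num.min (Num.max x r) b)) l @[r --> 0^'+]
    --> chain_variation g l.
  rewrite /chain_variation; apply: cvg_big => [|p _].
    exact: add_continuous.
  by apply: cvg_norm; exact: cvgB.
move=> cv; apply: (cvgr_to_le cv); near=> r; apply: key.
  by near: r; exact: nbhs_right_gt.
by near: r; exact: nbhs_right_le.
Unshelve. all: by end_near. Qed.

End RealDensity.

(** * Differentiation of primitives and gluing of local densities *)

Section RealPrimitive.
Context {R : realType}.
Local Notation mu := (@lebesgue_measure R).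
Implicit Types (f g h w : R -> R) (b c x : R).

Lemma ae_imp (P Q : R -> Prop) : (forall x, P x -> Q x) ->
  {ae mu, forall x, P x} -> {ae mu, forall x, Q x}.
Proof. by move=> PQ; apply: filterS; first exact: (ae_filter_ringOfSetsType mu). Qed.

Lemma ae_and (P Q : R -> Prop) : {ae mu, forall x, P x} -> {ae mu, forall x, Q x} ->
  {ae mu, forall x, P x /\ Q x}.
Proof. by move=> hP hQ; apply: filterI => //; exact: (ae_filter_ringOfSetsType mu). Qed.

Lemma integrable_setT_itv (h : R -> \bar R) : mu.-integrable setT h ->
  forall b, mu.-integrable `[0, b] h.
Proof. by move=> ih b; exact: integrableS ih. Qed.

Lemma derive1_near_eq f g x : (\forall t \near x, f t = g t) -> derive1 f x = derive1 g x.
Proof. by move=> fg; rewrite !derive1E; exact: near_eq_derive. Qed.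

Lemma derive1_addl f c x : derive1 (fun t => c + f t) x = derive1 f x.
Proof.
rewrite /derive1; set F := (fun=> _); set G := (fun=> _); suff -> : F = G by [].
by apply/funext => t; rewrite /F opprD addrACA subrr add0r.
Qed.

(** Lebesgue differentiation is applied to the globally integrable truncations of [h] to
    [[0, n.+1]]; near a point below [n.+1] the primitives coincide, hence so do the derivatives. *)
Lemma ae_derive1_primitive h : (forall b, mu.-integrable `[0, b] (EFin \o h)) ->
  {ae mu, forall x, 0 < x -> derive1 (fun y => \int[mu]_(t in `[0, y]) h t) x = h x}.
Proof.
move=> ih; pose I n : set R := [set` `[0, n.+1%:R]].
have key n : {ae mu, forall x, 0 < x < n.+1%:R ->
    derive1 (fun y => \int[mu]_(t in `[0, y]) h t) x = h x}.
  have ihn : mu.-integrable setT (EFin \o (h \_ (I n))).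
    rewrite -restrict_EFin; apply/integrable_restrict. 
    - exact: measurable_itv.
    - exact: measurableT.
    - by rewrite setTI; exact: ih.
  have := @FTC1 R (h \_ (I n)) (BLeft 0) _ (integrable_locally_restrict (measurable_itv _) (ih n.+1%:R)).
  move=> /(_ (integrable_setT_itv ihn)).
  apply: filterS; first exact: (ae_filter_ringOfSetsType mu).
  move=> x H /andP[x0 xn]; have [_ E] := H x0.
  have xI : I n x by rewrite /I/= in_itv/= (ltW x0) ltW.
  transitivity ((h \_ (I n)) x); last by rewrite patchE mem_set.
  rewrite -E; apply: derive1_near_eq; near=> t.
  apply: eq_Rintegral => s; rewrite inE/= in_itv/= => /andP[s0 st].
  rewrite patchE mem_set// /I/= in_itv/= s0/=; apply: le_trans st _.
  by near: t; apply: filterS (lt_nbhsl xn) => ? /ltW.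
apply: ae_imp (ae_foralln key) => x H x0; apply: (H (Num.truncn x)); rewrite x0; exact: truncnS_gt.
Unshelve. all: by end_near. Qed.

Lemma real_ac_density g c : (forall b, 0 < b -> real_ac_itv g b) ->
  g x @[x --> 0^'+] --> c ->
  exists w, [/\ measurable_fun setT w,
    forall b, mu.-integrable `[0, b] (EFin \o w),
    forall x, 0 < x -> g x = c + \int[mu]_(t in `[0, x]) w t &
    {ae mu, forall x, 0 < x -> derive1 g x = w x}].
Proof.
move=> acg gc.
have hn n : {h : R -> R | mu.-integrable setT (EFin \o h) /\
    forall x, 0 < x <= n.+1%:R -> g x = c + \int[mu]_(t in `[0, x]) h t}.
  apply/cid; have n0 : 0 < n.+1%:R :> R by rewrite ltr0n.
  have ac := real_ac_itv_chain_ac n0 (acg _ n0) gc.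
  have [|h ih hE] := chain_ac_density n0 ac; first by move=> x x0; rewrite x0 lexx.
  exists h; split => // x /andP[x0 xn]; rewrite -hE; last by rewrite xn (ltW x0).
  rewrite lexx leNgt x0/= min_l//; by rewrite addrC subrK.
pose h n := projT1 (hn n).
have ih n : mu.-integrable setT (EFin \o h n) := (projT2 (hn n)).1.
have hE n x : 0 < x <= n.+1%:R -> g x = c + \int[mu]_(t in `[0, x]) h n t := (projT2 (hn n)).2 x.
have mh n : measurable_fun setT (EFin \o h n) by have /integrableP[] := ih n.
have ae_h : {ae mu, forall x, forall n, 0 < x < n.+1%:R -> derive1 g x = h n x}.
  apply: ae_foralln => n.
  have := @ae_derive1_primitive (h n) _ => /(_ (integrable_setT_itv (ih n))).
  apply: filterS; first exact: (ae_filter_ringOfSetsType mu).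
  move=> x H /andP[x0 xn]; rewrite -H//.
  transitivity (derive1 (fun y => c + \int[mu]_(t in `[0, y]) h n t) x).
    apply: derive1_near_eq; near=> t; apply: hE; apply/andP; split.
      by near: t; exact: lt_nbhsr.
    by near: t; apply: filterS (lt_nbhsl xn) => ? /ltW.
  exact: derive1_addl.
(* For almost every [x > 0] all densities with [n.+1 > x] take the value [derive1 g x]. The upper
   limit glues them into a function measurable by construction. *)
pose w x := fine (limn_esup (fun n => (h n x)%:E)).
have mw : measurable_fun setT w.
  by apply: measurableT_comp => //; exact: measurable_fun_limn_esup.
have ae_w : {ae mu, forall x, 0 < x -> derive1 g x = w x}.
  move: ae_h; apply: filterS; first exact: (ae_filter_ringOfSetsType mu).
  move=> x H x0; rewrite /w.
  have cv : (h n x)%:E @[n --> \oo] --> (derive1 g x)%:E.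
    apply: cvg_near_cst; near=> n; congr EFin; apply/esym/H; rewrite x0.
    near: n; exists (Num.truncn x) => // n /= xn; apply: lt_le_trans (truncnS_gt x) _.
    by rewrite ler_nat ltnS.
  have ccv : cvgn (fun n => (h n x)%:E) by apply/cvg_ex; exists (derive1 g x)%:E.
  by rewrite is_cvg_limn_esupE// (cvg_lim _ cv).
have ae_wh n : {ae mu, forall x, `[0, n%:R]%classic x -> w x = h n x}.
  have ne0 : {ae mu, forall x, x <> 0 :> R}.
    exists [set 0]; split; [exact: measurable_set1|exact: lebesgue_measure_set1|].
    by move=> x /= /contrapT.
  apply: ae_imp (ae_and (ae_and ae_h ae_w) ne0) => x [[h1 h2] /eqP x0]; rewrite /= in_itv/= => /andP[x0' xn].
  have {}x0 : 0 < x by rewrite lt_def x0.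
  by rewrite -h2// (h1 n)// x0/= (le_lt_trans xn)// ltr_nat.
have wI n : mu.-integrable `[0, n%:R] (EFin \o w).
  have ihn : mu.-integrable `[0, n%:R] (EFin \o h n) by exact: integrableS (ih n).
  apply/integrableP; split; first by apply/measurable_EFinP; exact: measurable_funS mw.
  have /integrableP[_] := ihn; apply: le_lt_trans.
  rewrite (@ae_eq_integral_nonmeasurable _ _ _ (fun x => `|(h n x)%:E|)%E)//.
  have := ae_wh n; apply: filterS; first exact: (ae_filter_ringOfSetsType mu).
  by move=> x H xI; rewrite /= H.
have leT (b : R) : b <= (Num.truncn b).+1%:R by exact/ltW/truncnS_gt.
exists w; split => //.
  by move=> b; apply: integrableS (wI (Num.truncn b).+1) => //; apply: subset_itvl; rewrite bnd_simp.
move=> x x0; rewrite (@hE (Num.truncn x).+1); last first.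
  by rewrite x0 (le_trans (leT x))// ler_nat.
congr (_ + _); rewrite /Rintegral; congr fine.
apply: ae_eq_integral_nonmeasurable; have := ae_wh (Num.truncn x).+1.
apply: filterS; first exact: (ae_filter_ringOfSetsType mu).
move=> t H; rewrite /= in_itv/= => /andP[t0 tx]; rewrite H//=.
by rewrite in_itv/= t0 (le_trans tx).
Unshelve. all: by end_near. Qed.

End RealPrimitive.

(** * Complex absolutely continuous functions and their densities *)

Section ComplexPrimitive.
Context {R : realType}.
Local Notation mu := (@lebesgue_measure R).
Implicit Types (g p q w : R -> R[i]) (b x : R) (c : R[i]).

Lemma real_ac_itv_Re g b : abs_continuous `]0, b] g ->
  real_ac_itv (fun t => complex.Re (g t)) b /\ real_ac_itv (fun t => complex.Im (g t)) b.
Proof.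
move=> acg.
have key (h : R[i] -> R) : (forall z z', h (z - z') = h z - h z') ->
    (forall z, `|h z| <= cmod z) -> real_ac_itv (fun t => h (g t)) b.
  move=> hB hle e e0; have [d d0 H] := acg e e0; exists d => // n u v uv dis len.
  have := H n u v uv dis len; rewrite (eq_bigr _ (fun i _ => normC_cmod _)).
  rewrite -(raddf_sum (real_complex R)) ltcR; apply: le_lt_trans.
  by apply: ler_sum => i _; rewrite -hB.
split; apply: key.
- by move=> z z'; rewrite cReD cReN.
- exact: normr_Re_le.
- by move=> z z'; rewrite cImD cImN.
- exact: normr_Im_le.
Qed.

Lemma loc_ac_density g c : loc_abs_continuous g ->
  (g x : R[i]^o) @[x --> 0^'+] --> (c : R[i]^o) ->
  exists w, [/\ cmeasurable setT w, loc_integrable w,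
    forall x, 0 < x -> g x = c + cintegral `[0, x] w &
    {ae mu, forall x, 0 < x -> cderive g x = w x}].
Proof.
move=> acg /ccvgP[cr ci].
have [w1 [m1 i1 E1 D1]] := real_ac_density (fun b Hb => (real_ac_itv_Re (acg b Hb)).1) cr.
have [w2 [m2 i2 E2 D2]] := real_ac_density (fun b Hb => (real_ac_itv_Re (acg b Hb)).2) ci.
exists (fun t => w1 t +i* w2 t); split => //.
  by move=> x x0; apply: complex_ext; rewrite ?cReD ?cImD; [exact: E1|exact: E2].
by apply: ae_imp (ae_and D1 D2) => x [h1 h2] x0; rewrite /cderive h1// h2.
Qed.

Lemma primitive_inj p q : loc_integrable p -> loc_integrable q ->
  (forall x, 0 < x -> cintegral `[0, x] p = cintegral `[0, x] q) ->
  {ae mu, forall x, 0 < x -> p x = q x}.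
Proof.
move=> ip iq pq.
have key (h : R[i] -> R) : (forall p, loc_integrable p -> forall b, mu.-integrable `[0, b] (fun x => (h (p x))%:E)) ->
    (forall x, 0 < x -> \int[mu]_(t in `[0, x]) h (p t) = \int[mu]_(t in `[0, x]) h (q t)) ->
    {ae mu, forall x, 0 < x -> h (p x) = h (q x)}.
  move=> hi hE; have := ae_and (ae_derive1_primitive (hi p ip)) (ae_derive1_primitive (hi q iq)).
  apply: ae_imp => x [h1 h2] x0; rewrite -h1// -h2//; apply: derive1_near_eq.
  by near=> t; apply: hE; near: t; exact: lt_nbhsr.
have H1 := key (fun z => complex.Re z) (fun p ip b => (ip b).1)
  (fun x Hx => congr1 (fun z => complex.Re z) (pq x Hx)).
have H2 := key (fun z => complex.Im z) (fun p ip b => (ip b).2)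
  (fun x Hx => congr1 (fun z => complex.Im z) (pq x Hx)).
by apply: ae_imp (ae_and H1 H2) => x [h1 h2] x0; apply: complex_ext; [exact: h1|exact: h2].
Unshelve. all: by end_near. Qed.

Lemma loc_integrable_small w b (e : R) : loc_integrable w -> 0 < e ->
  exists2 d : R, 0 < d & forall A, measurable A -> A `<=` [set` `[0, b]] ->
    (mu A < d%:E -> \int[mu]_(t in A) (cmod (w t))%:E < e%:E)%E.
Proof.
move=> iw e0; pose I : set R := [set` `[0, b]].
have mI : measurable (I : set (measurableTypeR R)) by exact: measurable_itv.
have /(cintegrableP _ mI)[mw woo] := iw b.
have mcw : measurable_fun I (fun t => cmod (w t)) by exact: measurable_cmod.
have ih : mu.-integrable setT (EFin \o ((fun t => cmod (w t)) \_ I)).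
  rewrite -restrict_EFin; apply/integrable_restrict.
  - exact: measurable_itv.
  - exact: measurableT.
  rewrite setTI; apply/integrableP; split; first exact/measurable_EFinP.
  by under eq_integral do rewrite /= ger0_norm ?cmod_ge0//.
have [d [d0 H]] := integral_normr_continuous ih e0; exists d => // A mA AI Ad.
have fin : (\int[mu]_(t in A) (cmod (w t))%:E)%E \is a fin_num.
  rewrite ge0_fin_numE; last by apply: integral_ge0 => t _; rewrite lee_fin cmod_ge0.
  apply: le_lt_trans woo; apply: ge0_subset_integral => //; first exact/measurable_EFinP.
  by move=> t _; rewrite lee_fin cmod_ge0.
rewrite -(fineK fin) lte_fin; apply: le_lt_trans (H A mA Ad).
rewrite le_eqVlt; apply/orP; left; apply/eqP.
rewrite /Rintegral; congr fine; apply: eq_integral => x; rewrite inE => Ax.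
by rewrite patchE mem_set ?ger0_norm ?cmod_ge0//; exact: AI.
Qed.

Lemma cintegral_itvB w (u v : R) : loc_integrable w -> 0 <= u -> u <= v ->
  cintegral `[0, v] w - cintegral `[0, u] w = cintegral `]u, v] w.
Proof.
move=> iw u0 uv; apply: complex_ext; rewrite ?cReD ?cImD ?cReN ?cImN /cintegral/=.
  by rewrite Rintegral_itvB ?bnd_simp//; exact: (iw v).1.
by rewrite Rintegral_itvB ?bnd_simp//; exact: (iw v).2.
Qed.

Lemma primitive_loc_ac g c w : loc_integrable w ->
  (forall x, 0 < x -> g x = c + cintegral `[0, x] w) ->
  loc_abs_continuous g /\ ((g x : R[i]^o) @[x --> 0^'+] --> (c : R[i]^o)).
Proof.
move=> iw gE; split.
  (* Half of [e], because [cmod_cintegral] costs a factor 2. *)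
  move=> b b0 e e0; have e20 : 0 < e / 2 by rewrite divr_gt0.
  have [d d0 H] := loc_integrable_small b iw e20; exists d => // n u v uv dis len.
  rewrite (eq_bigr _ (fun i _ => normC_cmod _)) -(raddf_sum (real_complex R)) ltcR -lte_fin.
  have mcw : measurable_fun [set` `[0, b]] (fun t => cmod (w t)).
    by have /cintegrableP[//|mw _] := iw b; exact: measurable_cmod.
  pose A : set R := \big[setU/set0]_(i < n) [set` `]u i, v i]].
  have mi i : measurable ([set` `]u i, v i]] : set R) by exact: measurable_itv.
  have tI : trivIset setT (fun i => [set` `]u i, v i]] : set R).
    apply/trivIsetP => i j _ _ ij; apply/seteqP; split => // t [].
    rewrite /= !in_itv/= => /andP[h1 h2] /andP[h3 h4].
    have [h|h] := dis i j ij.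
      by have := lt_le_trans h3 (le_trans h2 h); rewrite ltxx.
    by have := lt_le_trans h1 (le_trans h4 h); rewrite ltxx.
  have mA : measurable A by exact: bigsetU_measurable.
  have Ib i : [set` `]u i, v i]] `<=` [set` `[0, b]].
    have [] := uv i; rewrite /= !in_itv/= => /andP[u0 _] /andP[_ vb] _ t/=.
    by rewrite !in_itv/= => /andP[ut tv]; rewrite (le_trans tv vb) (ltW (lt_trans u0 ut)).
  have AI : A `<=` [set` `[0, b]].
    by rewrite /A; elim/big_ind : _ => // X Z XI ZI t [/XI|/ZI].
  have Ad : (mu A < d%:E)%E.
    rewrite /A measure_bigsetU_ord//.
    rewrite (eq_bigr (fun i => (v i - u i)%:E)) ?sumEFin ?lte_fin// => i _.
    have [_ _ lt] := uv i; transitivity (mu [set` `]u i, v i]]) => //.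
    by rewrite lebesgue_measure_itv/= lte_fin lt.
  have := H A mA AI Ad; rewrite ge0_integral_bigsetU//; last 4 first.
  - exact: index_enum_uniq.
  - exact: sub_trivIset tI.
  - by apply/measurable_EFinP; apply: measurable_funS mcw.
  - by move=> t _; rewrite lee_fin cmod_ge0.
  move=> le; rewrite -sumEFin.
  apply: (@le_lt_trans _ _ (\sum_(i < n) 2%:E * \int[mu]_(t in `]u i, v i]) (cmod (w t))%:E)%E).
    apply: lee_sum => i _; have [] := uv i; rewrite /= !in_itv/= => /andP[u0 _] /andP[v0 vb] uvi.
    rewrite !gE// opprD addrACA subrr add0r cintegral_itvB ?(ltW u0) ?(ltW uvi)//.
    apply: cmod_cintegral => //.
    by split; [apply: integrableS (iw b).1|apply: integrableS (iw b).2].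
  rewrite -ge0_sume_distrr; last by move=> i _; apply: integral_ge0 => t _; rewrite lee_fin cmod_ge0.
  by rewrite muleC -lte_pdivlMr// -EFinM.
apply/cvgrPdist_le => e /ltc0_real[-> e0].
have e20 : 0 < complex.Re e / 2 by rewrite divr_gt0.
have [d d0 H] := loc_integrable_small 1 iw e20.
near=> x.
have x0 : 0 < x by near: x; exact: nbhs_right_gt.
have x1 : x <= 1 by near: x; exact: nbhs_right_le.
have xd : x < d by near: x; exact: nbhs_right_lt.
rewrite distrC gE// addrAC subrr add0r normC_cmod lecR -lee_fin.
apply: le_trans (cmod_cintegral _ (iw x)) _ => //.
rewrite muleC -lee_pdivlMr// -EFinM; apply/ltW/H => //.
  by apply: subset_itvl; rewrite bnd_simp.
by rewrite lebesgue_measure_itv/= lte_fin x0 sube0 lte_fin.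
Unshelve. all: by end_near. Qed.

End ComplexPrimitive.

(** * Weakly singular kernels *)

Section AbelKernels.
Context {R : realType}.
Local Notation mu := (@lebesgue_measure R).
Local Notation erlk a := (EFin \o @rlk R a).
Implicit Types (p q r : R -> R[i]) (a b x y : R) (f g : R -> \bar R).

#[local] Hint Resolve amod_ge0 : core.

Lemma erlk_ge0 a : 0 < a -> forall t, (0 <= (erlk a) t)%E.
Proof. by move=> a0 t; rewrite lee_fin rlk_ge0. Qed.

Lemma measurable_erlk a : measurable_fun [set: R] (erlk a).
Proof. by apply/measurable_EFinP; exact: measurable_rlk. Qed.

(** Causality confines both arguments to [t <= x], so local bounds on kernels, whose constants
    depend on the right end, are sufficient. *)
Lemma nconv_le_itv f f' g g' (c d x : R) : 0 <= c -> 0 <= d ->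
  measurable_fun [set: R] f -> measurable_fun [set: R] f' ->
  measurable_fun [set: R] g -> measurable_fun [set: R] g' ->
  (forall t, 0 <= f t)%E -> (forall t, 0 <= f' t)%E ->
  (forall t, 0 <= g t)%E -> (forall t, 0 <= g' t)%E ->
  (forall t : R, t < 0 -> f t = 0%E) -> (forall t : R, t < 0 -> g t = 0%E) ->
  (forall t : R, (t <= x)%R -> f t <= c%:E * f' t)%E ->
  (forall t : R, (t <= x)%R -> g t <= d%:E * g' t)%E ->
  (nconv f g x <= (c * d)%:E * nconv f' g' x)%E.
Proof.
move=> c0 d0 mf mf' mg mg' f0 f'0 g0 g'0 fN gN ff' gg'.
rewrite -nconvZ//; apply: ge0_le_integral => //.
- by move=> s _; exact: mule_ge0.
- exact: measurable_nconv_section.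
- by apply: (@measurable_nconv_section _ (fun t => (c%:E * f' t)%E) (fun t => (d%:E * g' t)%E) x);
    exact: measurable_funeM.
move=> s _; have [s0|s0] := ltP s 0.
  by rewrite gN// mule0 !mule_ge0// ?lee_fin.
have [xs|xs] := ltP x s.
  by rewrite fN ?subr_lt0// mul0e !mule_ge0// ?lee_fin.
by apply: lee_pmul => //; [apply: ff'; rewrite gerBl|exact: gg'].
Qed.

(* The values at t <= 0 are normalized to 0: the kernels of the statement take
   irrelevant values there, which would break pointwise bounds by rlk. *)
Definition abel_kernel a p := [/\ cmeasurable [set: R] p, forall t, t <= 0 -> p t = 0 &
  forall b, 0 < b -> exists2 C, 0 <= C & forall t, t <= b -> cmod (p t) <= C * rlk a t].

Lemma abel_kernel_causal a p : abel_kernel a p -> causal p = p.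
Proof.
by move=> [_ p0 _]; apply/funext => t; rewrite /causal; case: leP => // /ltW/p0.
Qed.

Lemma abel_kernel_cmeasurable a p : abel_kernel a p -> cmeasurable [set: R] (causal p).
Proof. by move=> kp; rewrite (abel_kernel_causal kp); case: kp. Qed.

Lemma abel_kernel_amod a p : abel_kernel a p -> amod p = (fun t => (cmod (p t))%:E).
Proof. by move=> kp; apply/funext => t; rewrite /amod (abel_kernel_causal kp). Qed.

Lemma abel_kernel_measurable_amod a p : abel_kernel a p -> measurable_fun [set: R] (amod p).
Proof. by move=> /abel_kernel_cmeasurable/measurable_amod. Qed.

Lemma abel_kernel_loc_integrable a p : 0 < a -> abel_kernel a p -> loc_integrable p.
Proof.
move=> a0 [mp _ kp]; apply: (loc_integrable_le_rlk a0 mp) => b /kp[C _ H].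
by exists C => t /andP[_ /H].
Qed.

Lemma abel_kernelZ (z : R[i]) a p :
  abel_kernel a p -> abel_kernel a (fun t => z * p t).
Proof.
move=> [mp p0 pC]; split.
- by apply: cmeasurableM => //; exact: cmeasurable_cst.
- by move=> t t0; rewrite p0// mulr0.
move=> b /pC[C C0 H]; exists (cmod z * C); first by rewrite mulr_ge0// cmod_ge0.
by move=> t tb; rewrite cmodM -mulrA ler_wpM2l ?cmod_ge0// H.
Qed.

Lemma abel_kernel_nconv_le a p g b : 0 < a -> abel_kernel a p -> 0 < b ->
  measurable_fun [set: R] g -> (forall t, 0 <= g t)%E -> (forall t, t < 0 -> g t = 0%E) ->
  exists2 C, 0 <= C & forall x, x <= b ->
    (nconv (amod p) g x <= C%:E * nconv (erlk a) g x)%E.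
Proof.
move=> a0 kp b0 mg g0 gN; have [_ _ /(_ _ b0)[C C0 H]] := kp.
exists C => // x xb; rewrite -[C]mulr1; apply: nconv_le_itv => //.
- exact: abel_kernel_measurable_amod kp.
- exact: measurable_erlk.
- exact: erlk_ge0.
- exact: amod_lt0.
- by move=> t tx; rewrite (abel_kernel_amod kp) lee_fin H// (le_trans tx).
- by move=> t _; rewrite mul1e.
Qed.

(* Convolution identities between kernels of total order a hold at these x. *)
Definition rlk_finite a q x : Prop := (nconv (erlk a) (amod q) x < +oo)%E.

Lemma abel_kernel_nconv_lty a p q x : 0 < a -> abel_kernel a p -> loc_integrable q ->
  0 < x -> rlk_finite a q x -> (nconv (amod p) (amod q) x < +oo)%E.
Proof.
move=> a0 kp /loc_integrableP[mq _] x0 fq.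
have [C C0 H] := abel_kernel_nconv_le a0 kp x0 (measurable_amod mq) (amod_ge0 q) (@amod_lt0 _ q).
apply: le_lt_trans (H x (lexx x)) _; apply: lte_mul_pinfty => //.
Qed.

Lemma ae_rlk_finite a q : 0 < a -> loc_integrable q ->
  {ae mu, forall x, rlk_finite a q x}.
Proof.
move=> a0 iq; have := ae_nconv_lty (loc_integrable_rlk a0) iq.
by apply: ae_imp => x; rewrite /rlk_finite (_ : amod _ = erlk a)//; apply/funext => t; exact: amod_rlk.
Qed.

(** The quotient of the two kernels is a multiple of [t ^ (a' - a)]: raising the order weakens the
    singularity at 0. *)
Lemma rlk_le a a' b : 0 < a -> a <= a' -> 0 < b ->
  exists2 C, 0 <= C & forall t, t <= b -> rlk a' t <= C * rlk a t.
Proof.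
move=> a0 aa' b0; have a'0 := lt_le_trans a0 aa'.
exists (b `^ (a' - a) * Gamma a / Gamma a').
  by rewrite !mulr_ge0 ?powR_ge0 ?invr_ge0 ?(ltW (Gamma_gt0 _)).
move=> t tb; have [t0|t0] := leP t 0; first by rewrite !rlk_le0// mulr0.
rewrite /rlk /pw t0 [leRHS](_ : _ = b `^ (a' - a) * t `^ (a - 1) / Gamma a'); last first.
  by field; rewrite !gt_eqF ?Gamma_gt0.
rewrite ler_pM2r ?invr_gt0 ?Gamma_gt0// (_ : a' - 1 = a' - a + (a - 1)); last by ring.
rewrite powRD_gt0// ler_wpM2r ?powR_ge0//; apply: ge0_ler_powR; rewrite ?nnegrE ?subr_ge0//.
  exact: ltW.
exact: ltW.
Qed.

Lemma abel_kernel_rlk a a' : 0 < a -> a <= a' -> abel_kernel a (fun t => (rlk a' t)%:C).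
Proof.
move=> a0 aa'; have a'0 := lt_le_trans a0 aa'; split.
- by apply: cmeasurable_real; exact: measurable_rlk.
- by move=> t t0; rewrite rlk_le0.
move=> b b0; have [C C0 H] := rlk_le a0 aa' b0; exists C => // t tb.
by rewrite cmod_real ger0_norm ?rlk_ge0// H.
Qed.

Lemma rlk_finite_le a a' q x : 0 < a -> a <= a' -> loc_integrable q -> 0 < x ->
  rlk_finite a q x -> rlk_finite a' q x.
Proof.
move=> a0 aa' iq x0 fq; have a'0 := lt_le_trans a0 aa'.
have := abel_kernel_nconv_lty a0 (abel_kernel_rlk a0 aa') iq x0 fq.
by rewrite /rlk_finite (_ : amod _ = erlk a')//; apply/funext => t; exact: amod_rlk.
Qed.

(** The kernel of order 1 is constant on the positive half-line, so finiteness is local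
    integrability; higher orders follow by [rlk_finite_le]. This turns identities that hold almost
    everywhere into identities at every [x > 0]. *)
Lemma rlk_finite_ge1 a q x : 1 <= a -> loc_integrable q -> 0 < x -> rlk_finite a q x.
Proof.
move=> a1 iq x0; apply: (rlk_finite_le ltr01 a1 iq x0).
have /loc_integrableP[mq /(_ x) ioo] := iq.
have mA := measurable_amod mq.
apply: le_lt_trans (_ : (Gamma 1)^-1%:E * \int[mu]_(t in `[0%R, x]) amod q t < +oo)%E; last first.
  apply: lte_mul_pinfty => //.
    by rewrite lee_fin invr_ge0 ltW// Gamma_gt0.
rewrite -ge0_integralZl//; last 2 first.
- exact: measurable_funTS.
- by rewrite lee_fin invr_ge0 ltW// Gamma_gt0.
rewrite [leRHS]integral_mkcond; apply: ge0_le_integral => //.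
- by move=> s _; rewrite mule_ge0// erlk_ge0.
- by apply: measurable_nconv_section => //; exact: measurable_erlk.
- apply/measurable_restrict => //; rewrite setTI.
  by apply: measurable_funeM; exact: measurable_funTS.
move=> s _; rewrite patchE; case: ifPn => [|/negP sx].
  rewrite inE/= in_itv/= => /andP[s0 sx].
  apply: lee_wpmul2r; first exact: amod_ge0.
  rewrite lee_fin /rlk /pw; case: ltP => _.
    by rewrite subrr powRr0 mul1r.
  by rewrite mul0r invr_ge0 ltW// Gamma_gt0.
have [s0|s0] := ltP s 0; first by rewrite amod_lt0// mule0.
have [xs|xs] := ltP x s; first by rewrite /= rlk_le0 ?mul0e// subr_le0 ltW.
by exfalso; apply: sx; rewrite inE/= in_itv/= s0.
Qed.

Lemma abel_kernel_nconv2_le a b p r c : 0 < a -> 0 < b -> abel_kernel a p -> abel_kernel b r ->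
  0 < c -> exists2 C, 0 <= C & forall x, x <= c ->
    (nconv (amod p) (amod r) x <= (C * rlk (a + b) x)%:E)%E.
Proof.
move=> a0 b0 kp kr c0; have [_ _ /(_ _ c0)[C C0 H]] := kp; have [_ _ /(_ _ c0)[D D0 H']] := kr.
exists (C * D); first exact: mulr_ge0.
move=> x xc; rewrite EFinM -nconv_rlk//; apply: nconv_le_itv => //.
- exact: abel_kernel_measurable_amod kp.
- exact: measurable_erlk.
- exact: abel_kernel_measurable_amod kr.
- exact: measurable_erlk.
- exact: erlk_ge0.
- exact: erlk_ge0.
- exact: amod_lt0.
- exact: amod_lt0.
- by move=> t tx; rewrite (abel_kernel_amod kp) lee_fin H// (le_trans tx).
- by move=> t tx; rewrite (abel_kernel_amod kr) lee_fin H'// (le_trans tx).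
Qed.

(** By Tonelli the two kernels are convolved first, and their convolution is bounded by the kernel
    of order [a + b], less singular than either. *)
Lemma abel_nconv2_lty a b p r q x : 0 < a -> 0 < b -> abel_kernel a p -> abel_kernel b r ->
  loc_integrable q -> 0 < x -> rlk_finite (a + b) q x ->
  (nconv (amod p) (nconv (amod r) (amod q)) x < +oo)%E.
Proof.
move=> a0 b0 kp kr /loc_integrableP[mq _] x0 fq.
have mp := abel_kernel_cmeasurable kp; have mr := abel_kernel_cmeasurable kr.
have mAp := measurable_amod mp; have mAr := measurable_amod mr.
have mAq := measurable_amod mq.
rewrite nconvA//.
have [C C0 H] := abel_kernel_nconv2_le a0 b0 kp kr x0.
apply: le_lt_trans (_ : (C * 1)%:E * nconv (erlk (a + b)) (amod q) x < +oo)%E; last first.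
  by apply: lte_mul_pinfty => //; rewrite mulr1 lee_fin.
have ab0 : 0 < a + b by rewrite addr_gt0.
apply: nconv_le_itv => //.
- exact: measurable_nconv.
- exact: measurable_erlk.
- by move=> t; exact: nconv_ge0.
- exact: erlk_ge0.
- move=> t t0; apply/eqP; rewrite eq_le nconv_ge0// andbT.
  (* The bound by [rlk] vanishes at negative [t], whatever the right end, here 1; so the convolution
     vanishes too. *)
  have [D _ /(_ t)] := abel_kernel_nconv2_le a0 b0 kp kr (@ltr01 R).
  by rewrite rlk_le0 ?mulr0; [apply; exact: ltW (lt_trans t0 ltr01)|exact: ltW].
- exact: amod_lt0.
- by move=> t _; rewrite mul1e.
Qed.

Lemma abel_cconvA a b p r q x : 0 < a -> 0 < b -> abel_kernel a p -> abel_kernel b r ->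
  loc_integrable q -> 0 < x -> rlk_finite (a + b) q x ->
  cconv p (cconv r q) x = cconv (cconv p r) q x.
Proof.
move=> a0 b0 kp kr iq x0 fq; apply: cconvA; last exact: (abel_nconv2_lty a0 b0 kp kr iq x0 fq).
- exact: abel_kernel_cmeasurable kp.
- exact: abel_kernel_cmeasurable kr.
- exact: loc_integrable_causal.
Qed.

Lemma abel_nconv_cconv_lty a b p r q x :
  0 < a -> 0 < b -> abel_kernel a p -> abel_kernel b r -> loc_integrable q -> 0 < x ->
  rlk_finite (a + b) q x -> (nconv (amod p) (amod (cconv r q)) x < +oo)%E.
Proof.
move=> a0 b0 kp kr iq x0 fq; have mq := loc_integrable_causal iq.
have mp := abel_kernel_cmeasurable kp; have mr := abel_kernel_cmeasurable kr.
have mc := cmeasurable_causal (cmeasurable_cconv mr mq).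
have := abel_nconv2_lty a0 b0 kp kr iq x0 fq.
move=> foo; apply: (@le_lt_trans _ _ ((1 * 2)%:E *
  nconv (amod p) (nconv (amod r) (amod q)) x)%E); last first.
  by apply: lte_mul_pinfty => //; rewrite mul1r lee_fin.
apply: nconv_le_itv => //; try exact: amod_ge0; try exact: amod_lt0.
- exact: measurable_amod.
- exact: measurable_amod.
- exact: measurable_amod.
- by apply: measurable_nconv; [exact: measurable_amod|exact: measurable_amod
    |exact: amod_ge0|exact: amod_ge0].
- by move=> t; apply: nconv_ge0; exact: amod_ge0.
- by move=> t _; rewrite mul1e.
by move=> t _; rewrite /amod causal_cconv; exact: cmod_cconv_le.
Qed.

End AbelKernels.

(** * Linearity of convolution and geometrically dominated series of kernels *)

Section AbelKernelSeries.
Context {R : realType}.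
Local Notation mu := (@lebesgue_measure R).
Local Notation erlk a := (EFin \o @rlk R a).
Implicit Types (p q r : R -> R[i]) (a b x y : R) (c : R[i]).

#[local] Hint Resolve amod_ge0 : core.

Lemma cconvZr c p q x : cmeasurable [set: R] (causal p) -> loc_integrable q ->
  (nconv (amod p) (amod q) x < +oo)%E -> cconv p (fun t => c * q t) x = c * cconv p q x.
Proof.
move=> mp /loc_integrable_causal mq pq; rewrite !cconvE.
rewrite -(cintegralZl c measurableT (cconv_integrable mp mq pq)).
apply: eq_cintegral => s _; rewrite mulrCA; congr (_ * _).
by rewrite /causal; case: ifP; rewrite ?mulr0.
Qed.

Lemma cconvZl c p q x : cconv (fun t => c * p t) q x = cconv p (fun t => c * q t) x.
Proof. by apply: eq_cintegral => s _; rewrite mulrCA mulrA. Qed.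

Lemma cconvDr p q r x : cmeasurable [set: R] (causal p) -> loc_integrable q ->
  loc_integrable r -> (nconv (amod p) (amod q) x < +oo)%E ->
  (nconv (amod p) (amod r) x < +oo)%E ->
  cconv p (fun t => q t + r t) x = cconv p q x + cconv p r x.
Proof.
move=> mp /loc_integrable_causal mq /loc_integrable_causal mr pq pr; rewrite !cconvE.
rewrite -(cintegralD measurableT (cconv_integrable mp mq pq) (cconv_integrable mp mr pr)).
apply: eq_cintegral => s _; rewrite -mulrDr; congr (_ * _).
by rewrite /causal; case: ifP; rewrite ?addr0.
Qed.

Lemma cconvDl p q r x : cmeasurable [set: R] (causal p) -> cmeasurable [set: R] (causal q) ->
  loc_integrable r -> (nconv (amod p) (amod r) x < +oo)%E ->
  (nconv (amod q) (amod r) x < +oo)%E ->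
  cconv (fun t => p t + q t) r x = cconv p r x + cconv q r x.
Proof.
move=> mp mq /loc_integrable_causal mr pq pr; rewrite !cconvE.
rewrite -(cintegralD measurableT (cconv_integrable mp mr pq) (cconv_integrable mq mr pr)).
apply: eq_cintegral => s _; rewrite -mulrDl; congr (_ * _).
by rewrite /causal; case: ifP; rewrite ?addr0.
Qed.

Lemma loc_integrableD q r : loc_integrable q -> loc_integrable r ->
  loc_integrable (fun t => q t + r t).
Proof. by move=> iq ir b; exact: cintegrableD. Qed.

Lemma loc_integrableZ c q : loc_integrable q -> loc_integrable (fun t => c * q t).
Proof. by move=> iq b; exact: cintegrableZl. Qed.

Lemma geometric_cmod_sum_le (u : nat -> R[i]) (M : R) : 0 <= M ->
  (forall n, cmod (u n) <= 2^-1 ^+ n * M) -> forall N, \sum_(k < N) cmod (u k) <= 2 * M.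
Proof.
move=> M0 H N; apply: (@le_trans _ _ (\sum_(k < N) 2^-1 ^+ k * M)); first exact: ler_sum.
by rewrite -mulr_suml ler_wpM2r// sum_half_le.
Qed.

(** All partial sums are bounded by [2 * h], so dominated convergence exchanges sum and integral. *)
Lemma cintegral_series (F : nat -> R -> R[i]) (h : R -> R) :
  (forall n, cmeasurable [set: R] (F n)) -> mu.-integrable setT (EFin \o h) ->
  (forall n s, cmod (F n s) <= 2^-1 ^+ n * h s) ->
  (cseries (fun n => cintegral setT (F n)) n : R[i]^o) @[n --> \oo] -->
  (cintegral setT (fun s => csum (F ^~ s)) : R[i]^o).
Proof.
move=> mF ih Fh.
have h0 s : 0 <= h s by have := le_trans (cmod_ge0 _) (Fh 0%N s); rewrite expr0 mul1r.
have cvF s : cvgn (cseries (F ^~ s)).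
  by apply: (cseries_cvg (geometric_cmod_sum_le (h0 s) _)) => n; exact: Fh.
have mh2 : measurable_fun setT h by have /integrableP[/measurable_EFinP] := ih.
have iF n : cintegrable setT (F n).
  apply/cintegrableP => //; split => //.
  apply: le_lt_trans (_ : \int[mu]_s `|(h s)%:E| < +oo)%E; last by have /integrableP[] := ih.
  apply: ge0_le_integral => //.
  - by move=> s _; rewrite lee_fin cmod_ge0.
  - exact: (measurable_EFin_cmod (mF n)).
  - by apply/measurable_EFinP; exact: measurableT_comp.
  move=> s _; rewrite lee_fin ger0_norm//; apply: le_trans (Fh n s) _.
  by rewrite ler_piMl// exprn_ile1 ?invr_ge0// invf_le1 ?ler1n.
pose G n s := cseries (F ^~ s) n.
have GE n : G n = fun s => \sum_(k < n) F k s by apply/funext => s; rewrite /G cseriesE.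
have -> : cseries (fun n => cintegral setT (F n)) = fun n => cintegral setT (G n).
  apply/funext => n; rewrite cseriesE GE.
  by have [_ ->] := @cintegral_sum R setT n (fun i => F i) measurableT (fun i => iF i).
apply: (@cdominated_cvg _ G _ (fun s => 2 * h s)).
- by move=> n; rewrite GE; apply: cmeasurable_sum.
- apply: (@cmeasurable_lim _ G) => [n|s]; first by rewrite GE; apply: cmeasurable_sum.
  exact: cvF.
- by move=> s; exact: cvF.
- rewrite (_ : _ \o _ = fun s => (2%:E * (EFin \o h) s)%E); first exact: integrableZl.
  by apply/funext => s; rewrite /= EFinM.
- move=> n s; rewrite GE; apply: le_trans (ler_cmod_sum _ _ _) _.
  by apply: (geometric_cmod_sum_le (u := F ^~ s) (h0 s)) => k; exact: Fh.
Qed.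

(** Summable domination by one Riemann-Liouville kernel, with [C] independent of [n]. The ratio can
    be fixed at 1/2 because the base [B] in [Gamma_ge] may be taken as large as desired. *)
Definition geometric_kernels a (p : nat -> R -> R[i]) :=
  [/\ forall n, cmeasurable [set: R] (p n), forall n t, t <= 0 -> p n t = 0 &
    forall b, 0 < b -> exists2 C, 0 <= C &
      forall n t, t <= b -> cmod (p n t) <= 2^-1 ^+ n * (C * rlk a t)].

Definition kernel_sum (p : nat -> R -> R[i]) t := csum (p ^~ t).

Lemma geometric_kernels_kernel a (p : nat -> R -> R[i]) n : 0 < a -> geometric_kernels a p -> abel_kernel a (p n).
Proof.
move=> a0 [mp p0 pC]; split => //; first exact: p0.
move=> b /pC[C C0 H]; exists C => // t tb; apply: le_trans (H n t tb) _.
apply: ler_piMl; first by rewrite mulr_ge0// rlk_ge0.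
by rewrite exprn_ile1 ?invr_ge0// invf_le1 ?ler1n.
Qed.

Lemma geometric_kernels_cvg a (p : nat -> R -> R[i]) t : 0 < a -> geometric_kernels a p -> cvgn (cseries (p ^~ t)).
Proof.
move=> a0 [mp p0 pC].
have m0 : 0 < Num.max t 1 by rewrite lt_max ltr01 orbT.
have [C C0 H] := pC _ m0; have Cr : 0 <= C * rlk a t by rewrite mulr_ge0// rlk_ge0.
by apply: (cseries_cvg (geometric_cmod_sum_le Cr _)) => n; apply: H; rewrite le_max lexx.
Qed.

Lemma abel_kernel_sum a (p : nat -> R -> R[i]) : 0 < a -> geometric_kernels a p -> abel_kernel a (kernel_sum p).
Proof.
move=> a0 kp; have [mp p0 pC] := kp; split.
- apply: (@cmeasurable_lim _ (fun n t => \sum_(k < n) p k t)).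
    by move=> n; apply: cmeasurable_sum.
  move=> t; rewrite (_ : (fun _ => _) = cseries (p ^~ t)); last first.
    by apply/funext => n; rewrite cseriesE.
  exact: (geometric_kernels_cvg a0 kp).
- move=> t t0; apply: csum_lim; rewrite (_ : cseries _ = fun=> 0); first exact: cvg_cst.
  by apply/funext => n; rewrite cseriesE big1// => k _; exact: p0.
move=> b /pC[C C0 H]; exists (2 * C); first by rewrite mulr_ge0.
move=> t tb; rewrite -mulrA; apply: cmod_csum_le.
have Cr : 0 <= C * rlk a t by rewrite mulr_ge0// rlk_ge0.
by apply: (geometric_cmod_sum_le (u := p ^~ t) Cr) => k; exact: H.
Qed.

Lemma cconv_dominated_series (F : nat -> R -> R[i]) a q x : 0 < a -> loc_integrable q ->
  rlk_finite a q x -> (forall n, cmeasurable [set: R] (F n)) ->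
  (exists2 C, 0 <= C & forall n s, cmod (F n s) <=
     2^-1 ^+ n * (C * (rlk a (x - s) * cmod (causal q s)))) ->
  (cseries (fun n => cintegral setT (F n)) n : R[i]^o) @[n --> \oo] -->
  (cintegral setT (fun s => csum (F ^~ s)) : R[i]^o).
Proof.
move=> a0 /loc_integrable_causal mq fq mF [C C0 FC].
apply: cintegral_series FC => //.
have mh : measurable_fun [set: R] (fun s : R => rlk a (x - s) * cmod (causal q s)).
  apply: measurable_funM; last exact: measurable_cmod.
  by apply: (measurableT_comp (measurable_rlk a)); exact: measurable_sub_cst.
rewrite (_ : _ \o _ = fun s => (C%:E * (EFin \o (fun s => rlk a (x - s) * cmod (causal q s))%R) s)%E).
  apply: integrableZl => //; apply/integrableP; split; first exact/measurable_EFinP.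
  apply: le_lt_trans fq; rewrite le_eqVlt; apply/orP; left; apply/eqP.
  apply: eq_integral => s _; rewrite /= ger0_norm ?EFinM//.
  by rewrite mulr_ge0 ?rlk_ge0 ?cmod_ge0.
by apply/funext => s; rewrite /= EFinM.
Qed.

Lemma cconv_seriesl a (p : nat -> R -> R[i]) q x : 0 < a -> geometric_kernels a p -> loc_integrable q ->
  0 < x -> rlk_finite a q x ->
  (cseries (fun n => cconv (p n) q x) n : R[i]^o) @[n --> \oo] -->
  (cconv (kernel_sum p) q x : R[i]^o).
Proof.
move=> a0 kp iq x0 fq; have mq := loc_integrable_causal iq.
pose F n s := causal (p n) (x - s) * causal q s.
have kpn n := geometric_kernels_kernel n a0 kp.
have mpn n := abel_kernel_cmeasurable (kpn n).
have cl : cconv (kernel_sum p) q x = cintegral setT (fun s => csum (F ^~ s)).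
  rewrite cconvE; apply: eq_cintegral => s _.
  rewrite (abel_kernel_causal (abel_kernel_sum a0 kp)) mulrC /kernel_sum.
  rewrite -csumZ; last exact: (geometric_kernels_cvg a0 kp).
  by congr csum; apply/funext => n; rewrite /F (abel_kernel_causal (kpn n)) mulrC.
rewrite cl (_ : (fun n => cconv (p n) q x) = fun n => cintegral setT (F n)); last first.
  by apply/funext => n; rewrite cconvE.
apply: (cconv_dominated_series a0 iq fq).
  by move=> n; exact: cmeasurable_cconv_section.
have [_ _ /(_ _ x0)[C C0 H]] := kp; exists C => // n s.
rewrite /F cmodM (abel_kernel_causal (kpn n)); have [s0|s0] := ltP s 0.
  by rewrite (causal_lt0 _ s0) cmod0 !mulr0.
rewrite [leRHS](_ : _ = 2^-1 ^+ n * (C * rlk a (x - s)) * cmod (causal q s)); last by ring.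
by apply: ler_wpM2r; [exact: cmod_ge0|apply: H; rewrite gerBl].
Qed.

(** Both factors are kernels here, so the majorant is a convolution of two Riemann-Liouville
    kernels, finite at every [x]. *)
Lemma cconv_seriesr a b p (q : nat -> R -> R[i]) x : 0 < a -> 0 < b -> abel_kernel a p -> geometric_kernels b q ->
  0 < x ->
  (cseries (fun n => cconv p (q n) x) n : R[i]^o) @[n --> \oo] -->
  (cconv p (kernel_sum q) x : R[i]^o).
Proof.
move=> a0 b0 kp kq x0.
have kqn n := geometric_kernels_kernel n b0 kq.
have mp := abel_kernel_cmeasurable kp.
pose F n s := causal p (x - s) * causal (q n) s.
pose rb t : R[i] := (rlk b t)%:C.
have kr : abel_kernel b rb by exact: abel_kernel_rlk.
have cl : cconv p (kernel_sum q) x = cintegral setT (fun s => csum (F ^~ s)).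
  rewrite cconvE; apply: eq_cintegral => s _.
  rewrite (abel_kernel_causal (abel_kernel_sum b0 kq)) /kernel_sum.
  rewrite -csumZ; last exact: (geometric_kernels_cvg b0 kq).
  by congr csum; apply/funext => n; rewrite /F (abel_kernel_causal (kqn n)).
rewrite cl (_ : (fun n => cconv p (q n) x) = fun n => cintegral setT (F n)); last first.
  by apply/funext => n; rewrite cconvE.
apply: (cconv_dominated_series (x := x) a0 (abel_kernel_loc_integrable b0 kr)).
- rewrite /rlk_finite (_ : amod rb = erlk b); first by rewrite nconv_rlk// ltry.
  by apply/funext => t; exact: amod_rlk.
- by move=> n; apply: cmeasurable_cconv_section => //; exact: abel_kernel_cmeasurable (kqn n).
have [_ _ /(_ _ x0)[C C0 H]] := kp; have [_ _ /(_ _ x0)[D D0 H']] := kq.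
exists (C * D) => [|n s]; first exact: mulr_ge0.
rewrite (abel_kernel_causal kr) cmod_real (ger0_norm (rlk_ge0 _ b0)).
rewrite /F cmodM (abel_kernel_causal kp) (abel_kernel_causal (kqn n)).
have [s0|s0] := ltP s 0.
  have [_ /(_ _ (ltW s0)) -> _] := kqn n.
  by rewrite cmod0 [rlk b s]rlk_le0 ?(ltW s0)// !mulr0.
have [xs|xs] := ltP x s.
  have [_ p0 _] := kp; rewrite p0; last by rewrite subr_le0 ltW.
  by rewrite cmod0 [rlk a _]rlk_le0 ?subr_le0 ?(ltW xs)// !(mul0r, mulr0).
apply: le_trans (ler_pM (cmod_ge0 _) (cmod_ge0 _) (H (x - s) _) (H' n s xs)) _.
  by rewrite gerBl.
by rewrite le_eqVlt; apply/orP; left; apply/eqP; ring.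
Qed.

Lemma kernel_sumS a (p : nat -> R -> R[i]) t : 0 < a -> geometric_kernels a p ->
  kernel_sum p t = p 0%N t + kernel_sum (fun n => p n.+1) t.
Proof.
move=> a0 kp; have cv := geometric_kernels_cvg (t := t) a0 kp.
suff : (cseries (fun n => p n.+1 t) n : R[i]^o) @[n --> \oo] --> (kernel_sum p t - p 0%N t : R[i]^o).
  by move=> /csum_lim; rewrite /kernel_sum => ->; rewrite addrC subrK.
rewrite (_ : cseries _ = fun n => cseries (p ^~ t) n.+1 + - p 0%N t).
  by apply: ccvgD; [rewrite -(cvg_shiftS (cseries (p ^~ t))) in cv; exact: cv|exact: cvg_cst].
by apply/funext => n; rewrite !cseriesE big_ord_recl/= addrAC subrr add0r.
Qed.

End AbelKernelSeries.

(** * Resolvent kernels and the Volterra equation *)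

Section ResolventKernels.
Context {R : realType}.
Local Notation mu := (@lebesgue_measure R).
Variables (rho : R) (omega lambda : R[i]) (sigma c : R).
Hypotheses (rho0 : 0 < rho) (sigma0 : 0 < sigma).
Local Notation kp := (kpos rho omega).
Implicit Types (q : R -> R[i]) (b m g t x : R) (n : nat).

Lemma kpos_le0 m g t : t <= 0 -> kp m g t = 0.
Proof. by move=> t0; rewrite [kp _ _ _]/kpos ltNge t0. Qed.

Local Opaque kpos ker.

Lemma abel_kernel_kpos m g : 0 < m -> abel_kernel m (kp m g).
Proof.
move=> m0; split; first exact: cmeasurable_kpos.
  by move=> t; exact: kpos_le0.
by move=> b b0; exact: kpos_le_rlk.
Qed.

Lemma cconv_kpos m g m' g' x : 0 < m -> 0 < m' -> 0 < x ->
  cconv (kp m g) (kp m' g') x = kp (m + m') (g + g') x.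
Proof.
move=> m0 m'0 x0; rewrite -(ker_kpos rho omega _ _ x0) -cconv_ker//.
by apply/esym/eq_cconv; [move=> t /ker_kpos|apply: aeW => t /ker_kpos].
Qed.

(** The term of index [n] of the Neumann series started at [k(b, g)]: convolving [n] times with
    [lambda k(sigma, c)] adds up the indices. *)
Definition rterm b g n t : R[i] := lambda ^+ n * kp (b + n%:R * sigma) (g + n%:R * c) t.

Lemma rterm_index_gt0 b n : 0 < b -> 0 < b + n%:R * sigma.
Proof. by move=> b0; rewrite ltr_pwDl// mulr_ge0// ltW. Qed.

Lemma powR_index_split a b n : 0 < a -> a `^ (b + n%:R * sigma) = a `^ b * (a `^ sigma) ^+ n.
Proof.
move=> a0; rewrite powRD_gt0// [n%:R * _]mulrC powRrM powR_mulrn ?powR_ge0//.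
Qed.

Lemma geometric_rterm b g : 0 < b -> geometric_kernels b (rterm b g).
Proof.
move=> b0; split.
- move=> n; apply: cmeasurableM; first exact: cmeasurable_cst.
  by apply: cmeasurable_kpos => //; exact: rterm_index_gt0.
- by move=> n t t0; rewrite /rterm kpos_le0// mulr0.
move=> a a0; have [B0 B00 HB] := ker_le omega rho0 a0.
pose N := (Num.truncn `|c|).+1; pose G := (Num.truncn `|g|).+1.
have cN : `|c| <= N%:R by apply/ltW/truncnS_gt.
have gG : `|g| <= G%:R by apply/ltW/truncnS_gt.
(* Twice the cost of one more index: a factor [lambda], a superscript changed by [c], hence [2 ^ N],
   and a power [t ^ sigma <= a ^ sigma]. The gain is [B ^ sigma], so [Q <= B ^ sigma] gives the
   ratio 1/2. *)
pose Q := 2 * (cmod lambda * 2 ^+ N * a `^ sigma).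
have Q0 : 0 <= Q by rewrite !mulr_ge0 ?cmod_ge0 ?exprn_ge0 ?powR_ge0.
pose B := Num.max B0 (Q `^ sigma^-1).
have B_gt0 : 0 < B by rewrite lt_max B00.
have QB : Q <= B `^ sigma.
  have -> : Q = (Q `^ sigma^-1) `^ sigma by rewrite -powRrM mulVf ?gt_eqF// powRr1.
  apply: ge0_ler_powR; rewrite ?nnegrE ?powR_ge0 ?(ltW sigma0) ?(ltW B_gt0)//.
  by rewrite le_max lexx orbT.
have [|C C0 HC] := HB B; first by rewrite le_max lexx.
have BS0 : 0 < B `^ sigma by exact: powR_gt0.
exists (C * 2 ^+ G * B `^ (- b) * Gamma b).
  by rewrite !mulr_ge0 ?exprn_ge0 ?powR_ge0 ?(ltW (Gamma_gt0 b0)).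
move=> n t ta; have [t0|t0] := leP t 0.
  by rewrite /rterm kpos_le0// mulr0 cmod0 rlk_le0// !mulr0.
rewrite /rterm -ker_kpos// cmodM cmodX.
have gn : `|g + n%:R * c| <= (G + n * N)%:R.
  rewrite natrD natrM; apply: le_trans (ler_normD _ _) _; apply: lerD => //.
  by rewrite normrM normr_nat ler_wpM2l.
have ta' : 0 < t <= a by rewrite t0.
have := HC (b + n%:R * sigma) (g + n%:R * c) (G + n * N)%N t (rterm_index_gt0 n b0) gn ta'.
move=> /(ler_wpM2l (exprn_ge0 n (cmod_ge0 lambda))) /le_trans; apply.
have -> : B `^ (- (b + n%:R * sigma)) = B `^ (- b) * ((B `^ sigma) ^+ n)^-1.
  by rewrite !powRN powR_index_split// invfM.
have -> : t `^ (b + n%:R * sigma - 1) = t `^ (b - 1) * (t `^ sigma) ^+ n.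
  by rewrite addrAC powR_index_split.
rewrite /rlk /pw t0 exprD mulnC exprM.
set X := cmod lambda ^+ n * _.
have -> : X = (cmod lambda * 2 ^+ N * (t `^ sigma) / B `^ sigma) ^+ n *
    (C * 2 ^+ G * B `^ (- b) * t `^ (b - 1)).
  by rewrite /X !exprMn exprVn; ring.
have GE : Gamma b * (t `^ (b - 1) / Gamma b) = t `^ (b - 1).
  by rewrite mulrCA mulfV ?mulr1// gt_eqF// Gamma_gt0.
rewrite -(mulrA _ (Gamma b)) GE.
rewrite ler_wpM2r//; first by rewrite !mulr_ge0 ?exprn_ge0 ?powR_ge0.
apply: lerXn2r; rewrite ?nnegrE ?invr_ge0//.
  by rewrite !mulr_ge0 ?cmod_ge0 ?exprn_ge0 ?powR_ge0 ?invr_ge0 ?powR_ge0.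
rewrite ler_pdivrMr// -ler_pdivrMl// invrK; apply: le_trans QB.
rewrite /Q ler_pM2l// ler_wpM2l ?mulr_ge0 ?cmod_ge0 ?exprn_ge0//.
apply: ge0_ler_powR; rewrite ?nnegrE//; exact: ltW.
Qed.

(* For b = sigma and g = c, lambda times this kernel is the resolvent of
   lambda k(sigma,c). *)
Definition resolvent b g := kernel_sum (rterm b g).

Lemma abel_kernel_resolvent b g : 0 < b -> abel_kernel b (resolvent b g).
Proof. by move=> b0; apply: abel_kernel_sum => //; exact: geometric_rterm. Qed.

Lemma resolventE b g t : 0 < b ->
  resolvent b g t = kp b g t + lambda * resolvent (b + sigma) (g + c) t.
Proof.
move=> b0; rewrite /resolvent (kernel_sumS t b0 (geometric_rterm g b0)); congr (_ + _).
  by rewrite /rterm expr0 mul1r !mul0r !addr0.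
have bs0 : 0 < b + sigma by rewrite addr_gt0.
rewrite /kernel_sum -csumZ; last exact: (geometric_kernels_cvg bs0 (geometric_rterm _ bs0)).
congr csum; apply/funext => n.
have E1 : b + n.+1%:R * sigma = b + sigma + n%:R * sigma by rewrite -natr1; ring.
have E2 : g + n.+1%:R * c = g + c + n%:R * c by rewrite -natr1; ring.
by rewrite /rterm E1 E2 exprS mulrA.
Qed.

Lemma rterm_cconv b g n q x : 0 < b -> 0 < x -> loc_integrable q -> rlk_finite b q x ->
  cconv (rterm b g n) q x =
  lambda ^+ n * cconv (kp (b + n%:R * sigma) (g + n%:R * c)) q x.
Proof.
move=> b0 x0 iq fq; have bn0 := rterm_index_gt0 n b0.
have kk := abel_kernel_kpos (g + n%:R * c) bn0.
rewrite /rterm cconvZl cconvZr//; first exact: abel_kernel_cmeasurable kk.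
apply: (abel_kernel_nconv_lty bn0 kk iq x0); apply: rlk_finite_le fq => //.
by rewrite lerDl mulr_ge0// ltW.
Qed.

Lemma resolvent_series b g q x : 0 < b -> 0 < x -> loc_integrable q -> rlk_finite b q x ->
  (cseries (fun n => lambda ^+ n * cconv (kp (b + n%:R * sigma) (g + n%:R * c)) q x) n : R[i]^o)
    @[n --> \oo] --> (cconv (resolvent b g) q x : R[i]^o).
Proof.
move=> b0 x0 iq fq; have := cconv_seriesl b0 (geometric_rterm g b0) iq x0 fq.
rewrite (_ : (fun n => cconv _ _ _) =
  fun n => lambda ^+ n * cconv (kp (b + n%:R * sigma) (g + n%:R * c)) q x)//.
by apply/funext => n; exact: rterm_cconv.
Qed.

Lemma abel_kernel_rlk_finite a b p x : 0 < a -> 0 < b -> 0 < x -> abel_kernel b p ->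
  rlk_finite a p x.
Proof.
move=> a0 b0 x0 kpb.
have := abel_kernel_nconv2_le a0 b0 (abel_kernel_rlk a0 (lexx a)) kpb x0.
move=> [C _ /(_ x (lexx x)) H]; rewrite /rlk_finite.
apply: (@le_lt_trans _ _ (C * rlk (a + b) x)%:E); last exact: ltry.
apply: le_trans H; rewrite le_eqVlt; apply/orP; left; apply/eqP.
by congr nconv; apply/funext => t; rewrite amod_rlk.
Qed.

(** The semigroup law shifts the indices of every term. Together with [kpos_cconv_resolvent], where
    the factors are in the other order, this stands in for commutativity of convolution. *)
Lemma resolvent_cconv_kpos b g m g' x : 0 < b -> 0 < m -> 0 < x ->
  cconv (resolvent b g) (kp m g') x = resolvent (b + m) (g + g') x.
Proof.
move=> b0 m0 x0; have kk := abel_kernel_kpos g' m0.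
have := resolvent_series (g := g) b0 x0 (abel_kernel_loc_integrable m0 kk)
  (abel_kernel_rlk_finite b0 m0 x0 kk).
move=> /csum_lim <-; congr csum; apply/funext => n; rewrite cconv_kpos//; last exact: rterm_index_gt0.
by rewrite /rterm addrAC (addrAC g).
Qed.

Lemma kpos_cconv_resolvent m g' b g x : 0 < m -> 0 < b -> 0 < x ->
  cconv (kp m g') (resolvent b g) x = resolvent (m + b) (g' + g) x.
Proof.
move=> m0 b0 x0; have kk := abel_kernel_kpos g' m0.
have := cconv_seriesr m0 b0 kk (geometric_rterm g b0) x0.
move=> /csum_lim; rewrite -/(resolvent b g) => <-; congr csum; apply/funext => n.
have bn0 := rterm_index_gt0 n b0.
have kn := abel_kernel_kpos (g + n%:R * c) bn0.
rewrite /rterm cconvZr//.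
- by rewrite cconv_kpos// !addrA.
- exact: abel_kernel_cmeasurable kk.
- exact: abel_kernel_loc_integrable kn.
apply: (abel_kernel_nconv_lty m0 kk (abel_kernel_loc_integrable bn0 kn) x0).
exact: abel_kernel_rlk_finite kn.
Qed.

End ResolventKernels.

Lemma rterm_mittag_leffler {R : realType} (rho beta gamma x : R) (omega lambda : R[i])
    (sigma c : R) n : 0 < x ->
  rterm rho omega lambda sigma c beta gamma n x =
  lambda ^+ n * (x `^ (beta + n%:R * sigma - 1))%:C *
  mittag_leffler rho (beta + n%:R * sigma) (gamma + n%:R * c) (omega * (x `^ rho)%:C).
Proof. by move=> x0; rewrite /rterm -ker_kpos// -mulrA. Qed.

(** * The kernel of ordinary integration *)

Section GammaOne.
Context {R : realType}.
Local Notation mu := (@lebesgue_measure R).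

Lemma ae_neq (c : R) : {ae mu, forall x, x <> c}.
Proof.
exists [set c]; split; [exact: measurable_set1|exact: lebesgue_measure_set1|].
by move=> x /= /contrapT.
Qed.

(** Away from 0 the integrand is the exponential density of rate 1, of total mass 1. *)
Lemma Gamma1 : Gamma 1 = 1 :> R.
Proof.
rewrite GammaE /egamma -[RHS]/(fine 1%:E) -(@integral_exponential_pdf R 1 ltr01); congr fine.
apply: ae_eq_integral_nonmeasurable; apply: ae_imp (ae_neq 0) => t /eqP t0 _.
rewrite /exponential_pdf patchE /pw subrr powRr0; congr EFin.
have [tpos|tneg] := ltP 0 t.
  by rewrite mem_set ?mulN1r ?mul1r//= in_itv/= (ltW tpos).
rewrite mul0r memNset//= in_itv/= andbT leNgt lt_def eq_sym t0/= => /negP; exact.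
Qed.

Lemma ker_1_0 (rho : R) (omega : R[i]) (t : R) : ker rho omega 1 0 t = 1.
Proof.
rewrite /ker subrr powRr0 mul1r; apply: csum_lim; apply: cvg_near_cst.
near=> n; have n0 : (0 < n)%N by near: n; exact: nbhs_infty_gt.
rewrite cseriesE -(prednK n0) big_ord_recl/= big1 ?addr0.
  by rewrite /pochhammer big_ord0 mulr0 add0r Gamma1 divr1 expr0 fact0 divr1 mulr1.
by move=> i _; rewrite /bump/= pochhammerSl !mul0r.
Unshelve. all: by end_near. Qed.

End GammaOne.

(** * Injectivity of integration modulo null sets *)

Section AePrimitive.
Context {R : realType}.
Local Notation mu := (@lebesgue_measure R).
Implicit Types (p q r : R -> R[i]) (x : R) (a : R[i]).

Definition aeq q r := {ae mu, forall x, 0 < x -> q x = r x}.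

Lemma aeq_eq q r : (forall x, 0 < x -> q x = r x) -> aeq q r.
Proof. by move=> qr; apply: aeW. Qed.

Lemma aeq_sym q r : aeq q r -> aeq r q.
Proof. by apply: ae_imp => x h x0; rewrite h. Qed.

Lemma aeq_trans p q r : aeq p q -> aeq q r -> aeq p r.
Proof. by move=> h1 h2; apply: ae_imp (ae_and h1 h2) => x [e1 e2] x0; rewrite e1// e2. Qed.

Lemma ae_pos_point (P : R -> Prop) (x d : R) : 0 < d -> {ae mu, forall x, P x} ->
  exists2 y, x < y < x + d & P y.
Proof.
move=> d0 [N [mN N0 PN]]; apply: contrapT => H.
pose I : set R := [set` `]x, x + d[].
have sub : I `<=` N.
  move=> y; rewrite /I/= in_itv/= => yx; apply: PN => /= Py; apply: H; by exists y.
have : (mu I <= 0)%E.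
  rewrite -N0; apply: le_measure => //; rewrite inE//; exact: measurable_itv.
by rewrite /I lebesgue_measure_itv/= lte_fin ltrDl d0 -EFinB addrAC subrr add0r lee_fin leNgt d0.
Qed.

(** The primitive vanishes at points arbitrarily close to [x]; its absolute continuity, used on the
    single interval from [x] to such a point [y], plays the part of continuity. *)
Lemma primitive_ae0 p : loc_integrable p ->
  aeq (fun x => cintegral `[0, x] p) (fun=> 0) ->
  forall x, 0 < x -> cintegral `[0, x] p = 0.
Proof.
move=> ip p0 x x0; apply: cmod_eq0; apply/eqP; rewrite eq_le cmod_ge0 andbT.
apply/ler_addgt0Pr => e e0; rewrite add0r.
have [acp _] := primitive_loc_ac (g := fun x => 0 + cintegral `[0, x] p) ip (fun x _ => erefl).
have x10 : 0 < x + 1 by rewrite addr_gt0.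
have [d d0 H] := acp _ x10 e e0.
(* The bound 1 keeps [y] inside []0, x + 1]], where [d] was chosen. *)
have dm0 : 0 < Num.min d 1 by rewrite lt_min d0 ltr01.
have [y /andP[xy yx] py] := ae_pos_point x dm0 p0.
have y0 := lt_trans x0 xy.
have := H 1%N (fun=> x) (fun=> y); rewrite !big_ord1 !add0r py// sub0r normrN normC_cmod ltcR.
move=> h; apply/ltW/h.
- move=> _; split => //=; rewrite in_itv/= ?x0 ?y0 ?lerDl//=.
  by apply: le_trans (ltW yx) _; rewrite lerD2l ge_min lexx orbT.
- by move=> i j; rewrite !ord1 eqxx.
- by rewrite ltrBlDl; apply: lt_le_trans yx _; rewrite lerD2l ge_min lexx.
Qed.

Lemma primitive_ae_inj p q : loc_integrable p -> loc_integrable q ->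
  aeq (fun x => cintegral `[0, x] p) (fun x => cintegral `[0, x] q) -> aeq p q.
Proof.
move=> ip iq pq; apply: primitive_inj => // x x0.
have iqN : loc_integrable (fun t => (-1) * q t) by exact: loc_integrableZ.
have ipq := loc_integrableD ip iqN.
have E y : cintegral `[0, y] (fun t => p t + (-1) * q t) =
    cintegral `[0, y] p - cintegral `[0, y] q.
  by rewrite cintegralD// cintegralZl// mulN1r.
apply/eqP; rewrite -subr_eq0 -E; apply/eqP; apply: primitive_ae0 => //.
by apply: ae_imp pq => y h y0; rewrite E h// subrr.
Qed.

End AePrimitive.

Lemma nconv_amodZr {R : realType} (c : R[i]) (p q : R -> R[i]) (x : R) :
  cmeasurable [set: R] (causal p) -> loc_integrable q ->
  (nconv (amod p) (amod q) x < +oo)%E ->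
  (nconv (amod p) (amod (fun t => c * q t)%R) x < +oo)%E.
Proof.
move=> mp iq pq; have mq := loc_integrable_causal iq.
have mcq := loc_integrable_causal (loc_integrableZ c iq).
apply: (@le_lt_trans _ _ ((1 * cmod c)%:E * nconv (amod p) (amod q) x)%E); last first.
  by apply: lte_mul_pinfty => //; rewrite mul1r lee_fin cmod_ge0.
apply: nconv_le_itv; rewrite ?cmod_ge0//; try exact: amod_ge0; try exact: amod_lt0.
- exact: measurable_amod.
- exact: measurable_amod.
- exact: measurable_amod.
- exact: measurable_amod.
- by move=> t _; rewrite mul1e.
move=> t _; rewrite /amod /causal; case: ifP => _; first by rewrite cmodM.
by rewrite cmod0 mule0.
Qed.

Lemma ae_cconv_lin {R : realType} (m : R) (z : R[i]) (p q r : R -> R[i]) : 0 < m -> abel_kernel m p ->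
  loc_integrable q -> loc_integrable r ->
  aeq (cconv p (fun x => z * q x + r x)) (fun x => z * cconv p q x + cconv p r x).
Proof.
move=> m0 kk iq ir; have mk := abel_kernel_cmeasurable kk.
have := ae_and (ae_rlk_finite m0 iq) (ae_rlk_finite m0 ir).
apply: ae_imp => x [fq fr] x0.
have nq := abel_kernel_nconv_lty m0 kk iq x0 fq.
have nr := abel_kernel_nconv_lty m0 kk ir x0 fr.
rewrite -(cconvZr z mk iq nq) -cconvDr//; first exact: loc_integrableZ.
exact: nconv_amodZr.
Qed.

(** * The Cauchy problem *)

Section PrabhakarOperator.
Context {R : realType}.
Local Notation mu := (@lebesgue_measure R).
Variables (rho : R) (omega : R[i]).
Hypothesis rho0 : 0 < rho.
Local Notation kp := (kpos rho omega).
Local Notation E m g := (prabhakar g rho m omega).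
Implicit Types (p q r : R -> R[i]) (m g x : R) (a : R[i]).

Lemma prabhakar0 q : E 0 0 q = q.
Proof. by apply/funext => x; rewrite /prabhakar !eqxx. Qed.

Lemma prabhakar_cconv m g q : 0 < m -> E m g q = cconv (kp m g) q.
Proof.
move=> m0; apply/funext => x; rewrite /prabhakar (gt_eqF m0)/=.
rewrite -[LHS]/(cconv (ker rho omega m g) q x).
by apply: eq_cconv => [t /ker_kpos//|]; exact: aeW.
Qed.

Local Opaque prabhakar kpos ker.

(* The indices for which the operator is not degenerate: prabhakar is the
   identity at (0, 0), and meaningless at (0, g) otherwise. *)
Definition prabhakar_index m g := 0 < m \/ (m = 0 /\ g = 0).

Lemma prabhakar_aeq m g q r : prabhakar_index m g -> aeq q r -> aeq (E m g q) (E m g r).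
Proof.
move=> [m0|[-> ->]] qr; last by rewrite !prabhakar0.
by rewrite !prabhakar_cconv//; apply: aeq_eq => x _; exact: eq_cconv.
Qed.

Lemma loc_integrable_prabhakar m g q : prabhakar_index m g -> loc_integrable q ->
  loc_integrable (E m g q).
Proof.
move=> [m0|[-> ->]] iq; last by rewrite prabhakar0.
rewrite prabhakar_cconv//; apply: loc_integrable_cconv => //.
exact: abel_kernel_loc_integrable (abel_kernel_kpos omega rho0 g m0).
Qed.

Lemma prabhakar_comp_pos m g m' g' q x : 0 < m -> 0 < m' -> loc_integrable q -> 0 < x ->
  rlk_finite (m + m') q x -> E m g (E m' g' q) x = E (m + m') (g + g') q x.
Proof.
move=> m0 m'0 iq x0 fq; rewrite !prabhakar_cconv ?addr_gt0//.
rewrite (abel_cconvA m0 m'0 (abel_kernel_kpos omega rho0 g m0)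
  (abel_kernel_kpos omega rho0 g' m'0) iq x0 fq).
by apply: eq_cconv; [move=> t t0; exact: cconv_kpos|exact: aeW].
Qed.

(** [M] and [G] are separate variables so that compositions are stated with simplified indices,
    their arithmetic becoming side goals. *)
Lemma prabhakar_comp m g m' g' M G q : prabhakar_index m g -> prabhakar_index m' g' ->
  loc_integrable q -> m + m' = M -> g + g' = G ->
  aeq (E m g (E m' g' q)) (E M G q).
Proof.
move=> [m0|[-> ->]]; last by move=> _ _ <- <-; rewrite prabhakar0 !add0r; exact: aeq_eq.
move=> [m'0|[-> ->]]; last by move=> _ <- <-; rewrite prabhakar0 !addr0; exact: aeq_eq.
move=> iq <- <-; have mm0 : 0 < m + m' by rewrite addr_gt0.
apply: ae_imp (ae_rlk_finite mm0 iq) => x fq x0; exact: prabhakar_comp_pos.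
Qed.

Lemma prabhakar_lin m g a q r : prabhakar_index m g -> loc_integrable q -> loc_integrable r ->
  aeq (E m g (fun x => a * q x + r x)) (fun x => a * E m g q x + E m g r x).
Proof.
move=> [m0|[-> ->]] iq ir; last by rewrite !prabhakar0; exact: aeq_eq.
rewrite !prabhakar_cconv//.
exact: ae_cconv_lin m0 (abel_kernel_kpos omega rho0 g m0) iq ir.
Qed.

(** This places ordinary integration among the Prabhakar operators, under the same composition
    law. *)
Lemma prabhakar_1_0 q x : E 1 0 q x = cintegral `[0, x] q.
Proof.
rewrite prabhakar_cconv// (@eq_cconv _ _ (fun=> 1) _ q); last exact: aeW.
  by apply: eq_cintegral => s _; rewrite mul1r.
by move=> t t0; rewrite -ker_kpos// ker_1_0.
Qed.

Lemma prabhakar_1_0_inj p q : loc_integrable p -> loc_integrable q ->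
  aeq (E 1 0 p) (E 1 0 q) -> aeq p q.
Proof.
move=> ip iq pq; apply: primitive_ae_inj => //.
by apply: ae_imp pq => x h x0; rewrite -!prabhakar_1_0 h.
Qed.

Lemma prabhakar_kpos m g m' g' x : prabhakar_index m g -> 0 < m' -> 0 < x ->
  E m g (kp m' g') x = kp (m + m') (g + g') x.
Proof.
move=> [m0|[-> ->]] m'0 x0; last by rewrite prabhakar0 !add0r.
by rewrite prabhakar_cconv// cconv_kpos.
Qed.

End PrabhakarOperator.

Local Opaque Gamma kpos ker prabhakar.

(** * The Volterra equation: its only solution *)

Section VolterraEquation.
Context {R : realType}.
Local Notation mu := (@lebesgue_measure R).
Variables (rho : R) (omega lambda : R[i]) (sigma c : R).
Hypotheses (rho0 : 0 < rho) (sigma0 : 0 < sigma).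
Local Notation kp := (kpos rho omega).
Local Notation E m g := (prabhakar g rho m omega).
Local Notation S := (resolvent rho omega lambda sigma c).
Variables (K : R[i]) (b g0 a g1 : R) (f : R -> R[i]).
Hypotheses (b0 : 0 < b) (a0 : 0 < a) (locf : loc_integrable f).
Implicit Types (y q : R -> R[i]) (m g x : R).

Definition volterra_rhs x : R[i] := K * kp b g0 x + E a g1 f x.

Definition volterra_sol x : R[i] := K * S b g0 x + cconv (S a g1) f x.

Let kS m g (m0 : 0 < m) : abel_kernel m (S m g) :=
  abel_kernel_resolvent omega lambda c rho0 sigma0 g m0.

Let iS m g (m0 : 0 < m) : loc_integrable (S m g) := abel_kernel_loc_integrable m0 (kS g m0).

Let ik m g (m0 : 0 < m) : loc_integrable (kp m g) :=
  abel_kernel_loc_integrable m0 (abel_kernel_kpos omega rho0 g m0).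

Lemma loc_integrable_volterra_rhs : loc_integrable volterra_rhs.
Proof.
apply: loc_integrableD; first by apply: loc_integrableZ; exact: ik.
by apply: loc_integrable_prabhakar => //; left.
Qed.

Lemma loc_integrable_volterra_sol : loc_integrable volterra_sol.
Proof.
apply: loc_integrableD; first by apply: loc_integrableZ; exact: iS.
by apply: loc_integrable_cconv => //; exact: iS.
Qed.

Lemma resolvent_cconvE m g q x : 0 < m -> loc_integrable q -> 0 < x -> rlk_finite m q x ->
  cconv (S m g) q x = lambda * cconv (S (m + sigma) (g + c)) q x + E m g q x.
Proof.
move=> m0 iq x0 fq; have ms0 : 0 < m + sigma by rewrite addr_gt0.
have fs : rlk_finite (m + sigma) q x.
  by apply: rlk_finite_le fq => //; rewrite lerDl ltW.
have k1 := abel_kernel_kpos omega rho0 g m0; have k2 := kS (g + c) ms0.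
have k3 := abel_kernelZ lambda k2.
have n2 := abel_kernel_nconv_lty ms0 k2 iq x0 fs.
rewrite prabhakar_cconv// -(cconvZr lambda (abel_kernel_cmeasurable k2) iq n2) -cconvZl.
rewrite addrC -cconvDl//.
- by apply: eq_cconv; [move=> t t0; exact: resolventE|exact: aeW].
- exact: abel_kernel_cmeasurable k1.
- exact: abel_kernel_cmeasurable k3.
- exact: abel_kernel_nconv_lty fq.
- exact: abel_kernel_nconv_lty fs.
Qed.

Lemma ae_resolvent_cconv m g q : 0 < m -> loc_integrable q ->
  aeq (cconv (S m g) q) (fun x => lambda * cconv (S (m + sigma) (g + c)) q x + E m g q x).
Proof.
by move=> m0 iq; apply: ae_imp (ae_rlk_finite m0 iq) => x fq x0; exact: resolvent_cconvE.
Qed.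

(** Convolve the equation with [T]. The resolvent equation gives a second expression of [cconv T y],
    and the two share the term in [S (sigma + sigma) (c + c)]. Cancelling it leaves [E sigma c y]
    equal to [cconv T volterra_rhs], and the equation then returns [y]; no iteration on [y] is
    involved. *)
Lemma volterra_unique y : loc_integrable y ->
  aeq y (fun x => lambda * E sigma c y x + volterra_rhs x) -> aeq y volterra_sol.
Proof.
move=> iy yV; have ih := loc_integrable_volterra_rhs.
pose T := S sigma c; have kT : abel_kernel sigma T := kS c sigma0.
have iE : loc_integrable (E sigma c y) by apply: loc_integrable_prabhakar => //; left.
have ss0 : 0 < sigma + sigma by rewrite addr_gt0.
have key : aeq (E sigma c y) (cconv T volterra_rhs).
  have h1 : aeq (cconv T y) (fun x => lambda * cconv (S (sigma + sigma) (c + c)) y x + E sigma c y x).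
    exact: ae_resolvent_cconv.
  have h2 : aeq (cconv T y) (cconv T (fun x => lambda * E sigma c y x + volterra_rhs x)).
    by apply: aeq_eq => x _; exact: eq_cconv.
  have h3 := ae_cconv_lin lambda sigma0 kT iE ih.
  have h4 : aeq (cconv T (E sigma c y)) (cconv (S (sigma + sigma) (c + c)) y).
    apply: ae_imp (ae_rlk_finite ss0 iy) => x fy x0; rewrite prabhakar_cconv//.
    rewrite (abel_cconvA sigma0 sigma0 kT (abel_kernel_kpos omega rho0 c sigma0) iy x0 fy).
    by apply: eq_cconv; [move=> t t0; exact: resolvent_cconv_kpos|exact: aeW].
  have := ae_and (ae_and h1 h2) (ae_and h3 h4); apply: ae_imp => x [[e1 e2] [e3 e4]] x0.
  have := e1 x0; rewrite e2// e3// e4//; by move/addrI => ->.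
have T1 : aeq (cconv T volterra_rhs)
    (fun x => K * S (sigma + b) (c + g0) x + cconv (S (sigma + a) (c + g1)) f x).
  have iEf : loc_integrable (E a g1 f) by apply: loc_integrable_prabhakar => //; left.
  have h1 := ae_cconv_lin K sigma0 kT (ik g0 b0) iEf.
  have sa0 : 0 < sigma + a by rewrite addr_gt0.
  have := ae_and h1 (ae_rlk_finite sa0 locf); apply: ae_imp => x [e1 fx] x0.
  rewrite e1// /T resolvent_cconv_kpos//; congr (_ + _); rewrite prabhakar_cconv//.
  rewrite (abel_cconvA sigma0 a0 kT (abel_kernel_kpos omega rho0 g1 a0) locf x0 fx).
  by apply: eq_cconv; [move=> t t0; exact: resolvent_cconv_kpos|exact: aeW].
have h5 := ae_resolvent_cconv g1 a0 locf.
have := ae_and (ae_and yV key) (ae_and T1 h5); apply: ae_imp => x [[e1 e2] [e3 e4]] x0.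
rewrite e1// e2// e3// /volterra_sol e4// /volterra_rhs (resolventE omega lambda c rho0 sigma0 g0 x b0).
by rewrite (addrC b) (addrC g0) (addrC a) (addrC g1); ring.
Qed.

(** Convolution with [k(sigma, c)] shifts both resolvents by one index, and [resolventE] adds the
    first term back. *)
Lemma volterra_solE : aeq volterra_sol
  (fun x => lambda * E sigma c volterra_sol x + volterra_rhs x).
Proof.
have h1 := prabhakar_lin omega rho0 (K) (or_introl sigma0 : prabhakar_index sigma c) (iS g0 b0)
  (loc_integrable_cconv (iS g1 a0) locf).
have sa0 : 0 < sigma + a by rewrite addr_gt0.
have h2 := ae_rlk_finite sa0 locf.
have h3 := ae_resolvent_cconv g1 a0 locf.
have := ae_and (ae_and h1 h2) h3; apply: ae_imp => x [[e1 fx] e3] x0.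
rewrite e1// !prabhakar_cconv// kpos_cconv_resolvent//.
rewrite (abel_cconvA sigma0 a0 (abel_kernel_kpos omega rho0 c sigma0) (kS g1 a0) locf x0 fx).
rewrite (@eq_cconv _ _ (S (sigma + a) (c + g1)) f f x); last exact: aeW; last first.
  by move=> t t0; exact: kpos_cconv_resolvent.
rewrite /volterra_sol e3// /volterra_rhs (resolventE omega lambda c rho0 sigma0 g0 x b0).
by rewrite (addrC b) (addrC g0) (addrC a) (addrC g1); ring.
Qed.

End VolterraEquation.

(** * Equivalence of the Cauchy problem and the Volterra equation *)

Section CauchyProblem.
Context {R : realType}.
Local Notation mu := (@lebesgue_measure R).
Variables (rho al nu gamma delta : R) (omega lambda K : R[i]) (f : R -> R[i]).
Hypotheses (rho0 : 0 < rho) (al0 : 0 < al) (al1 : al < 1) (nu0 : 0 <= nu) (nu1 : nu <= 1).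
Hypothesis locf : loc_integrable f.
Implicit Types (y q w : R -> R[i]) (m g x : R).

Local Notation kp := (kpos rho omega).
Local Notation E m g := (prabhakar g rho m omega).
Local Notation m1 := ((1 - nu) * (1 - al)).
Local Notation g1 := (- gamma * (1 - nu)).
Local Notation m2 := (nu * (1 - al)).
Local Notation g2 := (- gamma * nu).
Local Notation b := (m2 + al).
Local Notation g0 := (gamma - gamma * nu).
Local Notation sigma := (2 * al).
Local Notation c := (delta + gamma).
Local Notation S := (resolvent rho omega lambda sigma c).
Local Notation h := (volterra_rhs rho omega K b g0 al gamma f).
Local Notation y0 := (volterra_sol rho omega lambda sigma c K b g0 al gamma f).

Lemma inner_index : prabhakar_index m1 g1.
Proof.
move: nu1; rewrite le_eqVlt => /predU1P[->|nu1'].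
  by right; rewrite subrr mul0r mulr0.
by left; rewrite mulr_gt0// subr_gt0.
Qed.

Lemma outer_index : prabhakar_index m2 g2.
Proof.
move: nu0; rewrite le_eqVlt => /predU1P[<-|nu0'].
  by right; rewrite mul0r mulr0.
by left; rewrite mulr_gt0// subr_gt0.
Qed.

Let m2_ge0 : 0 <= m2. Proof. by rewrite mulr_ge0// subr_ge0 ltW. Qed.
Let m1_ge0 : 0 <= m1. Proof. by rewrite mulr_ge0// subr_ge0// ltW. Qed.
Let b_gt0 : 0 < b. Proof. by rewrite ltr_wpDl. Qed.
Let sigma_gt0 : 0 < sigma. Proof. by rewrite mulr_gt0. Qed.
Let n2_gt0 : 0 < 1 - m2.
Proof. by rewrite (_ : 1 - m2 = m1 + al); [rewrite ltr_wpDl|ring]. Qed.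

Let ok_al g : prabhakar_index al g. Proof. by left. Qed.
Let ok_b g : prabhakar_index b g. Proof. by left. Qed.
Let ok_sigma g : prabhakar_index sigma g. Proof. by left. Qed.
Let ok_n2 g : prabhakar_index (1 - m2) g. Proof. by left. Qed.
Let ok_one g : prabhakar_index 1 g. Proof. by left. Qed.
Let iP m g q (k : prabhakar_index m g) : loc_integrable q -> loc_integrable (E m g q) :=
  loc_integrable_prabhakar omega rho0 k.
Let ikp m g (m0 : 0 < m) : loc_integrable (kp m g) :=
  abel_kernel_loc_integrable m0 (abel_kernel_kpos omega rho0 g m0).

Lemma kpos_1_0 x : 0 < x -> kp 1 0 x = 1.
Proof. by move=> x0; rewrite -ker_kpos// ker_1_0. Qed.

(** The indices [b], [g0] are complementary to [m1], [g1]: they add up to [(1, 0)], whose kernel is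
    the constant 1. This is why the initial value enters with the kernel [kp b g0]. *)
Lemma inner_rhs : aeq (E m1 g1 h) (fun x => K + E (m1 + al) (g1 + gamma) f x).
Proof.
have l := prabhakar_lin omega rho0 K inner_index (ikp g0 b_gt0) (iP (ok_al gamma) locf).
have p := prabhakar_comp omega rho0 inner_index (ok_al gamma) locf erefl erefl.
apply: ae_imp (ae_and l p) => x [e1 e2] x0; rewrite e1// e2//.
rewrite (prabhakar_kpos omega rho0 g0 inner_index b_gt0 x0).
have -> : m1 + b = 1 by ring.
have -> : g1 + g0 = 0 by ring.
by rewrite kpos_1_0// mulr1.
Qed.

(** The two operators of the derivative have total order [1 - al] and total superscript [- gamma].
    Hence the outer operator sends the inner identity for [E 1 0 w] to the integral of the
    right-hand side; commuting it with [E 1 0] and cancelling the integration yields the equation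
    without differentiating anything. *)
Lemma solution_equation y w : loc_integrable y -> loc_integrable w ->
  (forall x, 0 < x -> E m1 g1 y x = K + cintegral `[0, x] w) -> aeq y y0 ->
  aeq (E m2 g2 w) (fun x => lambda * E al delta y x + f x).
Proof.
move=> iy iw yw yy0.
have iEy := iP (ok_al delta) iy; have iEs := iP (ok_sigma c) iy.
have ir : loc_integrable (fun x => lambda * E al delta y x + f x).
  by apply: loc_integrableD => //; exact: loc_integrableZ.
have yV : aeq y (fun x => lambda * E sigma c y x + h x).
  have v := volterra_solE omega lambda c rho0 sigma_gt0 K g0 gamma b_gt0 al0 locf.
  have p := prabhakar_aeq rho omega (ok_sigma c) yy0.
  by apply: ae_imp (ae_and (ae_and yy0 v) p) => x [[e1 e2] e3] x0; rewrite e1// e2// e3.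
have h0 := loc_integrable_volterra_rhs omega rho0 K g0 gamma b_gt0 al0 locf.
have inner : aeq (E 1 0 w)
    (fun x => lambda * E (m1 + sigma) (g1 + c) y x + E (m1 + al) (g1 + gamma) f x).
  have p1 := prabhakar_aeq rho omega inner_index yV.
  have p2 := prabhakar_lin omega rho0 lambda inner_index iEs h0.
  have p3 := prabhakar_comp omega rho0 inner_index (ok_sigma c) iy erefl erefl.
  have := ae_and (ae_and p1 p2) (ae_and p3 inner_rhs).
  apply: ae_imp => x [[e1 e2] [e3 e4]] x0.
  rewrite prabhakar_1_0//; apply: (addrI K); rewrite -yw// e1// e2// e3// e4//.
  by rewrite addrCA.
apply: (prabhakar_1_0_inj (rho := rho) (omega := omega) (iP outer_index iw) ir).
have ok1 : prabhakar_index (m1 + sigma) (g1 + c) by left; rewrite ltr_wpDl.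
have ok2 : prabhakar_index (m1 + al) (g1 + gamma) by left; rewrite ltr_wpDl.
have q1 := prabhakar_comp (M := 1 + m2) (G := g2) omega rho0 (ok_one 0) outer_index iw erefl (add0r _).
have q2 := prabhakar_comp (M := 1 + m2) (G := g2) omega rho0 outer_index (ok_one 0) iw (addrC _ _) (addr0 _).
have q3 := prabhakar_aeq rho omega outer_index inner.
have q4 := prabhakar_lin omega rho0 lambda outer_index (iP ok1 iy) (iP ok2 locf).
have q5 : aeq (E m2 g2 (E (m1 + sigma) (g1 + c) y)) (E (1 + al) delta y).
  by apply: prabhakar_comp => //; [exact: outer_index|ring|ring].
have q6 : aeq (E m2 g2 (E (m1 + al) (g1 + gamma) f)) (E 1 0 f).
  by apply: prabhakar_comp => //; [exact: outer_index|ring|ring].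
have q7 := prabhakar_lin omega rho0 lambda (ok_one 0) iEy locf.
have q8 : aeq (E 1 0 (E al delta y)) (E (1 + al) delta y).
  by apply: prabhakar_comp => //; rewrite add0r.
have := ae_and (ae_and (ae_and q1 q2) (ae_and q3 q4)) (ae_and (ae_and q5 q6) (ae_and q7 q8)).
apply: ae_imp => x [[[e1 e2] [e3 e4]] [[e5 e6] [e7 e8]]] x0.
by rewrite e1// -e2// e3// e4// e5// e6// e7// e8.
Qed.

(** [E (1 - m2) (- g2)] completes the outer operator to ordinary integration, which returns
    [E m1 g1 y] up to the constant [K]; then [E b g0] completes the inner one. Both sides of the
    Volterra equation are thus compared after one integration. *)
Lemma equation_solution y w : loc_integrable y -> loc_integrable w ->
  (forall x, 0 < x -> E m1 g1 y x = K + cintegral `[0, x] w) ->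
  aeq (E m2 g2 w) (fun x => lambda * E al delta y x + f x) -> aeq y y0.
Proof.
move=> iy iw yw eqn.
have iEy := iP (ok_al delta) iy; have iEs := iP (ok_sigma c) iy.
have h0 := loc_integrable_volterra_rhs omega rho0 K g0 gamma b_gt0 al0 locf.
have iEf := iP (ok_al gamma) locf.
apply: volterra_unique => //.
have iV : loc_integrable (fun x => lambda * E sigma c y x + h x).
  by apply: loc_integrableD => //; exact: loc_integrableZ.
apply: (prabhakar_1_0_inj (rho := rho) (omega := omega) iy iV).
have ok1 : prabhakar_index (1 - m2 + al) (- g2 + delta) by left; rewrite addr_gt0.
have p1 := prabhakar_aeq rho omega (ok_n2 (- g2)) eqn.
have p2 : aeq (E (1 - m2) (- g2) (E m2 g2 w)) (E 1 0 w).
  by apply: prabhakar_comp => //; [exact: outer_index|ring|ring].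
have p3 := prabhakar_lin omega rho0 lambda (ok_n2 (- g2)) iEy locf.
have p4 := prabhakar_comp omega rho0 (ok_n2 (- g2)) (ok_al delta) iy erefl erefl.
have iG := iP (ok_n2 (- g2)) locf.
(* The constant is written as a multiple of [kp 1 0], so that [E b g0] acts on it by the semigroup
   law. *)
have inner : aeq (E m1 g1 y) (fun x => K * kp 1 0 x +
    (lambda * E (1 - m2 + al) (- g2 + delta) y x + E (1 - m2) (- g2) f x)).
  have := ae_and (ae_and p1 p2) (ae_and p3 p4).
  apply: ae_imp => x [[e1 e2] [e3 e4]] x0.
  by rewrite yw// kpos_1_0// mulr1 -(prabhakar_1_0 rho omega) -e2// e1// e3// e4.
have iA : loc_integrable (fun x => lambda * E (1 - m2 + al) (- g2 + delta) y x +
    E (1 - m2) (- g2) f x).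
  by apply: loc_integrableD => //; apply: loc_integrableZ; exact: iP.
have q1 : aeq (E b g0 (E m1 g1 y)) (E 1 0 y).
  by apply: prabhakar_comp => //; [exact: inner_index|ring|ring].
have q2 := prabhakar_aeq rho omega (ok_b g0) inner.
have q3 := prabhakar_lin omega rho0 K (ok_b g0) (ikp 0 ltr01) iA.
have q4 := prabhakar_lin omega rho0 lambda (ok_b g0) (iP ok1 iy) iG.
have q5 : aeq (E b g0 (E (1 - m2 + al) (- g2 + delta) y)) (E (1 + sigma) c y).
  by apply: prabhakar_comp => //; ring.
have q6 : aeq (E b g0 (E (1 - m2) (- g2) f)) (E (1 + al) gamma f).
  by apply: prabhakar_comp => //; ring.
have r1 := prabhakar_lin omega rho0 lambda (ok_one 0) iEs h0.
have r2 := prabhakar_lin omega rho0 K (ok_one 0) (ikp g0 b_gt0) iEf.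
have r3 : aeq (E 1 0 (E sigma c y)) (E (1 + sigma) c y).
  by apply: prabhakar_comp => //; rewrite add0r.
have r4 : aeq (E 1 0 (E al gamma f)) (E (1 + al) gamma f).
  by apply: prabhakar_comp => //; rewrite add0r.
have := ae_and (ae_and (ae_and q1 q2) (ae_and q3 q4)) (ae_and (ae_and q5 q6)
  (ae_and (ae_and r1 r2) (ae_and r3 r4))).
apply: ae_imp => x [[[e1 e2] [e3 e4]] [[e5 e6] [[d1 d2] [d3 d4]]]] x0.
have L : E 1 0 y x = K * E b g0 (kp 1 0) x + (lambda * E (1 + sigma) c y x + E (1 + al) gamma f x).
  rewrite -(e1 x0) (e2 x0) (e3 x0) (e4 x0).
  by rewrite (e5 x0) (e6 x0).
rewrite L (d1 x0) (d2 x0) (d3 x0) (d4 x0).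
rewrite (prabhakar_kpos omega rho0 0 (ok_b g0) ltr01 x0).
rewrite (prabhakar_kpos omega rho0 g0 (ok_one 0) b_gt0 x0).
by rewrite (addrC b) (addrC g0) addrCA.
Qed.

End CauchyProblem.

(** * The source series: convergence at every positive point *)

Section SolutionSeries.
Context {R : realType}.
Local Notation mu := (@lebesgue_measure R).
Variables (rho : R) (omega lambda : R[i]) (sigma c : R).
Hypotheses (rho0 : 0 < rho) (sigma0 : 0 < sigma).
Local Notation kp := (kpos rho omega).
Local Notation S := (resolvent rho omega lambda sigma c).
Implicit Types (q : R -> R[i]) (b g x : R).

Lemma cseries_shift_cvg (u : nat -> R[i]) N :
  cvgn (cseries (fun n => u (n + N)%N)) -> cvgn (cseries u).
Proof.
move=> /cvg_ex[/= l ul]; apply/cvg_ex; exists (cseries u N + l : R[i]).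
rewrite -(cvg_shiftn N) (_ : (fun n => _) = fun n => (cseries u N : R[i]) + cseries (fun n => u (n + N)%N) n).
  by apply: ccvgD; [exact: cvg_cst|exact: ul].
apply/funext => n; rewrite !cseriesE addnC big_split_ord/=; congr (_ + _).
by apply: eq_bigr => i _; rewrite addnC.
Qed.

Definition sterm b g q x n : R[i] :=
  lambda ^+ n * cconv (kp (b + n%:R * sigma) (g + n%:R * c)) q x.

(** From the index [N] on, the orders are at least 1 and [rlk_finite_ge1] applies at every [x]. The
    finitely many earlier terms, whose integrals may diverge at [x], do not affect convergence. *)
Lemma sterm_cvg b g q x : 0 < b -> loc_integrable q -> 0 < x -> cvgn (cseries (sterm b g q x)).
Proof.
move=> b0 iq x0; pose N := (Num.truncn (sigma^-1)).+1.
have bN1 : 1 <= b + N%:R * sigma.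
  apply: ler_wpDl; first exact: ltW.
  by rewrite -ler_pdivrMr// div1r ltW// truncnS_gt.
have bN0 : 0 < b + N%:R * sigma by exact: lt_le_trans bN1.
apply: (@cseries_shift_cvg _ N).
have := resolvent_series (omega := omega) (lambda := lambda) (c := c) (g := g + N%:R * c) rho0 sigma0 bN0 x0 iq (rlk_finite_ge1 bN1 iq x0).
move=> /(ccvgZ (c := lambda ^+ N) _) h; apply/cvg_ex; eexists.
rewrite (_ : cseries _ = fun n => lambda ^+ N * cseries (fun n => lambda ^+ n *
  cconv (kp (b + N%:R * sigma + n%:R * sigma) (g + N%:R * c + n%:R * c)) q x) n); first exact: h.
apply/funext => n; rewrite [LHS]cseriesE.
rewrite [X in _ * X]cseriesE.
rewrite mulr_sumr.
apply: eq_bigr => i _.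
rewrite /sterm exprD natrD !mulrDl -!addrA (addrC (i%:R * sigma)) (addrC (i%:R * c)).
by rewrite mulrA (mulrC (lambda ^+ i)).
Qed.

Lemma stermE b g q x : 0 < b -> loc_integrable q -> 0 < x -> rlk_finite b q x ->
  csum (sterm b g q x) = cconv (S b g) q x.
Proof. by move=> b0 iq x0 fq; apply: csum_lim; exact: resolvent_series. Qed.

Lemma sterm_le0 b g q x n : 0 < b -> x <= 0 -> sterm b g q x n = 0.
Proof.
move=> b0 x0; rewrite /sterm -[RHS](mulr0 (lambda ^+ n)); congr (_ * _).
rewrite -(cintegral0 `[0, x]); apply: eq_cintegral => s; rewrite /= in_itv/= => /andP[s0 _].
by rewrite kpos_le0 ?mul0r// subr_le0 (le_trans x0).
Qed.

(** The partial sums converge at every real [x], the terms being 0 for [x <= 0], so the sum is a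
    pointwise limit of measurable functions. *)
Lemma cmeasurable_sterm_sum b g q : 0 < b -> loc_integrable q ->
  cmeasurable [set: R] (fun x => csum (sterm b g q x)).
Proof.
move=> b0 iq; apply: (@cmeasurable_lim _ (fun n x => \sum_(k < n) sterm b g q x k)).
  move=> n; apply: cmeasurable_sum => k; apply: cmeasurableM; first exact: cmeasurable_cst.
  apply: cmeasurable_cconv; last exact: loc_integrable_causal.
  by apply: abel_kernel_cmeasurable; apply: abel_kernel_kpos => //; exact: rterm_index_gt0.
move=> x; rewrite (_ : (fun n => _) = cseries (sterm b g q x)); last first.
  by apply/funext => n; rewrite cseriesE.
have [x0|x0] := leP x 0; last exact: sterm_cvg.
have E : cseries (sterm b g q x) = fun=> 0.
  by apply/funext => n; rewrite cseriesE big1// => k _; exact: sterm_le0.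
have -> : csum (sterm b g q x) = 0 by apply: csum_lim; rewrite E; exact: cvg_cst.
by rewrite E; exact: cvg_cst.
Qed.

End SolutionSeries.

Lemma loc_integrable_eq_pos {R : realType} (q r : R -> R[i]) : (forall x, 0 < x -> q x = r x) ->
  loc_integrable q -> loc_integrable r.
Proof.
move=> qr iq b.
have H (p : R[i] -> R) : (@lebesgue_measure R).-integrable `[0, b] (fun x => (p (q x))%:E) ->
    (@lebesgue_measure R).-integrable `[0, b] (fun x => (p (r x))%:E).
  move=> h.
  have : (@lebesgue_measure R).-integrable `]0, b] (fun x => (p (r x))%:E).
    apply: eq_integrable (integrableS _ _ _ h) => //.
    - by move=> x; rewrite inE/= in_itv/= => /andP[x0 _]; rewrite qr.
    - by apply: subset_itvr; rewrite bnd_simp.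
  move=> /integrableP[mr roo]; apply/integrableP; split.
    exact/emeasurable_fun_itv_obnd_cbndP.
  by rewrite -integral_itv_obnd_cbnd//; exact: measurableT_comp.
by split; apply: H; case: (iq b).
Qed.

(** * The announced function belongs to the domain *)

Section ExistenceOfSolution.
Context {R : realType}.
Local Notation mu := (@lebesgue_measure R).
Variables (rho al nu gamma delta : R) (omega lambda K : R[i]) (f : R -> R[i]).
Hypotheses (rho0 : 0 < rho) (al0 : 0 < al) (al1 : al < 1) (nu0 : 0 <= nu) (nu1 : nu <= 1).
Hypothesis locf : loc_integrable f.
Implicit Types (y q w : R -> R[i]) (m g x : R).

Local Notation kp := (kpos rho omega).
Local Notation E m g := (prabhakar g rho m omega).
Local Notation m1 := ((1 - nu) * (1 - al)).
Local Notation g1 := (- gamma * (1 - nu)).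
Local Notation m2 := (nu * (1 - al)).
Local Notation g2 := (- gamma * nu).
Local Notation b := (m2 + al).
Local Notation g0 := (gamma - gamma * nu).
Local Notation sigma := (2 * al).
Local Notation c := (delta + gamma).
Local Notation S := (resolvent rho omega lambda sigma c).

(** [volterra_sol] convolves [f] with the summed kernel; this function sums the convolutions, as
    announced. They agree where [rlk_finite al f x] holds, hence almost everywhere. *)
Definition series_solution x : R[i] :=
  K * S b g0 x + csum (sterm rho omega lambda sigma c al gamma f x).
Local Notation Y := series_solution.
Local Notation y0 := (volterra_sol rho omega lambda sigma c K b g0 al gamma f).

Let m2_ge0 : 0 <= m2. Proof. by rewrite mulr_ge0// subr_ge0 ltW. Qed.
Let m1_ge0 : 0 <= m1. Proof. by rewrite mulr_ge0// subr_ge0// ltW. Qed.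
Let b_gt0 : 0 < b. Proof. by rewrite ltr_wpDl. Qed.
Let sigma_gt0 : 0 < sigma. Proof. by rewrite mulr_gt0. Qed.
Let ok_one g : prabhakar_index 1 g. Proof. by left. Qed.
Let kS m g (m0 : 0 < m) : abel_kernel m (S m g) :=
  abel_kernel_resolvent omega lambda c rho0 sigma_gt0 g m0.
Let iS m g (m0 : 0 < m) : loc_integrable (S m g) := abel_kernel_loc_integrable m0 (kS g m0).
Let inner_ok := inner_index gamma al1 nu1.
Let outer_ok := outer_index gamma al1 nu0.

Lemma series_solution_aeq : aeq Y y0.
Proof.
apply: ae_imp (ae_rlk_finite al0 locf) => x fx x0.
by rewrite /Y /volterra_sol stermE.
Qed.

Lemma loc_integrable_series_solution : loc_integrable Y.
Proof.
have mY : cmeasurable [set: R] (causal Y).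
  apply: cmeasurable_causal; apply: cmeasurableD; last exact: cmeasurable_sterm_sum.
  by apply: cmeasurableM; [exact: cmeasurable_cst|case: (kS g0 b_gt0)].
have iy0 := loc_integrable_volterra_sol omega lambda c rho0 sigma_gt0 K g0 gamma b_gt0 al0 locf.
apply/loc_integrableP; split => // r.
have /loc_integrableP[_ /(_ r)] := iy0; apply: le_lt_trans; rewrite le_eqVlt.
apply/orP; left; apply/eqP; apply: ae_eq_integral_nonmeasurable.
apply: ae_imp (ae_and series_solution_aeq (ae_neq 0)) => x [e /eqP xn].
rewrite /= in_itv/= => /andP[x0 _]; rewrite /amod !causal_ge0// e// lt_def xn.
by [].
Qed.

Section Density.
Variable w : R -> R[i].
Hypothesis iw : loc_integrable w.
Hypothesis Fw : forall x, 0 < x -> E (1 - m2) (gamma * nu) f x = cintegral `[0, x] w.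

Let ok_n2 g : prabhakar_index (1 - m2) g.
Proof. by left; rewrite (_ : 1 - m2 = m1 + al); [rewrite ltr_wpDl|ring]. Qed.

(** [E m2 g2] complements the operator applied to [f] in [Fw]: applying it to both sides gives the
    integrals of [f] and of [E m2 g2 w], and integration is cancelled. *)
Lemma source_density : aeq f (E m2 g2 w).
Proof.
apply: (prabhakar_1_0_inj (rho := rho) (omega := omega) locf).
  exact: loc_integrable_prabhakar.
have p1 : aeq (E m2 g2 (E (1 - m2) (gamma * nu) f)) (E 1 0 f).
  by apply: prabhakar_comp => //; ring.
have p2 : aeq (E m2 g2 (E (1 - m2) (gamma * nu) f)) (E m2 g2 (E 1 0 w)).
  by apply: prabhakar_aeq => //; apply: aeq_eq => x x0; rewrite Fw// prabhakar_1_0.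
have p3 : aeq (E m2 g2 (E 1 0 w)) (E (1 + m2) g2 w).
  by apply: prabhakar_comp => //; ring.
have p4 : aeq (E 1 0 (E m2 g2 w)) (E (1 + m2) g2 w).
  by apply: prabhakar_comp => //; ring.
have := ae_and (ae_and p1 p2) (ae_and p3 p4); apply: ae_imp => x [[e1 e2] [e3 e4]] x0.
by rewrite -(e1 x0) (e2 x0) (e3 x0) (e4 x0).
Qed.

Lemma cconv_kpos_source m g x : 0 < m -> 0 < x -> rlk_finite (m + m2) w x ->
  cconv (kp m g) f x = cconv (kp (m + m2) (g + g2)) w x.
Proof.
move=> m0 x0 fw.
transitivity (cconv (kp m g) (E m2 g2 w) x).
  by apply: eq_cconv => //; exact: source_density.
have [m2_gt0|[m20 g20]] := outer_ok; last by rewrite m20 g20 prabhakar0 !addr0.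
rewrite prabhakar_cconv// (abel_cconvA m0 m2_gt0 (abel_kernel_kpos omega rho0 g m0)
  (abel_kernel_kpos omega rho0 g2 m2_gt0) iw x0 fw).
by apply: eq_cconv; [move=> t t0; exact: cconv_kpos|exact: aeW].
Qed.

(** Passing from [f] to [w] raises the indices of the source term from [(al, gamma)] to [(b, g0)],
    those of the term in [K]; one resolvent then serves both. *)
Lemma series_solutionE x : 0 < x -> rlk_finite b w x ->
  Y x = K * S b g0 x + cconv (S b g0) w x.
Proof.
move=> x0 fw; rewrite /Y -(stermE omega lambda c rho0 sigma_gt0 g0 b_gt0 iw x0 fw).
congr (_ + csum _); apply/funext => n; rewrite /sterm; congr (_ * _).
have fn : rlk_finite (al + n%:R * sigma + m2) w x.
  apply: rlk_finite_le b_gt0 _ iw x0 fw.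
  by rewrite addrAC (addrC al) lerDl mulr_ge0// ltW.
rewrite (cconv_kpos_source _ (rterm_index_gt0 sigma_gt0 n al0) x0 fn).
have -> : al + n%:R * sigma + m2 = b + n%:R * sigma by ring.
by have -> : gamma + n%:R * c + g2 = g0 + n%:R * c by ring.
Qed.

(** The inner operator brings all orders to at least [m1 + b = 1], so the identity holds at every
    [x > 0], as the pointwise conditions on [hp_inner] demand. *)
Lemma inner_series_solution x : 0 < x ->
  E m1 g1 Y x = K * S 1 0 x + cconv (S 1 0) w x.
Proof.
move=> x0; have m1b : m1 + b = 1 by ring.
have g1g0 : g1 + g0 = 0 by ring.
have f1 : rlk_finite (m1 + b) w x by apply: rlk_finite_ge1; rewrite ?m1b.
have [m1_gt0|[m10 g10]] := inner_ok; last first.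
  rewrite m10 g10 prabhakar0; rewrite m10 add0r in m1b; rewrite g10 add0r in g1g0.
  have fb : rlk_finite b w x by apply: rlk_finite_ge1 => //; rewrite m1b.
  by rewrite (series_solutionE x0 fb) m1b g1g0.
have k1 := abel_kernel_kpos omega rho0 g1 m1_gt0.
have mk1 := abel_kernel_cmeasurable k1; have kb := kS g0 b_gt0.
have nS : (nconv (amod (kp m1 g1)) (amod (S b g0)) x < +oo)%E.
  apply: (abel_kernel_nconv_lty m1_gt0 k1 (iS g0 b_gt0) x0).
  exact: abel_kernel_rlk_finite kb.
have iSw : loc_integrable (cconv (S b g0) w) by apply: loc_integrable_cconv => //; exact: iS.
rewrite prabhakar_cconv//.
transitivity (cconv (kp m1 g1) (fun x => K * S b g0 x + cconv (S b g0) w x) x).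
  apply: eq_cconv => //; apply: ae_imp (ae_rlk_finite b_gt0 iw) => t ft t0.
  exact: series_solutionE.
rewrite cconvDr//; last 3 first.
- by apply: loc_integrableZ; exact: iS.
- by apply: nconv_amodZr => //; exact: iS.
- exact: abel_nconv_cconv_lty f1.
rewrite cconvZr//; last exact: iS.
rewrite (abel_cconvA m1_gt0 b_gt0 k1 kb iw x0 f1).
have RE t : 0 < t -> cconv (kp m1 g1) (S b g0) t = S 1 0 t.
  move=> t0; rewrite (kpos_cconv_resolvent omega lambda c rho0 sigma_gt0 g1 g0 m1_gt0 b_gt0 t0).
  by rewrite m1b g1g0.
by congr (K * _ + _); [exact: RE|apply: eq_cconv; [exact: RE|exact: aeW]].
Qed.

Lemma inner_series_primitive : exists2 W, loc_integrable W &
  forall x, 0 < x -> E m1 g1 Y x = K + cintegral `[0, x] W.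
Proof.
pose T := S sigma c; have kT : abel_kernel sigma T := kS c sigma_gt0.
have iT : loc_integrable T := iS c sigma_gt0.
have iTw : loc_integrable (cconv T w) by exact: loc_integrable_cconv.
(* By [resolventE], [S 1 0] is 1 plus [lambda] times the primitive of [T]. Substituting this in
   [inner_series_solution] leaves the constant [K] and the primitive of the function given here. *)
exists (fun x => K * lambda * T x + (lambda * cconv T w x + w x)).
  apply: loc_integrableD; first exact: loc_integrableZ.
  by apply: loc_integrableD => //; exact: loc_integrableZ.
move=> x x0; rewrite inner_series_solution//.
have I (q r : R -> R[i]) (z : R[i]) : loc_integrable q -> loc_integrable r ->
    cintegral `[0, x] (fun t => z * q t + r t) = z * cintegral `[0, x] q + cintegral `[0, x] r.
  by move=> iq ir; rewrite cintegralD ?cintegralZl//; exact: cintegrableZl.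
rewrite I//; last by apply: loc_integrableD => //; exact: loc_integrableZ.
rewrite I// -!(prabhakar_1_0 rho omega).
have TE t : 0 < t -> S (1 + sigma) (0 + c) t = E 1 0 T t.
  by move=> t0; rewrite prabhakar_cconv// kpos_cconv_resolvent.
rewrite (resolventE omega lambda c rho0 sigma_gt0 0 x ltr01) TE// kpos_1_0//.
rewrite (resolvent_cconvE omega lambda c rho0 sigma_gt0 0 ltr01 iw x0); last exact: rlk_finite_ge1.
have -> : cconv (S (1 + sigma) (0 + c)) w x = E 1 0 (cconv T w) x.
  rewrite prabhakar_cconv// (abel_cconvA ltr01 sigma_gt0 (abel_kernel_kpos omega rho0 0 ltr01) kT iw x0).
    by apply: eq_cconv; [move=> t t0; rewrite kpos_cconv_resolvent|exact: aeW].
  by apply: rlk_finite_ge1 => //; rewrite lerDl ltW.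
by rewrite mulrDr mulr1 mulrA -!addrA.
Qed.

End Density.

End ExistenceOfSolution.

Local Opaque Gamma kpos ker prabhakar mittag_leffler.

Unset Implicit Arguments.

Theorem theorem4p1 (R : realType) (mu nu rho K gamma delta : R)
    (omega lambda : R[i]) (f : R -> R[i])
    (mu_gt0 : 0 < mu) (mu_lt1 : mu < 1) (nu_ge0 : 0 <= nu) (nu_le1 : nu <= 1)
    (rho_gt0 : 0 < rho) (K_ge0 : 0 <= K) (gamma_ge0 : 0 <= gamma)
    (delta_ge0 : 0 <= delta) (fL1 : cintegrable `[0, +oo[ f) :
  let u (x : R) (n : nat) : R[i] :=
    let beta := nu * (1 - mu) + mu * (2 * n + 1)%:R in
    lambda ^+ n * (x `^ (beta - 1))%:C
    * mittag_leffler rho beta (gamma - gamma * nu + n%:R * (delta + gamma))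
        (omega * (x `^ rho)%:C) in
  let v (x : R) (n : nat) : R[i] :=
    lambda ^+ n
    * prabhakar (gamma + n%:R * (delta + gamma)) rho ((2 * n + 1)%:R * mu)
        omega f x in
  let Y (x : R) : R[i] := K%:C * csum (u x) + csum (v x) in
  let F := prabhakar (gamma * nu) rho (1 - nu * (1 - mu)) omega f in
  [/\ {ae @lebesgue_measure R, forall x, 0 < x ->
        cvgn (cseries (u x)) /\ cvgn (cseries (v x))},
      (forall y : R -> R[i],
        hp_solution gamma delta mu nu rho omega lambda K f y <->
        [/\ hp_domain gamma mu nu rho omega y,
            hp_initial gamma mu nu rho omega K y &
            {ae @lebesgue_measure R, forall x, 0 < x -> y x = Y x}]) &
      (loc_abs_continuous F ->
       (F x : R[i]^o) @[x --> 0^'+] --> (0 : R[i]^o) ->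
       hp_solution gamma delta mu nu rho omega lambda K f Y)].
Proof.
move=> u v Y F.
have locf : loc_integrable f.
  by move=> b; split; [apply: integrableS fL1.1|apply: integrableS fL1.2];
    rewrite //; apply: subset_itvl.
have b_gt0 : 0 < nu * (1 - mu) + mu by rewrite ltr_wpDl// mulr_ge0// subr_ge0 ltW.
have sigma_gt0 : 0 < 2 * mu by rewrite mulr_gt0.
have uE x : 0 < x -> u x = rterm rho omega lambda (2 * mu) (delta + gamma)
    (nu * (1 - mu) + mu) (gamma - gamma * nu) ^~ x.
  move=> x0; apply/funext => n.
  rewrite (@rterm_mittag_leffler R rho _ _ x omega lambda _ _ n x0).
  have E : nu * (1 - mu) + mu * (2 * n + 1)%:R = nu * (1 - mu) + mu + n%:R * (2 * mu).
    by rewrite natrD natrM; ring.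
  by rewrite /u E.
have vE x : v x = sterm rho omega lambda (2 * mu) (delta + gamma) mu gamma f x.
  apply/funext => n; rewrite /v /sterm; congr (_ * _).
  have -> : (2 * n + 1)%:R * mu = mu + n%:R * (2 * mu) by rewrite natrD natrM; ring.
  by rewrite prabhakar_cconv//; exact: rterm_index_gt0.
pose y1 := series_solution rho mu nu gamma delta omega lambda K%:C f.
have YE x : 0 < x -> Y x = y1 x.
  by move=> x0; rewrite /Y uE// vE.
pose y0 := volterra_sol rho omega lambda (2 * mu) (delta + gamma) K%:C
  (nu * (1 - mu) + mu) (gamma - gamma * nu) mu gamma f.
have Yy0 : aeq Y y0.
  apply: (aeq_trans (aeq_eq YE)); exact: series_solution_aeq.
(* Domain and initial condition are common to both sides; they provide the density [w] that serves
   in both directions. *)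
have sol y : hp_domain gamma mu nu rho omega y -> hp_initial gamma mu nu rho omega K y ->
    aeq y y0 <-> hp_equation gamma delta mu nu rho omega lambda f y.
  move=> [iy acy] init; have [w [_ iw yw Dw]] := loc_ac_density acy init.
  (* The derivative is known almost everywhere only, but the outer operator maps it and [w] to
     functions equal almost everywhere. *)
  have outer := prabhakar_aeq rho omega (outer_index gamma mu_lt1 nu_ge0) Dw.
  split=> [yy0|eqn].
    have := solution_equation rho_gt0 mu_gt0 mu_lt1 nu_ge0 nu_le1 locf iy iw yw yy0.
    exact: aeq_trans outer.
  apply: (equation_solution rho_gt0 mu_gt0 mu_lt1 nu_ge0 nu_le1 locf iy iw yw).
  exact: aeq_trans (aeq_sym outer) eqn.
have sol_iff y : hp_solution gamma delta mu nu rho omega lambda K f y <->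
    [/\ hp_domain gamma mu nu rho omega y, hp_initial gamma mu nu rho omega K y & aeq y Y].
  split=> [[dom eqn init]|[dom init yY]].
    by split => //; apply: (aeq_trans _ (aeq_sym Yy0)); exact/sol.
  by split => //; apply/sol => //; exact: aeq_trans yY Yy0.
split.
- apply: aeW => x x0; split.
    by rewrite uE//; apply: (geometric_kernels_cvg b_gt0); exact: geometric_rterm.
  by rewrite vE; exact: sterm_cvg.
- exact: sol_iff.
(* Up to a null set, [F] is the image of the source term of index 0 under the inner operator. Its
   limit 0 makes it the primitive of [w] without constant, so the initial value remains [K]. *)
move=> acF F0; have [w [_ iw Fw _]] := loc_ac_density acF F0.
have Fw' x : 0 < x -> F x = cintegral `[0, x] w by move=> x0; rewrite Fw// add0r.
have [W iW IW] := inner_series_primitive delta lambda K%:C rho_gt0 mu_gt0 mu_lt1 nu_ge0 nu_le1 locf iw Fw'.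
have innerE x : 0 < x -> hp_inner gamma mu nu rho omega Y x = K%:C + cintegral `[0, x] W.
  move=> x0; rewrite -IW// /hp_inner.
  have [m1_gt0|[-> ->]] := inner_index gamma mu_lt1 nu_le1; last by rewrite !prabhakar0; exact: YE.
  by rewrite !prabhakar_cconv//; apply: eq_cconv => //; exact: aeq_eq.
have [acY initY] := primitive_loc_ac iW innerE.
apply/sol_iff; split => //; last exact: aeq_eq.
split => //; apply: (loc_integrable_eq_pos (q := y1)) => [x /YE//|].
exact: loc_integrable_series_solution.
Qed.
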